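(* Fix $m\in\mathbb{N}$ and $\mathfrak{D}\subset\mathbb{R}^m$ with positive Lebesgue measure that is the closure of its interior. For each $N$ and each $u\in\mathbb{R}^m$, let $H_N(u)$ be a random $N\times N$ real symmetric matrix and $\mu_N(u)$ a probability measure on $\mathbb{R}$. Assume: (Assumptions locally uniform in $u$) Either the family satisfies the locally uniform convexity-preserving-functional assumptions, or it satisfies the locally uniform concentrated-input assumptions, both given in the context. (Limit measures) There exist probability measures $\mu_\infty(u)$ on $\mathbb{R}$ such that $d_{\mathrm{BL}}(\mu_N(u),\mu_\infty(u))\le N^{-\kappa}$ if we are in the convexity-preserving-functional setting, or ${\rm W}_1(\mu_N(u),\mu_\infty(u))\le N^{-\kappa}$ if we are in the concentrated-input setting, for $\kappa=\kappa(u)>0$ that can be chosen uniformly on compact sets of $u$. These measures also admit densities $\mu_\infty(u,\cdot)$ on $[-\kappa,\kappa]$ that satisfy $\mu_\infty(u,x)<\kappa^{-1}|x|^{-1+\kappa}$ for all $|x|<\kappa$. (Continuity and decay in $u$) For each $N$, the map $u\mapsto H_N(u)$ is entrywise continuous. Furthermore, there exists $C>0$ such that $\mathbb{E}[|\det(H_N(u))|]\le(C\max(\|u\|,1))^N$. (Superexponential concentration) For every $R>0$ and every $\epsilon>0$, $$\lim_{N\to\infty}\frac{1}{N\log N}\log\left[\sup_{u\in B_R}\mathbb{P}(d_{\mathrm{BL}}(\hat\mu_{H_N(u)},\mu_\infty(u))>\epsilon)\right]=-\infty.$$ (No outliers) For every $R>0$ and every $\epsilon>0$, $$\lim_{N\to\infty}\inf_{u\in\mathfrak{D}\cap\mathcal{G}_{+\epsilon}\cap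 B_R}\mathbb{P}\big(\mathrm{Spec}(H_N(u))\subset[\mathtt{l}(\mu_\infty(u))-\epsilon,\mathtt{r}(\mu_\infty(u))+\epsilon]\big)=1.$$ (Topology) Each $\mathcal{G}_{+\epsilon}$ is convex; $\mathfrak{D}$ is convex and closed; the set $\mathfrak{D}\cap\mathcal{G}_{+1}$ has positive Lebesgue measure; and $$\overline{\mathfrak{D}\cap\Big(\bigcup_{\epsilon>0}\mathcal{G}_{+\epsilon}\Big)}=\mathfrak{D}\cap\mathcal{G}.$$ Then for any $\alpha>0$ and any fixed $p\in\mathbb{R}$, $$\lim_{N\to\infty}\frac1N\log\int_{\mathfrak{D}}e^{-(N+p)\alpha\|u\|^2}\mathbb{E}[|\det(H_N(u))|\mathbf{1}_{H_N(u)\ge0}]\,du=\sup_{u\in\mathfrak{D}\cap\mathcal{G}}\left\{\int_{\mathbb{R}}\log|\lambda|\,\mu_\infty(u)(d\lambda)-\alpha\|u\|^2\right\}.$$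
   Context: Notation. $B_R$ is the ball of radius $R$ around $0$ in $\mathbb{R}^m$. $\mathtt{l}(\mu)$, $\mathtt{r}(\mu)$ are the left and right edges (infimum and supremum of the support) of a compactly supported measure $\mu$. $\mathcal{G}=\{u\in\mathbb{R}^m:\mu_\infty(u)((-\infty,0))=0\}=\{u:\mathtt{l}(\mu_\infty(u))\ge0\}$ and, for $\epsilon>0$, $\mathcal{G}_{+\epsilon}=\{u\in\mathbb{R}^m:\mathtt{l}(\mu_\infty(u))\ge2\epsilon\}$. $H\ge0$ means positive semi-definite. $\mathscr{S}_N$ is the space of $N\times N$ real symmetric matrices with norm $\|T\|_{\widetilde F}^2=\sum_{i\le j}T_{ij}^2$. $\|\cdot\|_{\mathrm{Lip}}$ is the Lipschitz constant (Euclidean norms; $\|\cdot\|_{\widetilde F}$ on $\mathscr{S}_N$). $\hat\mu_T=\frac1N\sum_{i=1}^N\delta_{\lambda_i(T)}$ is the empirical spectral measure. $d_{\mathrm{BL}}(\mu,\nu)=\sup\{|\int f\,d(\mu-\nu)|:\|f\|_{\mathrm{Lip}}+\|f\|_{L^\infty}\le1\}$, ${\rm W}_1(\mu,\nu)=\sup\{|\int f\,d(\mu-\nu)|:\|f\|_{\mathrm{Lip}}\le1\}$, $d_{\mathrm{KS}}(\mu,\nu)=\sup_x|\mu((-\infty,x])-\nu((-\infty,x])|$. Locally uniform convexity-preserving-functional assumptions: for each $N,u$, $H_N(u)=\Phi_u(X(u))$, where $X(u)$ is a random vector in $\mathbb{R}^M$ ($M\ge1$ possibly depending on $N$) with independent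 real entries, and $\Phi_u=\Phi_{N,u}:\mathbb{R}^M\to\mathscr{S}_N$ is deterministic, Lipschitz, with $\Phi_u^{-1}(A)$ convex for every convex set $A$; and for every compact $Q\subset\mathbb{R}^m$ there are $\kappa,\delta>0$ such that, with $\lambda_i(u)$ the eigenvalues of $H_N(u)$ and $(X_{\mathrm{cut}}(u))_i=X(u)_i\mathbf{1}_{|X(u)_i|<N^{-\kappa}/\|\Phi_u\|_{\mathrm{Lip}}}$: (E) for all $u\in Q$ and all $N$, $d_{\mathrm{BL}}(\mathbb{E}\hat\mu_{H_N(u)},\mu_N(u))\le N^{-\kappa}$; the measures $\mu_N(u)$ are supported in a compact set common to all $N$ and $u\in Q$; each has a density $\mu_N(u,\cdot)$ on $(-\kappa,\kappa)$ with $\mu_N(u,x)<\kappa^{-1}|x|^{-1+\kappa}$ for $|x|<\kappa$; (C) for every $\epsilon>0$, $\lim_N\sup_{u\in Q}\frac1N\log\mathbb{E}[\prod_{i=1}^N(1+|\lambda_i(u)|\mathbf{1}_{|\lambda_i(u)|>e^{N^\epsilon}})]=0$ and $\lim_N\inf_{u\in Q}\mathbb{P}(H_N(u)\text{ has no eigenvalues in }[-e^{-N^\epsilon},e^{-N^\epsilon}])=1$; and $\limsup_N\sup_{u\in Q}\frac1{N\log N}\log\mathbb{E}[|\det(H_N(u))|^{1+\delta}]<\infty$; (S) $\lim_N\frac1{N\log N}\log\sup_{u\in Q}\mathbb{P}(d_{\mathrm{KS}}(\hat\mu_{\Phi_u(X(u))},\hat\mu_{\Phi_u(X_{\mathrm{cut}}(u))})>N^{-\kappa})=-\infty$.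 Locally uniform concentrated-input assumptions: for every compact $Q\subset\mathbb{R}^m$ there are $\kappa,\epsilon_0>0$ such that: (W) the statement (E) above holds with $d_{\mathrm{BL}}$ replaced by ${\rm W}_1$; (L) for every $\zeta>0$ there is $c_\zeta>0$ such that for all $u\in Q$, all $N$, all Lipschitz $f:\mathbb{R}\to\mathbb{R}$ and all $\delta>0$, $$\mathbb{P}\left(\left|\tfrac1N\mathrm{Tr}f(H_N(u))-\tfrac1N\mathbb{E}\,\mathrm{Tr}f(H_N(u))\right|>\delta\right)\le\exp\left(-\frac{c_\zeta}{N^\zeta}\min\left\{\left(\tfrac{N\delta}{\|f\|_{\mathrm{Lip}}}\right)^2,\left(\tfrac{N\delta}{\|f\|_{\mathrm{Lip}}}\right)^{1+\epsilon_0}\right\}\right);$$ (Gap) for every $\epsilon>0$, $\lim_N\inf_{u\in Q}\mathbb{P}(H_N(u)\text{ has no eigenvalues in }[-e^{-N^\epsilon},e^{-N^\epsilon}])=1$. *)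

(* Defs.v *)
From HB Require Import structures.
From mathcomp Require Import all_boot all_order all_algebra.
From mathcomp Require Import all_classical all_reals all_analysis.

Set Implicit Arguments.
Unset Strict Implicit.
Unset Printing Implicit Defensive.

Import Order.TTheory GRing.Theory Num.Theory.
Import numFieldNormedType.Exports.

Local Open Scope classical_set_scope.
Local Open Scope ring_scope.

Definition measure_mx_display : measure_display -> measure_display.
Proof. exact. Qed.

Section measurable_matrix.
Context d (T : measurableType d) (p q : nat).

Definition mx_preimages : set (set 'M[T]_(p, q)) :=
  \bigcup_(ij in [set: 'I_p * 'I_q])
    preimage_set_system setT (fun A : 'M[T]_(p, q) => A ij.1 ij.2) measurable.

Let mx_set0 : <<s mx_preimages >> set0.
Proof. exact: sigma_algebra0. Qed.

Let mx_setC A : <<s mx_preimages >> A -> <<s mx_preimages >> (~` A).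
Proof. exact: sigma_algebraC. Qed.

Let mx_bigcup (F : (set 'M[T]_(p, q))^nat) :
  (forall i, <<s mx_preimages >> (F i)) ->
  <<s mx_preimages >> (\bigcup_i F i).
Proof. exact: sigma_algebra_bigcup. Qed.

HB.instance Definition _ := @isMeasurable.Build (measure_mx_display d)
  'M[T]_(p, q) <<s mx_preimages >> mx_set0 mx_setC mx_bigcup.

Lemma measurable_entry i j :
  measurable_fun setT (fun A : 'M[T]_(p, q) => A i j).
Proof.
move=> _ Y mY; rewrite setTI; apply: sub_sigma_algebra.
by exists (i, j) => //; exists Y => //; rewrite setTI.
Qed.

Lemma measurable_fun_mx d' (T' : measurableType d') (f : T' -> 'M[T]_(p, q)) :
  (forall i j, measurable_fun setT (fun x => f x i j)) -> measurable_fun setT f.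
Proof.
move=> mf; apply: (@measurability _ _ _ _ _ _ mx_preimages) => //.
move=> _ [_ [[i j] _ [Y mY <-]] <-].
rewrite setTI setTI -comp_preimage -[X in measurable X]setTI.
exact: mf.
Qed.

End measurable_matrix.

Section lebesgue_rV.
Context {R : realType}.

Definition rV_cons (m : nat) (z : measurableTypeR R * 'rV[R]_m) : 'rV[R]_m.+1 :=
  row_mx (const_mx z.1 : 'rV_1) z.2.

Definition rV_uncons (m : nat) (v : 'rV[R]_m.+1) :
    measurableTypeR R * 'rV[R]_m :=
  (v ord0 ord0, rsubmx (v : 'rV_(1 + m))).

Lemma rV_consK m : cancel (@rV_cons m) (@rV_uncons m).
Proof.
move=> [x v]; rewrite /rV_cons /rV_uncons row_mxKr; congr pair.
by rewrite mxE; case: splitP => // j _; rewrite mxE.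
Qed.

Lemma measurable_rV_cons m : measurable_fun setT (@rV_cons m).
Proof.
apply: measurable_fun_mx => i j.
rewrite /rV_cons; under eq_fun do rewrite mxE.
case: (fintype.split (j : 'I_(1 + m))) => k.
  by under eq_fun do rewrite mxE; exact: measurable_fst.
apply: (@measurableT_comp _ _ _ _ _ _ (fun v : 'rV[R]_m => v i k)) => //.
exact: measurable_entry.
Qed.

Lemma measurable_rV_uncons m : measurable_fun setT (@rV_uncons m).
Proof.
apply: measurable_fun_pair; first exact: measurable_entry.
apply: measurable_fun_mx => i j.
under eq_fun do rewrite mxE; exact: measurable_entry.
Qed.

Section step.
Context (m : nat) (mu : {sigma_finite_measure set 'rV[R]_m -> \bar R}).

Definition leb_step : set 'rV[R]_m.+1 -> \bar R :=
  pushforward (lebesgue_measure \x mu)%E (@rV_cons m).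

Let leb_step0 : leb_step set0 = 0%E.
Proof. by rewrite /leb_step /pushforward preimage_set0 measure0. Qed.

Let leb_step_ge0 A : (0 <= leb_step A)%E.
Proof. by rewrite /leb_step /pushforward measure_ge0. Qed.

Let leb_step_sigma_additive : semi_sigma_additive leb_step.
Proof.
have mF A : measurable A -> measurable (@rV_cons m @^-1` A).
  by move=> mA; rewrite -[X in measurable X]setTI; exact: measurable_rV_cons.
move=> F mFn tF mUF; rewrite /leb_step /pushforward preimage_bigcup.
apply: measure_semi_sigma_additive.
- by move=> n; exact: mF.
- apply/trivIsetP => /= i j _ _ ij; rewrite -preimage_setI.
  by move/trivIsetP : tF => /(_ _ _ _ _ ij) ->//; rewrite preimage_set0.
- by rewrite -preimage_bigcup; exact: mF.
Qed.

HB.instance Definition _ := isMeasure.Build _ _ _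
  leb_step leb_step0 leb_step_ge0 leb_step_sigma_additive.

Let leb_step_sigma_finite : sigma_finite setT leb_step.
Proof.
have /sigma_finiteP[F [TF ndF Foo]] := sigma_finiteT (@lebesgue_measure R).
have /sigma_finiteP[G [TG ndG Goo]] := sigma_finiteT mu.
exists (fun n => @rV_uncons m @^-1` (F n `*` G n)).
  apply/esym; rewrite -subTset => v _ /=.
  have [n _ Fn] : (\bigcup_n F n) (rV_uncons v).1 by rewrite -TF.
  have [k _ Gk] : (\bigcup_n G n) (rV_uncons v).2 by rewrite -TG.
  exists (maxn n k) => //; split.
    by have /subsetPset := ndF _ _ (leq_maxl n k); exact.
  by have /subsetPset := ndG _ _ (leq_maxr n k); exact.
move=> n; have [mF Fn] := Foo n; have [mG Gn] := Goo n.
have mFG : measurable (F n `*` G n) by exact: measurableX.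
split.
  by rewrite -[X in measurable X]setTI; exact: measurable_rV_uncons.
rewrite /leb_step /pushforward/= [X in (_ X < _)%E](_ : _ = F n `*` G n).
  by rewrite product_measure1E// lte_mul_pinfty// ge0_fin_numE.
by apply/funext => z; rewrite -[RHS](congr1 (F n `*` G n) (rV_consK z)).
Qed.

HB.instance Definition _ :=
  @Measure_isSigmaFinite.Build _ _ _ leb_step leb_step_sigma_finite.

End step.

Fixpoint leb (m : nat) : {sigma_finite_measure set 'rV[R]_m -> \bar R} :=
  if m is k.+1 then leb_step (leb k) else \d_(0 : 'rV[R]_0).

End lebesgue_rV.

(* The library norm on matrices is the sup norm. *)
Definition enorm (R : realType) (m : nat) (u : 'rV[R]_m) : R :=
  Num.sqrt (\sum_i u ord0 i ^+ 2).

Definition eball (R : realType) (m : nat) (r : R) : set 'rV[R]_m :=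
  [set u | enorm u < r].

Definition symF_norm (R : realType) (n : nat) (T : 'M[R]_n) : R :=
  Num.sqrt (\sum_(i < n) \sum_(j < n | (i <= j)%N) T i j ^+ 2).

Definition sym_mx (R : realType) (n : nat) : set 'M[R]_n :=
  [set T | T^T = T].

(* The pairs x = y contribute 0 / 0 = 0. *)
Definition lip (R : realType) (V W : zmodType) (nV : V -> R) (nW : W -> R)
    (f : V -> W) : \bar R :=
  ereal_sup [set (nW (f z.1 - f z.2) / nV (z.1 - z.2))%:E | z in [set: V * V]].

Section spectrum.
Context {R : realType} {n : nat}.
Implicit Type T : 'M[R]_n.

(* Eigenvalues with multiplicity, in nondecreasing order; the default [::] is
   never used when T is symmetric, by the spectral theorem. *)
Definition eigvals T : seq R :=
  xget [::] [set s : seq R |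
    sorted <=%R s /\ char_poly T = \prod_(x <- s) ('X - x%:P)].

Definition esd T : {measure set (measurableTypeR R) -> \bar R} :=
  mscale (n%:R^-1)%:nng
    (msum (fun i => \d_(nth 0 (eigvals T) i : measurableTypeR R)) n).

Definition tr_fun (f : R -> R) T : R := \sum_(x <- eigvals T) f x.

Definition psd T : Prop := forall v : 'cV[R]_n, 0 <= (v^T *m T *m v) ord0 ord0.

End spectrum.

(* The averaged measure, as a set function: the distances below only need
   measures as set functions. *)
Definition mean_esd {R : realType} {n : nat} d (Om : measurableType d)
    (P : probability Om R) (T : Om -> 'M[R]_n) :
    set (measurableTypeR R) -> \bar R :=
  fun B => (\int[P]_w esd (T w) B)%E.

Section distances.
Context {R : realType}.
Implicit Types mu nu : set (measurableTypeR R) -> \bar R.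
Local Open Scope ereal_scope.

Definition lipR (f : R -> R) : \bar R := lip Num.norm Num.norm f.

Definition supnorm (f : R -> R) : \bar R :=
  ereal_sup [set `|f x|%R%:E | x in [set: R]].

Definition int_gap mu nu (f : R -> R) : \bar R :=
  `| \int[mu]_x (f x)%:E - \int[nu]_x (f x)%:E |.

Definition dBL mu nu : \bar R :=
  ereal_sup [set int_gap mu nu f | f in [set f | lipR f + supnorm f <= 1]].

Definition W1 mu nu : \bar R :=
  ereal_sup [set int_gap mu nu f | f in [set f | lipR f <= 1]].

Definition dKS mu nu : \bar R :=
  ereal_sup [set `| mu `]-oo, x]%classic - nu `]-oo, x]%classic | | x in [set: R]].

Definition msupport mu : set R :=
  [set x | forall U : set R, open U -> U x -> 0 < mu U].

Definition ledge mu : \bar R := ereal_inf (EFin @` msupport mu).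

Definition redge mu : \bar R := ereal_sup (EFin @` msupport mu).

(* mu has on I a density bounded by kappa^-1 |x|^(-1 + kappa) for |x| < kappa.
   At x = 0 the bound is infinite (kappa < 1) whereas powR gives 0; that single
   point is excluded. *)
Definition density_near0 mu (I : set R) (kappa : R) : Prop :=
  exists g : R -> R,
    [/\ measurable_fun I g,
        (forall x, I x -> (0 <= g x)%R),
        (forall B : set R, measurable B -> B `<=` I ->
           mu B = \int[lebesgue_measure]_(x in B) (g x)%:E) &
        (forall x, (0 < `|x| < kappa)%R ->
           (g x < kappa^-1 * `|x| `^ (-1 + kappa))%R)].

End distances.

Definition independent_entries {R : realType} d (Om : measurableType d)
    (P : probability Om R) (k : nat) (X : Om -> 'rV[R]_k) : Prop :=
  forall (J : {set 'I_k}) (A : 'I_k -> set R), (forall i, measurable (A i)) ->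
    fine (P [set w | forall i, i \in J -> A i (X w ord0 i)]) =
    \prod_(i in J) fine (P [set w | A i (X w ord0 i)]).

Section assumptions.
Context {R : realType} {m : nat} {d : nat -> measure_display}
  {Om : forall N, measurableType (d N)} (P : forall N, probability (Om N) R)
  (H : forall N, 'rV[R]_m -> {RV (P N) >-> 'M[R]_N})
  (mu : nat -> 'rV[R]_m -> probability (measurableTypeR R) R).
Implicit Types (Q : set 'rV[R]_m) (kappa : R).
Local Open Scope ereal_scope.

Definition speedNlogN (N : nat) : \bar R := ((N%:R * ln N%:R)^-1)%R%:E.

Definition mean_close
    (dist : (set (measurableTypeR R) -> \bar R) ->
            (set (measurableTypeR R) -> \bar R) -> \bar R) Q kappa : Prop :=
  [/\ (forall u N, Q u -> (0 < N)%N ->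
         dist (mean_esd (P N) (H N u)) (mu N u) <= (N%:R `^ (- kappa))%:E),
      (exists K : set R, compact K /\
         forall u N, Q u -> (0 < N)%N -> mu N u (~` K) = 0) &
      (forall u N, Q u -> (0 < N)%N ->
         density_near0 (mu N u) `](- kappa)%R, kappa[%classic kappa)].

Definition no_small_eigenvalue N (eps : R) (u : 'rV[R]_m) : set (Om N) :=
  let b := expR (- (N%:R `^ eps)) in
  [set w | forall x, eigenvalue (H N u w) x -> ~ (- b <= x <= b)%R].

Definition spectral_gap Q : Prop := forall eps : R, (0 < eps)%R ->
  (fun N => ereal_inf [set P N (no_small_eigenvalue (N := N) eps u) | u in Q])
    @ \oo --> 1.

Definition coarse_bounds Q (delta : R) : Prop :=
  [/\ (forall eps : R, (0 < eps)%R ->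
         (fun N => ereal_sup [set (N%:R^-1)%R%:E *
            lne 'E_(P N)[(fun w => \prod_(x <- eigvals (H N u w))
              (1 + `|x| * (expR (N%:R `^ eps) < `|x|)%R%:R))%R] | u in Q])
           @ \oo --> 0),
      spectral_gap Q &
      limn_esup (fun N => ereal_sup [set speedNlogN N *
         lne 'E_(P N)[fun w => (`|\det (H N u w)| `^ (1 + delta))%R] | u in Q])
        < +oo].

(* If L = 0 the quotient is 0 instead of +oo; phi is then constant, so the
   truncation of its argument is immaterial. *)
Definition cut (N : nat) kappa (L : R) (k : nat) (x : 'rV[R]_k) : 'rV[R]_k :=
  \row_i (if `|x ord0 i| < N%:R `^ (- kappa) / L then x ord0 i else 0)%R.

Definition lip_sym (k n : nat) (phi : 'rV[R]_k -> 'M[R]_n) : \bar R :=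
  lip (@enorm R k) (@symF_norm R n) phi.

Definition cut_close (M : nat -> nat)
    (X : forall N, 'rV[R]_m -> {RV (P N) >-> 'rV[R]_(M N)})
    (Phi : forall N, 'rV[R]_m -> 'rV[R]_(M N) -> 'M[R]_N) Q kappa : Prop :=
  (fun N => speedNlogN N * lne (ereal_sup [set
     P N [set w | (N%:R `^ (- kappa))%:E <
       dKS (esd (Phi N u (X N u w)))
           (esd (Phi N u
              (cut N kappa (fine (lip_sym (Phi N u))) (X N u w))))]
     | u in Q])) @ \oo --> -oo.

(* Q is taken nonempty: over an empty Q the suprema and infima in \bar R are
   -oo and +oo, and the limits required of them would fail. *)
Definition convexity_preserving : Prop :=
  exists (M : nat -> nat)
    (X : forall N, 'rV[R]_m -> {RV (P N) >-> 'rV[R]_(M N)})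
    (Phi : forall N, 'rV[R]_m -> 'rV[R]_(M N) -> 'M[R]_N),
  [/\ (forall N, (0 < N)%N -> (0 < M N)%N),
      (forall N u, (0 < N)%N ->
         [/\ (forall w, H N u w = Phi N u (X N u w)),
             independent_entries (P N) (X N u),
             (forall x, sym_mx (Phi N u x)),
             lip_sym (Phi N u) < +oo &
             (forall A : set 'M[R]_N, A `<=` @sym_mx R N -> convex_set A ->
                convex_set (Phi N u @^-1` A))]) &
      (forall Q, compact Q -> Q !=set0 ->
         exists kappa delta : R,
           [/\ (0 < kappa)%R, (0 < delta)%R, mean_close dBL Q kappa,
               coarse_bounds Q delta & cut_close X Phi Q kappa])].

(* If f is constant the bound degenerates to 1 instead of 0; the deviation is
   then identically 0. *)
Definition linear_statistics_concentrate Q (eps0 : R) : Prop :=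
  forall zeta : R, (0 < zeta)%R -> exists2 c : R, (0 < c)%R &
  forall u N (f : R -> R) (delta : R),
    Q u -> (0 < N)%N -> lipR f < +oo -> (0 < delta)%R ->
    P N [set w | delta%:E < `| (N%:R^-1 * tr_fun f (H N u w))%R%:E -
           (N%:R^-1)%R%:E * 'E_(P N)[fun w => tr_fun f (H N u w)] | ]
    <= (let t := (N%:R * delta / fine (lipR f))%R in
        expR (- (c / N%:R `^ zeta * Num.min (t ^+ 2) (t `^ (1 + eps0)))))%:E.

Definition concentrated_input : Prop :=
  forall Q, compact Q -> Q !=set0 ->
    exists kappa eps0 : R,
      [/\ (0 < kappa)%R, (0 < eps0)%R, mean_close W1 Q kappa,
          linear_statistics_concentrate Q eps0 & spectral_gap Q].

Section limit.
Context (muoo : 'rV[R]_m -> probability (measurableTypeR R) R).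

Definition limit_measures
    (dist : (set (measurableTypeR R) -> \bar R) ->
            (set (measurableTypeR R) -> \bar R) -> \bar R) : Prop :=
  forall Q, compact Q -> exists2 kappa : R, (0 < kappa)%R & forall u, Q u ->
    (forall N, (0 < N)%N ->
       dist (mu N u) (muoo u) <= (N%:R `^ (- kappa))%:E) /\
    density_near0 (muoo u) `[(- kappa)%R, kappa]%classic kappa.

Definition superexp_concentration : Prop :=
  forall r eps : R, (0 < r)%R -> (0 < eps)%R ->
    (fun N => speedNlogN N * lne (ereal_sup [set
       P N [set w | eps%:E < dBL (esd (H N u w)) (muoo u)]
       | u in @eball R m r])) @ \oo --> -oo.

Definition goodset : set 'rV[R]_m := [set u | muoo u `]-oo, 0%R[%classic = 0].

Definition goodset_eps (eps : R) : set 'rV[R]_m :=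
  [set u | (2 * eps)%R%:E <= ledge (muoo u)].

(* An infimum of probabilities over an empty set of parameters is read as 1,
   which makes the condition void there. *)
Definition no_outliers (D : set 'rV[R]_m) : Prop :=
  forall r eps : R, (0 < r)%R -> (0 < eps)%R ->
    D `&` goodset_eps eps `&` @eball R m r !=set0 ->
    (fun N => ereal_inf [set
       P N [set w | forall x, eigenvalue (H N u w) x ->
              ledge (muoo u) - eps%:E <= x%:E <= redge (muoo u) + eps%:E]
       | u in D `&` goodset_eps eps `&` @eball R m r]) @ \oo --> 1.

End limit.
End assumptions.

(* Main.v *)
(** Two estimates, uniform over compact sets of parameters, carry the proof. The
    spectral measure of H_N(u), tested against bounded Lipschitz functions,
    converges in mean to mu_oo(u); and, for every eta > 0,
      E|det H_N(u)| <= exp (N (int ln min(max(|x|, eta), K) dmu_oo(u) + o(1))),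
    together with a bound exp (O(N ln N)) on a moment of order 1 + delta of the
    determinant. For concentrated inputs both bounds on determinants come from
    the exponential tails of Tr ln max(|H_N(u)|, eta). In the
    convexity-preserving case one has to show that all but N^(1-b) eigenvalues
    lie in [-K, K] outside an event of probability exp (- A N ln N), for every
    A: the sums of the hinges (|x| - K)_+ over the eigenvalues are quasi-convex
    Lipschitz functions of the input, so Talagrand's inequality concentrates
    them for truncated inputs, and differences of two hinge sums count
    eigenvalues.

    The bound on the density of mu_oo(u) near 0 makes the integrals of the
    clamped logarithm converge uniformly to the logarithmic potential as eta
    tends to 0, so that the rate int ln|x| dmu_oo(u) - alpha |u|^2 is continuous
    in u, as is int min(x_-, 1) dmu_oo(u), which vanishes exactly on G.

    Upper bound: large u are negligible by the decay hypothesis. Where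
    mu_oo(u) gives mass bounded below to the negative axis, positivity of H_N(u)
    forces its spectral measure away from mu_oo(u), an event so rare that the
    moment of order 1 + delta makes its contribution negligible; elsewhere, by
    compactness, the rate is nearly at most its supremum over D and G.
    Lower bound: for u in D and G_(+eps), all eigenvalues are at least eps with
    probability close to 1, hence the determinant is at least
    exp (N (int ln|x| dmu_oo(u) - o(1))); by convexity D and G_(+eps) has
    positive volume near each of its points, and these sets are dense in the
    intersection of D and G. *)
Require Import Defs.
From HB Require Import structures.
From mathcomp Require Import all_boot all_order all_algebra perm.
From mathcomp Require Import all_classical all_reals all_analysis.
From mathcomp Require Import measurable_realfun.
From mathcomp Require Import ring lra.
From mathcomp Require complex.
Import -(notations, coercions) complex.

Set Implicit Arguments.
Unset Strict Implicit.
Unset Printing Implicit Defensive.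

Import Order.TTheory GRing.Theory Num.Theory.
Import numFieldNormedType.Exports.

Local Open Scope classical_set_scope.
Local Open Scope ring_scope.

(** * The spectral theorem *)

Section spectral.
Context {R : realType}.

(** Moments of the determinant are only bounded by [exp (O(N ln N))], so an event can be discarded
    only if its probability is below [exp (- A N ln N)] for every [A]; plain exponential
    concentration would not do. The number of eigenvalues outside [[-K, K]] is neither Lipschitz nor
    convex, whereas a hinge sum is both. Its Lipschitz constant in the input is [sqrt (2 N)] times
    that of [Phi], and truncated inputs are bounded by [N^(-kappa)] divided by the latter; a
    deviation [N^(1-b)] thus has an exponent of order [N^(1+2(kappa-b))], which beats [N ln N] once
    [b < kappa]. Each of the [O(N^(1-b))] remaining outliers may cost a factor [exp (N^(b/2))], in
    total [exp (O(N^(1-b/2)))], still subexponential. Continuity of the limit in [u] is inherited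
    from finite [N]: means of bounded Lipschitz statistics of [H N u] are continuous in [u] by
    dominated convergence, and they converge uniformly on compact sets. *)

Lemma sqn_rV_ge0 n (v : 'rV[R]_n) : 0 <= (v *m v^T) ord0 ord0.
Proof. by rewrite mxE sumr_ge0// => i _; rewrite !mxE -expr2 sqr_ge0. Qed.

Lemma sqn_rV_eq0 n (v : 'rV[R]_n) : ((v *m v^T) ord0 ord0 == 0) = (v == 0).
Proof.
apply/idP/idP => [|/eqP ->]; last by rewrite mul0mx mxE.
rewrite mxE psumr_eq0 => [/allP v0|i _]; last by rewrite !mxE -expr2 sqr_ge0.
apply/eqP/rowP => i; have := v0 i (mem_index_enum i).
by rewrite !mxE -expr2 sqrf_eq0 => /eqP.
Qed.

(* The eigenvector [x + i y] of the complexification has eigenvalue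
   [a + i b]; comparing [x T y^T] with its transpose gives
   [b (|x|^2 + |y|^2) = 0]. *)
Lemma sym_has_eigenvector n (T : 'M[R]_n.+1) : T^T = T ->
  exists a (v : 'rV_n.+1), v != 0 /\ v *m T = a *: v.
Proof.
move=> Ts; pose TC : 'M[complex.complex R]_n.+1 :=
  map_mx (complex.real_complex R) T.
have [c /eigenvalueP[v vT v0]] := eigenvalue_closed TC isT.
pose x := map_mx (@complex.Re R) v; pose y := map_mx (@complex.Im R) v.
pose a := complex.Re c; pose b := complex.Im c.
have ReD : {morph (@complex.Re R) : u w / u + w} by move=> [? ?] [? ?].
have ImD : {morph (@complex.Im R) : u w / u + w} by move=> [? ?] [? ?].
have xT : x *m T = a *: x - b *: y.
  apply/rowP => i; have /rowP/(_ i)/(congr1 (@complex.Re R)) := vT.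
  rewrite !mxE (big_morph (@complex.Re R) ReD (erefl _)) => H.
  rewrite -[RHS](_ : complex.Re (c * v ord0 i) = _); last first.
    by rewrite /a /b; case: c {vT H a b} => ? ?; case: (v _ _) => ? ?.
  rewrite -H; apply: eq_bigr => j _; rewrite !mxE.
  by case: (v _ _) => ? ? /=; rewrite mulr0 subr0.
have yT : y *m T = b *: x + a *: y.
  apply/rowP => i; have /rowP/(_ i)/(congr1 (@complex.Im R)) := vT.
  rewrite !mxE (big_morph (@complex.Im R) ImD (erefl _)) => H.
  rewrite -[RHS](_ : complex.Im (c * v ord0 i) = _); last first.
    rewrite /a /b; case: c {vT H a b xT} => ? ?; case: (v _ _) => ? ? /=.
    by rewrite addrC.
  rewrite -H; apply: eq_bigr => j _; rewrite !mxE.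
  by case: (v _ _) => ? ? /=; rewrite mulr0 add0r.
have b0 : b * ((x *m x^T) ord0 ord0 + (y *m y^T) ord0 ord0) = 0.
  have H1 : x *m T *m y^T = x *m (y *m T)^T by rewrite trmx_mul Ts mulmxA.
  have H2 : x *m y^T = (y *m x^T)^T by rewrite trmx_mul trmxK.
  move: H1; rewrite xT yT mulmxBl (raddfD (@trmx R 1 n.+1))/= !linearZ/= mulmxDr.
  rewrite -!scalemxAl -!scalemxAr => /(congr1 (fun Z : 'M[R]_(1, 1) => Z ord0 ord0)).
  rewrite !mxE => H1.
  have : b * (\sum_j x ord0 j * x^T j ord0) +
         b * (\sum_j y ord0 j * y^T j ord0) = 0.
    by apply/eqP; rewrite addr_eq0; apply/eqP; move: H1; lra.
  by rewrite -mulrDr.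
have xy0 : (x != 0) || (y != 0).
  apply: contraNT v0; rewrite negb_or !negbK => /andP[/eqP x0 /eqP y0].
  apply/eqP/rowP => i; rewrite !mxE.
  have /rowP/(_ i) := x0; have /rowP/(_ i) := y0; rewrite !mxE.
  by case: (v _ _) => ? ? /= -> ->.
have {}b0 : b = 0.
  move/eqP : b0; rewrite mulf_eq0 => /orP[/eqP//|].
  rewrite paddr_eq0 ?sqn_rV_ge0// !sqn_rV_eq0 => /andP[/eqP x0 /eqP y0].
  by move: xy0; rewrite x0 y0 eqxx.
case/orP : xy0 => [x0|y0]; [exists a, x|exists a, y]; split => //.
  by rewrite xT b0 scale0r subr0.
by rewrite yT b0 scale0r add0r.
Qed.

(** Reflection in the hyperplane orthogonal to [v - e], with [e] the first basis vector: as [v] and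
    [e] have the same length, it exchanges them. When [v = e] the identity serves. *)
Lemma householder n (v : 'rV[R]_n.+1) : v *m v^T = 1%:M ->
  exists Q : 'M[R]_n.+1, [/\ Q^T = Q, Q *m Q = 1%:M & delta_mx ord0 ord0 *m Q = v].
Proof.
move=> v1; pose e : 'rV[R]_n.+1 := delta_mx ord0 ord0.
have [w wE] : exists w, w = v - e by eexists.
have [w0|w0] := eqVneq w 0.
  exists 1%:M; rewrite trmx1 mulmx1; split => //; rewrite mulmx1.
  by move/eqP : w0; rewrite wE subr_eq0 => /eqP.
pose q := (w *m w^T) ord0 ord0.
have q0 : q != 0 by rewrite sqn_rV_eq0.
have ww : w *m w^T = q%:M by rewrite [LHS]mx11_scalar.
exists (1%:M - (2 / q) *: (w^T *m w)); split.
- by rewrite linearB/= linearZ/= trmx1 trmx_mul trmxK.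
- rewrite mulmxBl mul1mx mulmxBr mulmx1 -scalemxAl -scalemxAr scalerA.
  rewrite mulmxA -(mulmxA w^T) ww mul_mx_scalar -scalemxAl scalerA.
  move: (w^T *m w) => A; apply/matrixP => i j; rewrite !mxE.
  by field.
- rewrite mulmxBr mulmx1 -scalemxAr mulmxA [e *m w^T]mx11_scalar mul_scalar_mx.
  rewrite scalerA.
  have -> : (e *m w^T) ord0 ord0 = - (q / 2).
    have vv : (v *m v^T) ord0 ord0 = 1 by rewrite v1 mxE.
    have ee : (e *m e^T) ord0 ord0 = 1 by rewrite trmx_delta mul_delta_mx mxE.
    have ev : (e *m v^T) ord0 ord0 = (v *m e^T) ord0 ord0.
      by rewrite -[in LHS](trmxK e) -trmx_mul mxE.
    have -> : q = (v *m v^T) ord0 ord0 - 2 * (e *m v^T) ord0 ord0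
                  + (e *m e^T) ord0 ord0.
      rewrite /q wE linearB/= mulmxBl !mulmxBr.
      by move: ev; rewrite !mxE => ev; lra.
    have -> : (e *m w^T) ord0 ord0 =
        (e *m v^T) ord0 ord0 - (e *m e^T) ord0 ord0.
      by rewrite wE linearB/= mulmxBr !mxE.
    by rewrite vv ee; lra.
  rewrite (_ : 2 / q * _ = -1); last by field.
  by rewrite scaleN1r opprK wE addrC subrK.
Qed.

(** Deflation: conjugation by a reflection carrying the first basis vector to a unit eigenvector
    clears the first row beyond the diagonal, hence by symmetry the first column, and induction
    diagonalizes the remaining block. *)
Lemma sym_spectral n (T : 'M[R]_n) : T^T = T ->
  exists (V : 'M[R]_n) (d : 'rV[R]_n),
    V *m V^T = 1%:M /\ T = V^T *m diag_mx d *m V.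
Proof.
elim: n T => [|n IH] T Ts.
  by exists 1%:M, 0; split; apply/matrixP => -[].
have [a [v [v0 vT]]] := sym_has_eigenvector Ts.
pose q := (v *m v^T) ord0 ord0.
have q0 : 0 < q by rewrite lt_neqAle eq_sym sqn_rV_eq0 v0 sqn_rV_ge0.
pose u := (Num.sqrt q)^-1 *: v.
have u1 : u *m u^T = 1%:M.
  rewrite /u linearZ/= -scalemxAl -scalemxAr scalerA [_ *m _]mx11_scalar -/q.
  rewrite -invfM -expr2 sqr_sqrtr ?ltW// scale_scalar_mx mulVf// gt_eqF//.
have [Q [Qs QQ eQ]] := householder u1.
have uT : u *m T = a *: u by rewrite -scalemxAl vT scalerA mulrC -scalerA.
pose T' : 'M[R]_(1 + n) := Q *m T *m Q.
have T's : T'^T = T' by rewrite !trmx_mul Qs Ts mulmxA.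
have row0 : usubmx T' = row_mx a%:M 0.
  have -> : usubmx T' = delta_mx ord0 ord0 *m T'.
    rewrite -rowE; move: (T') => M; apply/rowP => j; rewrite !mxE.
    by congr (M _ _); apply/val_inj.
  rewrite /T' !mulmxA eQ uT -scalemxAl -eQ -mulmxA QQ mulmx1.
  apply/rowP => j; rewrite !mxE; case: splitP => k /= jk; rewrite !mxE.
    rewrite !ord1 [j == _](_ : _ = true) ?mulr1 ?mulr1n//.
    by rewrite -val_eqE/= jk ord1.
  by rewrite [j == _](_ : _ = false) ?mulr0// -val_eqE/= jk.
have T'E : T' = block_mx a%:M 0 0 (drsubmx T').
  rewrite -[LHS]submxK; congr block_mx.
  - by rewrite /ulsubmx row0 row_mxKl.
  - by rewrite /ursubmx row0 row_mxKr.
  - by rewrite -[LHS]trmxK trmx_dlsub T's /ursubmx row0 row_mxKr trmx0.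
have dT's : (drsubmx T')^T = drsubmx T' by rewrite trmx_drsub T's.
have [V [d [V1 VE]]] := IH (drsubmx T') dT's.
pose B : 'M[R]_(1 + n) := block_mx 1%:M 0 0 V.
pose D : 'rV[R]_(1 + n) := row_mx a%:M d.
have BB : B *m B^T = 1%:M.
  rewrite /B tr_block_mx mulmx_block.
  rewrite !(trmx0, mul0mx, mulmx0, trmx1, mul1mx, add0r, addr0) V1.
  by rewrite -scalar_mx_block.
have BD : B^T *m diag_mx D *m B = T'.
  rewrite T'E {1}VE /B /D diag_mx_row tr_block_mx !mulmx_block.
  rewrite !(trmx0, mul0mx, mulmx0, trmx1, mul1mx, mulmx1, add0r, addr0).
  congr block_mx; apply/matrixP => i j.
  by rewrite !mxE !ord1 eqxx !mulr1n.
exists (B *m Q), D; split.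
  by rewrite trmx_mul mulmxA -(mulmxA B) Qs QQ mulmx1 BB.
have -> : T = Q *m T' *m Q by rewrite /T' !mulmxA QQ mul1mx -mulmxA QQ mulmx1.
by rewrite trmx_mul Qs -BD !mulmxA.
Qed.

End spectral.

(** * Eigenvalues and trace functions *)

Section eigenvalues.
Context {R : realType}.

Definition ev n (T : 'M[R]_n) (i : nat) : R := nth 0 (eigvals T) i.

(** The Hilbert-Schmidt norm: summing over all entries, unlike [symF_norm], makes it invariant under
    orthogonal conjugation. *)
Definition hs n (E : 'M[R]_n) : R := Num.sqrt (\sum_i \sum_j E i j ^+ 2).

(* Convexity is used through supporting lines. *)
Definition subgradient (g : R -> R) (x : R) : Prop :=
  exists a b, g x = a * x + b /\ forall y, a * y + b <= g y.

(** Lagrange's identity: twice the difference of the two sides is the double sum of the squares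
    [(a i * b j - a j * b i) ^+ 2]. *)
Lemma cauchy_schwarz_sum (I : finType) (a b : I -> R) :
  (\sum_i a i * b i) ^+ 2 <= (\sum_i a i ^+ 2) * (\sum_i b i ^+ 2).
Proof.
have : 0 <= \sum_i \sum_j (a i * b j - a j * b i) ^+ 2.
  by apply: sumr_ge0 => i _; apply: sumr_ge0 => j _; rewrite sqr_ge0.
have -> : \sum_i \sum_j (a i * b j - a j * b i) ^+ 2 =
  \sum_i \sum_j (a i ^+ 2 * b j ^+ 2) + \sum_i \sum_j (b i ^+ 2 * a j ^+ 2)
  - 2 * \sum_i \sum_j ((a i * b i) * (a j * b j)).
  rewrite mulr_sumr -big_split -sumrB; apply: eq_bigr => i _ /=.
  rewrite mulr_sumr -big_split -sumrB; apply: eq_bigr => j _ /=; ring.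
rewrite [X in _ + X - _]exchange_big/=.
under [X in _ + X - _]eq_bigr do under eq_bigr do rewrite mulrC.
under eq_bigr do rewrite -mulr_sumr; rewrite -mulr_suml.
under [X in _ - _ * X]eq_bigr do rewrite -mulr_sumr.
rewrite -mulr_suml -expr2; lra.
Qed.

Lemma char_poly_spectral n (V : 'M[R]_n) (d : 'rV[R]_n) :
  V *m V^T = 1%:M ->
  char_poly (V^T *m diag_mx d *m V) = \prod_i ('X - (d ord0 i)%:P).
Proof.
move=> V1; have V1' := mulmx1C V1.
rewrite /char_poly.
have -> : char_poly_mx (V^T *m diag_mx d *m V) =
    map_mx polyC V^T *m char_poly_mx (diag_mx d) *m map_mx polyC V.
  rewrite /char_poly_mx mulmxBr mulmxBl !map_mxM/=; congr (_ - _).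
  rewrite mul_mx_scalar -scalemxAl -map_mxM V1' map_mx1.
  by rewrite scalemx1.
rewrite !det_mulmx mulrC mulrA -det_mulmx -map_mxM V1 map_mx1 det1 mul1r.
rewrite -/(char_poly _) char_poly_trig ?diag_mx_is_trig//.
by apply: eq_bigr => i _; rewrite mxE eqxx mulr1n.
Qed.

Variable n : nat.
Implicit Types T S V W E : 'M[R]_n.

Lemma eigvals_spec T : sym_mx T ->
  sorted <=%R (eigvals T) /\ char_poly T = \prod_(x <- eigvals T) ('X - x%:P).
Proof.
move=> Ts; rewrite /eigvals; case: xgetP => [s _ [? ?]//|no].
have [V [d [V1 TE]]] := sym_spectral Ts.
pose s := sort <=%R [seq d ord0 i | i <- index_enum 'I_n].
have /(_ s)[] := no; split; first exact: (sort_sorted (@le_total _ R)).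
rewrite TE char_poly_spectral// (perm_big _ (permEl (perm_sort _ _)))/=.
by rewrite big_map.
Qed.

Lemma eigvals_perm T V (d : 'rV[R]_n) : sym_mx T -> V *m V^T = 1%:M ->
  T = V^T *m diag_mx d *m V ->
  perm_eq (eigvals T) [seq d ord0 i | i <- index_enum 'I_n].
Proof.
move=> Ts V1 TE; apply: prod_XsubC_eq.
by rewrite -(eigvals_spec Ts).2 {1}TE char_poly_spectral// big_map.
Qed.

Lemma size_eigvals T : sym_mx T -> size (eigvals T) = n.
Proof.
move=> Ts; have [V [d [V1 TE]]] := sym_spectral Ts.
rewrite (perm_size (eigvals_perm Ts V1 TE)) size_map.
by rewrite /index_enum -enumT size_enum_ord.
Qed.

Lemma ev_le T i j : sym_mx T -> (i <= j < n)%N -> ev T i <= ev T j.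
Proof.
move=> Ts /andP[ij jn]; have [sT _] := eigvals_spec Ts.
apply: (sorted_leq_nth (@le_trans _ R) (@lexx _ R) 0 sT) => //.
  by rewrite inE size_eigvals// (leq_ltn_trans ij).
by rewrite inE size_eigvals.
Qed.

Lemma big_eigvals (idx : R) (op : Monoid.com_law idx) T (f : R -> R) :
  sym_mx T ->
  \big[op/idx]_(x <- eigvals T) f x = \big[op/idx]_(i < n) f (ev T i).
Proof.
move=> Ts; rewrite (big_nth 0) size_eigvals// big_mkord.
exact: eq_bigr.
Qed.

Lemma tr_funE T (f : R -> R) : sym_mx T -> tr_fun f T = \sum_(i < n) f (ev T i).
Proof. exact: big_eigvals. Qed.

(** The rows of an orthogonal diagonalizing matrix are permuted so that the diagonal follows the
    nondecreasing order of [eigvals], the order on which Weyl's inequality relies. *)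
Lemma sym_eigenbasis T : sym_mx T -> exists V,
  V *m V^T = 1%:M /\ T = V^T *m diag_mx (\row_i ev T i) *m V.
Proof.
move=> Ts; have [V [d [V1 TE]]] := sym_spectral Ts.
have := eigvals_perm Ts V1 TE.
have -> : [seq d ord0 i | i <- index_enum 'I_n] = [tuple d ord0 i | i < n].
  by rewrite /= -(tnth_mktuple); rewrite /index_enum -enumT.
move/tuple_permP => [s sE].
have evE i : ev T (nat_of_ord i) = d ord0 (s i).
  rewrite /ev sE -tnth_nth; rewrite !tnth_mktuple//.
exists (row_perm s V); split.
  apply/matrixP => i j; have /matrixP/(_ (s i) (s j)) := V1.
  rewrite !mxE (inj_eq perm_inj) => <-; apply: eq_bigr => k _.
  by rewrite !mxE.
rewrite {1}TE; apply/matrixP => i j; rewrite !mxE (reindex_inj (@perm_inj _ s)).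
apply: eq_bigr => k _; rewrite !mul_mx_diag !mxE evE.
by [].
Qed.

Lemma orth_row_sum W i : W *m W^T = 1%:M -> \sum_j W i j ^+ 2 = 1.
Proof.
move=> /matrixP/(_ i i); rewrite !mxE eqxx mulr1n => <-.
by apply: eq_bigr => j _; rewrite mxE expr2.
Qed.

Lemma orth_col_sum W j : W *m W^T = 1%:M -> \sum_i W i j ^+ 2 = 1.
Proof.
move=> /mulmx1C/matrixP/(_ j j); rewrite !mxE eqxx mulr1n => <-.
by apply: eq_bigr => i _; rewrite mxE expr2.
Qed.

Lemma det_ev T : sym_mx T -> \det T = \prod_(i < n) ev T i.
Proof.
move=> Ts; have [V [V1 TE]] := sym_eigenbasis Ts.
rewrite {1}TE !det_mulmx mulrC mulrA -det_mulmx V1 det1 mul1r det_diag.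
by apply: eq_bigr => i _; rewrite mxE.
Qed.

Lemma eigenvalue_ev T x : sym_mx T ->
  eigenvalue T x <-> exists2 i : 'I_n, true & x = ev T i.
Proof.
move=> Ts; rewrite eigenvalue_root_char (eigvals_spec Ts).2 root_prod_XsubC.
split=> [xT|[i _ ->]].
  have [i] := nthP 0 xT.
  by rewrite size_eigvals// => i_lt <-; exists (Ordinal i_lt).
by apply: mem_nth; rewrite size_eigvals.
Qed.

Lemma quad_form T V (d : 'rV[R]_n) (v : 'rV[R]_n) :
  T = V^T *m diag_mx d *m V ->
  (v *m T *m v^T) ord0 ord0 = \sum_j d ord0 j * (v *m V^T) ord0 j ^+ 2.
Proof.
move=> ->; rewrite !mulmxA -(mulmxA _ V) -[V *m v^T]trmxK trmx_mul trmxK.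
move: (v *m V^T) => w; rewrite mul_mx_diag mxE; apply: eq_bigr => j _.
by rewrite !mxE; ring.
Qed.

Lemma quad_form1 V (v : 'rV[R]_n) : V *m V^T = 1%:M ->
  \sum_j (v *m V^T) ord0 j ^+ 2 = \sum_j v ord0 j ^+ 2.
Proof.
move=> V1; have -> : \sum_j v ord0 j ^+ 2 = (v *m 1%:M *m v^T) ord0 ord0.
  by rewrite mulmx1 mxE; apply: eq_bigr => j _; rewrite !mxE expr2.
rewrite (@quad_form _ V (const_mx 1)); last first.
  by rewrite diag_const_mx mulmx1 mulmx1C.
by apply: eq_bigr => j _; rewrite [const_mx _ _ _]mxE mul1r.
Qed.

Lemma psd_ev T : sym_mx T -> psd T <-> forall i : 'I_n, 0 <= ev T i.
Proof.
move=> Ts; have [V [V1 TE]] := sym_eigenbasis Ts; split=> [Tp i|Tp v].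
  have := Tp (row i V)^T; rewrite trmxK (quad_form _ TE) (bigD1 i)//= big1 => [|j ji].
    rewrite addr0 -row_mul V1 !mxE eqxx expr1n mulr1.
    by [].
  by rewrite -row_mul V1 !mxE eq_sym (negbTE ji) expr0n mulr0.
rewrite -{2}(trmxK v) (quad_form _ TE) sumr_ge0// => i _.
by rewrite mxE mulr_ge0// sqr_ge0.
Qed.

(** Cauchy-Schwarz over pairs of indices: the form is the inner product of [E] with the rank-one
    matrix of [v], whose Hilbert-Schmidt norm is the squared length of [v]. *)
Lemma quad_le_hs E (v : 'rV[R]_n) :
  (v *m E *m v^T) ord0 ord0 <= hs E * \sum_j v ord0 j ^+ 2.
Proof.
have -> : (v *m E *m v^T) ord0 ord0 =
    \sum_(p : 'I_n * 'I_n) E p.1 p.2 * (v ord0 p.1 * v ord0 p.2).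
  rewrite mxE -(pair_bigA _ (fun i j => E i j * (v ord0 i * v ord0 j)))/=.
  rewrite exchange_big; apply: eq_bigr => j _; rewrite !mxE mulr_suml.
  by apply: eq_bigr => i _; ring.
rewrite (le_trans (ler_norm _))// -sqrtr_sqr.
have -> : hs E * \sum_j v ord0 j ^+ 2 =
    Num.sqrt ((\sum_(p : 'I_n * 'I_n) E p.1 p.2 ^+ 2) *
      \sum_(p : 'I_n * 'I_n) (v ord0 p.1 * v ord0 p.2) ^+ 2).
  rewrite sqrtrM; last by rewrite sumr_ge0// => p _; rewrite sqr_ge0.
  rewrite -(pair_bigA _ (fun i j => E i j ^+ 2))/=; congr (_ * _).
  rewrite -(pair_bigA _ (fun i j => (v ord0 i * v ord0 j) ^+ 2))/=.
  under [in RHS]eq_bigr do under eq_bigr do rewrite exprMn.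
  under [in RHS]eq_bigr do rewrite -mulr_sumr.
  rewrite -mulr_suml -expr2 sqrtr_sqr ger0_norm//.
  by rewrite sumr_ge0// => p _; rewrite sqr_ge0.
by rewrite ler_wsqrtr// cauchy_schwarz_sum.
Qed.

(* A nonzero vector orthogonal to the eigenvectors of [T] below [i] and to
   those of [S] above [i]: [n - 1] linear conditions. *)
Lemma weyl_le T S (i : 'I_n) : sym_mx T -> sym_mx S ->
  ev T i <= ev S i + hs (T - S).
Proof.
move=> Ts Ss; have [V [V1 TE]] := sym_eigenbasis Ts.
have [W [W1 SE]] := sym_eigenbasis Ss.
pose M : 'M[R]_n := \matrix_(k, j)
  if (j < i)%N then V j k else if (i < j)%N then W j k else 0.
have : \det M == 0.
  rewrite -det_tr (expand_det_row _ i) big1// => j _.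
  by rewrite !mxE ltnn mul0r.
case/det0P => v v0 vM.
have vV (j : 'I_n) : (j < i)%N -> (v *m V^T) ord0 j = 0.
  move=> ji; have /rowP/(_ j) := vM; rewrite mxE [RHS]mxE => H.
  rewrite mxE -[RHS]H.
  by apply: eq_bigr => k _; rewrite !mxE ji.
have vW (j : 'I_n) : (i < j)%N -> (v *m W^T) ord0 j = 0.
  move=> ij; have /rowP/(_ j) := vM; rewrite mxE [RHS]mxE => H.
  rewrite mxE -[RHS]H.
  by apply: eq_bigr => k _; rewrite !mxE ij ltnNge (ltnW ij).
pose q := \sum_j v ord0 j ^+ 2.
have q0 : 0 < q.
  rewrite lt_neqAle sumr_ge0 ?andbT => [|j _]; last by rewrite sqr_ge0.
  rewrite eq_sym -[q](_ : (v *m v^T) ord0 ord0 = _) ?sqn_rV_eq0//.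
  by rewrite mxE; apply: eq_bigr => j _; rewrite !mxE expr2.
have lT : ev T i * q <= (v *m T *m v^T) ord0 ord0.
  rewrite (quad_form _ TE) /q -(quad_form1 v V1) mulr_sumr; apply: ler_sum => j _.
  have [ji|ij] := ltnP j i; first by rewrite vV// expr0n !mulr0.
  by rewrite ler_wpM2r ?sqr_ge0// mxE ev_le// ij ltn_ord.
have uS : (v *m S *m v^T) ord0 ord0 <= ev S i * q.
  rewrite (quad_form _ SE) /q -(quad_form1 v W1) mulr_sumr; apply: ler_sum => j _.
  have [ji|ij] := ltnP i j; first by rewrite vW// expr0n !mulr0.
  by rewrite ler_wpM2r ?sqr_ge0// mxE ev_le// ij ltn_ord.
have := quad_le_hs (T - S) v; rewrite mulmxBr mulmxBl !mxE -/q => h.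
rewrite -(ler_pM2r q0) mulrDl.
move: lT uS h; rewrite !mxE; lra.
Qed.

Lemma hsN E : hs (- E) = hs E.
Proof.
by rewrite /hs; under eq_bigr do under eq_bigr do rewrite mxE sqrrN.
Qed.

Lemma weyl T S (i : 'I_n) : sym_mx T -> sym_mx S ->
  `|ev T i - ev S i| <= hs (T - S).
Proof.
move=> Ts Ss; rewrite ler_norml; apply/andP; split.
  by have := weyl_le i Ss Ts; rewrite -(hsN (S - T)) opprB; lra.
by have := weyl_le i Ts Ss; lra.
Qed.

Lemma jensen (I : finType) (w y : I -> R) (g : R -> R) :
  (forall x, subgradient g x) -> (forall i, 0 <= w i) -> \sum_i w i = 1 ->
  g (\sum_i w i * y i) <= \sum_i w i * g (y i).
Proof.
move=> gc w0 w1; have [a [b [-> gab]]] := gc (\sum_i w i * y i).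
rewrite mulr_sumr -[b]mulr1 -w1 mulr_sumr -big_split/=; apply: ler_sum => i _.
by have := ler_wpM2l (w0 i) (gab (y i)); lra.
Qed.

Lemma diag_conj T V (d : 'rV[R]_n) W i :
  T = V^T *m diag_mx d *m V ->
  (W *m T *m W^T) i i = \sum_j (W *m V^T) i j ^+ 2 * d ord0 j.
Proof.
move=> TE; have -> : (W *m T *m W^T) i i =
    (row i W *m T *m (row i W)^T) ord0 ord0.
  rewrite -row_mul !mxE.
  by apply: eq_bigr => k _; rewrite !mxE.
rewrite (quad_form _ TE); apply: eq_bigr => j _.
by rewrite -row_mul [in LHS]mxE mulrC.
Qed.

(** Peierls' inequality. Each diagonal entry is an average of the eigenvalues with weights the
    squared entries of an orthogonal matrix. These are doubly stochastic: row sums 1 allow Jensen's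
    inequality, column sums 1 restore the trace. *)
Lemma peierls T W (g : R -> R) : sym_mx T -> W *m W^T = 1%:M ->
  (forall x, subgradient g x) ->
  \sum_i g ((W *m T *m W^T) i i) <= tr_fun g T.
Proof.
move=> Ts W1 gc; have [V [V1 TE]] := sym_eigenbasis Ts.
have U1 : (W *m V^T) *m (W *m V^T)^T = 1%:M.
  by rewrite trmx_mul trmxK mulmxA -(mulmxA W) (mulmx1C V1) mulmx1.
have U2 i := orth_row_sum i U1; have U3 j := orth_col_sum j U1.
under eq_bigr do rewrite (diag_conj _ _ TE).
apply: (@le_trans _ _ (\sum_i \sum_j (W *m V^T) i j ^+ 2 * g (ev T j))).
  apply: ler_sum => i _; under eq_bigr do rewrite mxE.
  by apply: jensen => // j; rewrite sqr_ge0.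
rewrite exchange_big tr_funE//; apply: ler_sum => j _.
by rewrite -mulr_suml U3 mul1r.
Qed.

Lemma peierls_eq T V (g : R -> R) : sym_mx T -> V *m V^T = 1%:M ->
  T = V^T *m diag_mx (\row_i ev T i) *m V ->
  tr_fun g T = \sum_i g ((V *m T *m V^T) i i).
Proof.
move=> Ts V1 TE; rewrite tr_funE//; apply: eq_bigr => i _; congr g.
rewrite {2}TE !mulmxA V1 mul1mx -!mulmxA V1 mulmx1.
by rewrite !mxE eqxx mulr1n.
Qed.

(** In an eigenbasis of the combination [Z] the trace is a sum over diagonal entries, which depend
    linearly on the matrix; scalar convexity applies to each entry and Peierls' inequality bounds
    the two resulting sums. *)
Lemma tr_fun_convex T S (t : R) (g : R -> R) : sym_mx T -> sym_mx S ->
  0 <= t <= 1 -> (forall x, subgradient g x) ->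
  tr_fun g (t *: T + (1 - t) *: S) <= t * tr_fun g T + (1 - t) * tr_fun g S.
Proof.
move=> Ts Ss /andP[t0 t1] gc; set Z := _ + _.
have Zs : sym_mx Z.
  by rewrite /sym_mx/= /Z linearD/= !linearZ/= (Ts : T^T = T) (Ss : S^T = S).
have [V [V1 ZE]] := sym_eigenbasis Zs.
rewrite (peierls_eq _ Zs V1 ZE).
apply: (@le_trans _ _ (t * (\sum_i g ((V *m T *m V^T) i i)) +
    (1 - t) * (\sum_i g ((V *m S *m V^T) i i)))).
  rewrite !mulr_sumr -big_split; apply: ler_sum => i _ /=.
  have -> : (V *m Z *m V^T) i i =
      t * (V *m T *m V^T) i i + (1 - t) * (V *m S *m V^T) i i.
    by rewrite /Z mulmxDr mulmxDl -!scalemxAr -!scalemxAl !mxE.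
  have [a [b [-> gab]]] := gc (t * (V *m T *m V^T) i i + (1 - t) * (V *m S *m V^T) i i).
  have := ler_wpM2l t0 (gab ((V *m T *m V^T) i i)).
  have t1' : 0 <= 1 - t by lra.
  have := ler_wpM2l t1' (gab ((V *m S *m V^T) i i)).
  by lra.
rewrite lerD// ler_wpM2l ?peierls//; lra.
Qed.

(** In an eigenbasis of [T], Peierls' inequality for [S] leaves only the diagonal of [T - S];
    Cauchy-Schwarz over its [n] entries gives the factor [sqrt n]. *)
Lemma tr_fun_lip T S (c : R) (g : R -> R) : sym_mx T -> sym_mx S ->
  (forall x, subgradient g x) -> 0 <= c ->
  (forall x y, `|g x - g y| <= c * `|x - y|) ->
  tr_fun g T <= tr_fun g S + c * (Num.sqrt n%:R * hs (T - S)).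
Proof.
move=> Ts Ss gc c0 gl; have [V [V1 TE]] := sym_eigenbasis Ts.
rewrite (peierls_eq _ Ts V1 TE).
pose F : 'M[R]_n := V *m (T - S) *m V^T.
apply: (@le_trans _ _ (\sum_i (g ((V *m S *m V^T) i i) + c * `|F i i|))).
  apply: ler_sum => i _; rewrite -lerBlDl.
  apply: le_trans (ler_norm _) _; apply: le_trans (gl _ _) _.
  by rewrite /F mulmxBr mulmxBl !mxE.
rewrite big_split/= lerD ?peierls// -mulr_sumr ler_wpM2l//.
have -> : hs (T - S) = hs F.
  congr Num.sqrt; have trE (Y : 'M[R]_n) : \sum_i \sum_j Y i j ^+ 2 = \tr (Y *m Y^T).
    apply: eq_bigr => i _; rewrite !mxE; apply: eq_bigr => j _.
    by rewrite mxE expr2.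
  rewrite !trE /F !trmx_mul trmxK !mulmxA -(mulmxA _ V^T) (mulmx1C V1) mulmx1.
  by rewrite [RHS]mxtrace_mulC !mulmxA (mulmx1C V1) mul1mx.
rewrite /hs -sqrtrM ?ler0n//.
rewrite -[leLHS]ger0_norm ?sumr_ge0// -sqrtr_sqr ler_wsqrtr//.
have := cauchy_schwarz_sum (fun=> 1 : R) (fun i => `|F i i|).
under eq_bigr do rewrite mul1r.
under [X in _ <= X * _ -> _]eq_bigr do rewrite expr1n.
rewrite sumr_const card_ord => /le_trans; apply.
rewrite ler_wpM2l ?ler0n//; apply: ler_sum => i _.
rewrite real_normK ?num_real// (bigD1 i)//= lerDl sumr_ge0// => j _.
by rewrite sqr_ge0.
Qed.

End eigenvalues.

(** * Talagrand's inequality *)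

Section talagrand.
Context {R : realType}.

Definition sqn n (v : 'rV[R]_n) : R := \sum_i v ord0 i ^+ 2.

(** Squared distance to [A]. The infimum over the empty set is 0, not infinity, whence the separate
    treatment of empty sets below. *)
Definition dist2 n (A : set 'rV[R]_n) (x : 'rV[R]_n) : R :=
  inf [set sqn (x - y) | y in A].

Definition is_convex (V : lmodType R) (A : set V) : Prop :=
  forall x y (t : R), A x -> A y -> 0 <= t <= 1 -> A (t *: x + (1 - t) *: y).

Lemma eq_ler (x y : R) : x = y -> x <= y.
Proof. by move=> ->. Qed.

Lemma sqn_ge0 n (v : 'rV[R]_n) : 0 <= sqn v.
Proof. by apply: sumr_ge0 => i _; rewrite sqr_ge0. Qed.

Definition cons_rV (T : Type) n (a : T) (v : 'rV[T]_n) : 'rV[T]_n.+1 :=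
  row_mx (const_mx a : 'rV_1) v.

Lemma cons_rV_conv n (a b t : R) (v w : 'rV[R]_n) :
  t *: cons_rV a v + (1 - t) *: cons_rV b w =
  cons_rV (t * a + (1 - t) * b) (t *: v + (1 - t) *: w).
Proof.
apply/rowP => i; rewrite !mxE; case: splitP => j _; rewrite !mxE//.
Qed.

Lemma cons_rVB n (a b : R) (v w : 'rV[R]_n) :
  cons_rV a v - cons_rV b w = cons_rV (a - b) (v - w).
Proof.
apply/rowP => i; rewrite !mxE; case: splitP => j _; rewrite !mxE//.
Qed.

Lemma sqn_cons_rV n (a : R) (v : 'rV[R]_n) : sqn (cons_rV a v) = a ^+ 2 + sqn v.
Proof.
rewrite /sqn (@big_split_ord _ _ _ 1 n) big_ord1 /cons_rV.
rewrite (row_mxEl (const_mx a : 'rV_1)) mxE; congr (_ + _).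
by apply: eq_bigr => i _; rewrite (row_mxEr (const_mx a : 'rV_1)).
Qed.

Lemma dist2_le n (A : set 'rV[R]_n) x y : A y -> dist2 A x <= sqn (x - y).
Proof.
move=> Ay; apply: ge_inf; last by exists y.
by exists 0 => _ [z _ <-]; exact: sqn_ge0.
Qed.

Lemma dist2_ge n (A : set 'rV[R]_n) x r : A !=set0 ->
  (forall y, A y -> r <= sqn (x - y)) -> r <= dist2 A x.
Proof.
move=> [y Ay] H; apply: lb_le_inf; first by exists (sqn (x - y)), y.
by move=> _ [z Az <-]; exact: H.
Qed.

Lemma sqn_conv n (a b : 'rV[R]_n) (t : R) : 0 <= t <= 1 ->
  sqn (t *: a + (1 - t) *: b) <= t * sqn a + (1 - t) * sqn b.
Proof.
move=> /andP[t0 t1]; rewrite /sqn !mulr_sumr -big_split; apply: ler_sum => i _.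
rewrite !mxE /=; have := mulr_ge0 t0 (_ : 0 <= 1 - t); rewrite subr_ge0 => /(_ t1).
by move=> /mulr_ge0 /(_ (sqr_ge0 (a ord0 i - b ord0 i))); nra.
Qed.

Lemma expR_conv (t u v : R) : 0 <= t <= 1 ->
  expR (t * u + (1 - t) * v) <= t * expR u + (1 - t) * expR v.
Proof.
move=> /andP[t0 t1]; set m := t * u + (1 - t) * v.
have H z : expR m * (1 + (z - m)) <= expR z.
  have -> : expR z = expR m * expR (z - m) by rewrite -expRD subrKC.
  by rewrite ler_pM2l ?expR_gt0// expR_ge1Dx.
have t1' : 0 <= 1 - t by lra.
apply: le_trans (lerD (ler_wpM2l t0 (H u)) (ler_wpM2l t1' (H v))).
by rewrite /m; apply: eq_ler; ring.
Qed.

Lemma ln_ge1V (x : R) : 0 < x -> 1 - x^-1 <= ln x.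
Proof.
move=> x0; have := @le_ln1Dx _ (x^-1 - 1).
rewrite subrKC lnV// => H.
have /H : -1 < x^-1 - 1 by rewrite ltrBrDr addNr invr_gt0.
lra.
Qed.

Lemma talagrand_scalar (r : R) : 5 / 6 <= r <= 1 ->
  expR (16^-1 * (6 * (1 - r)) ^+ 2 - (1 - 6 * (1 - r)) * ln r) <= 2 - r.
Proof.
move=> /andP[r2 r1]; pose s := 1 - r; rewrite -/s.
have s0 : 0 <= s by rewrite /s; lra.
have s1 : 6 * s <= 1 by rewrite /s; lra.
have rE : r = 1 - s by rewrite /s; lra.
have r0 : 0 < r by lra.
have ln1 : - ln r <= s + 2 * s ^+ 2.
  have := ln_ge1V r0; rewrite lerBlDr -lerBlDl => h.
  have : r^-1 <= 1 + (s + 2 * s ^+ 2).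
    by rewrite -[leLHS]mul1r ler_pdivrMr// rE; nra.
  lra.
have ln2 : s - s ^+ 2 <= ln (2 - r).
  apply: le_trans (ln_ge1V _); last lra.
  rewrite lerBrDr -lerBrDl -[leLHS]mul1r ler_pdivrMr; last lra.
  by rewrite rE; nra.
rewrite -ler_ln ?posrE ?expR_gt0//; last lra.
rewrite expRK; apply: le_trans ln2.
have : (1 - 6 * s) * - ln r <= (1 - 6 * s) * (s + 2 * s ^+ 2).
  by rewrite ler_wpM2l//; lra.
rewrite exprMn; nra.
Qed.

(* Young's inequality in place of Hoelder's: both exponentials are normalized
   by [P0] and [P1] before the convexity of [expR] is applied. *)
Lemma young_sum (I : finType) (w a b : I -> R) (t P0 P1 : R) :
  (forall i, 0 <= w i) -> 0 <= t <= 1 -> 0 < P0 -> 0 < P1 ->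
  P0 * (\sum_i w i * expR (a i)) <= 1 -> P1 * (\sum_i w i * expR (b i)) <= 1 ->
  \sum_i w i * expR (t * a i + (1 - t) * b i) <=
    expR (- (t * ln P0 + (1 - t) * ln P1)).
Proof.
move=> w0 t01 P00 P10 H0 H1; have /andP[t0 t1] := t01.
rewrite -(@ler_pM2l _ (expR (t * ln P0 + (1 - t) * ln P1))) ?expR_gt0//.
rewrite -expRD subrr expR0 mulr_sumr.
apply: (@le_trans _ _ (t * (P0 * (\sum_i w i * expR (a i))) +
   (1 - t) * (P1 * (\sum_i w i * expR (b i))))); last first.
  have t1' : 0 <= 1 - t by lra.
  have := ler_wpM2l t0 H0; have := ler_wpM2l t1' H1; lra.
rewrite !mulr_sumr -big_split; apply: ler_sum => i _ /=.
have := @expR_conv t (ln P0 + a i) (ln P1 + b i) t01.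
rewrite [expR (ln P0 + _)]expRD [expR (ln P1 + _)]expRD !lnK ?posrE//.
move=> /(ler_wpM2l (w0 i)) h; rewrite mulrCA -expRD.
have -> : t * ln P0 + (1 - t) * ln P1 + (t * a i + (1 - t) * b i) =
  t * (ln P0 + a i) + (1 - t) * (ln P1 + b i) by ring.
by apply: le_trans h _; apply: eq_ler; ring.
Qed.

Section product.
Variables (T : finType) (e : T -> R) (b : R).
Hypothesis b0 : 0 < b.
Hypothesis eb : forall t t', `|e t - e t'| <= b.

Definition prodw k (p : 'I_k -> T -> R) (w : 'rV[T]_k) : R :=
  \prod_i p i (w ord0 i).

Definition rvals k (w : 'rV[T]_k) : 'rV[R]_k := \row_i e (w ord0 i).

Lemma cons_rV_bij k : bijective (fun z : T * 'rV[T]_k => cons_rV z.1 z.2).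
Proof.
exists (fun w : 'rV[T]_k.+1 => (w ord0 ord0, rsubmx (w : 'rV_(1 + k)))).
  move=> [t w]; rewrite /cons_rV row_mxKr; congr pair.
  by rewrite mxE; case: splitP => // j _; rewrite mxE.
move=> w; apply/rowP => i; rewrite mxE; case: splitP => j ij; rewrite !mxE/=.
  by congr (w _ _); apply/val_inj; rewrite /= ij ord1.
by congr (w _ _); apply/val_inj; rewrite /= ij.
Qed.

Lemma cons_rV0 k (t : T) (w : 'rV[T]_k) : cons_rV t w ord0 ord0 = t.
Proof. by rewrite mxE; case: splitP => // j _; rewrite mxE. Qed.

Lemma cons_rVS k (t : T) (w : 'rV[T]_k) i :
  cons_rV t w ord0 (lift ord0 i) = w ord0 i.
Proof.
rewrite mxE; case: splitP => j /= ij; first by case: j ij => -[].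
by congr (w _ _); apply/val_inj; case: ij.
Qed.

Lemma prodw_cons k (p : 'I_k.+1 -> T -> R) t (w : 'rV[T]_k) :
  prodw p (cons_rV t w) = p ord0 t * prodw (fun i => p (lift ord0 i)) w.
Proof.
rewrite /prodw big_ord_recl cons_rV0; congr (_ * _).
by apply: eq_bigr => i _; rewrite cons_rVS.
Qed.

Lemma rvals_cons k t (w : 'rV[T]_k) :
  rvals (cons_rV t w) = cons_rV (e t) (rvals w).
Proof.
apply/rowP => i; rewrite !mxE; case: splitP => j ij; rewrite !mxE//.
Qed.

Lemma big_cons_rV k (F : 'rV[T]_k.+1 -> R) (Q : pred 'rV[T]_k.+1) :
  \sum_(w | Q w) F w = \sum_t \sum_(w | Q (cons_rV t w)) F (cons_rV t w).
Proof.
rewrite (reindex (fun z : T * 'rV[T]_k => cons_rV z.1 z.2)) ?pair_big_dep/=; last first.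
  exact/onW_bij/cons_rV_bij.
by apply: eq_big => -[].
Qed.

Definition weight k (p : 'I_k -> T -> R) (A : set 'rV[R]_k) : R :=
  \sum_(w | rvals w \in A) prodw p w.

Lemma prodw_ge0 k (p : 'I_k -> T -> R) w :
  (forall i t, 0 <= p i t) -> 0 <= prodw p w.
Proof. by move=> p0; apply: prodr_ge0. Qed.

Lemma weight_ge0 k (p : 'I_k -> T -> R) A :
  (forall i t, 0 <= p i t) -> 0 <= weight p A.
Proof. by move=> p0; apply: sumr_ge0 => w _; exact: prodw_ge0. Qed.

(** Induction on the number of coordinates. By convexity, a point over [t] is compared with mixtures
    of a point in the section of [A] at [t] and a point in the heaviest section, at the price of
    moving the first coordinate. Young's inequality mixes the two induction hypotheses, and the
    average over [t] closes with [x * (2 - x) <= 1] for [x = weight p A / P0]. *)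
Theorem talagrand_exp k (p : 'I_k -> T -> R) (A : set 'rV[R]_k) :
  (forall i t, 0 <= p i t) -> (forall i, \sum_t p i t = 1) -> is_convex A ->
  weight p A * (\sum_w prodw p w * expR (16^-1 * (dist2 A (rvals w) / b ^+ 2))) <= 1.
Proof.
elim: k p A => [|k IH] p A p0 p1 cA.
  have [A0|/set0P A0] := eqVneq A set0.
    rewrite /weight big_pred0 ?mul0r// => w; rewrite A0.
    by apply/negP => /set_mem.
  have f : 'I_0 -> T by case.
  pose w0 : 'rV[T]_0 := \row_i f i.
  have w0P w : w == w0 by apply/eqP/rowP => -[].
  have Aw0 : rvals w0 \in A.
    apply/mem_set; have [v Av] := A0.
    by rewrite (_ : rvals w0 = v)//; apply/rowP => -[].
  have big0 (Q : pred 'rV[T]_0) F : Q w0 -> \sum_(w | Q w) F w = F w0 :> R.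
    move=> Qw0; rewrite (bigD1 w0)//= big1 ?addr0// => w.
    by rewrite (w0P w) andbF.
  rewrite /weight !big0// /prodw !big_ord0 !mul1r -expR0 ler_expR.
  have [v Av] := A0; have := dist2_le (rvals w0) Av.
  have -> : rvals w0 - v = 0 by apply/rowP => -[].
  rewrite /sqn big_ord0 => d0; rewrite pmulr_rle0// pmulr_lle0//.
  by rewrite invr_gt0 exprn_gt0.
pose At t : set 'rV[R]_k := [set v | A (cons_rV (e t) v)].
pose p' (i : 'I_k) := p (lift ord0 i).
have cAt t : is_convex (At t).
  move=> x y u Ax Ay u01; rewrite /At/=; have := cA _ _ u Ax Ay u01.
  by rewrite cons_rV_conv -mulrDl subrKC mul1r.
have wA : weight p A = \sum_t p ord0 t * weight p' (At t).
  rewrite /weight big_cons_rV; apply: eq_bigr => t _; rewrite mulr_sumr.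
  apply: eq_big => [w|w _]; last exact: prodw_cons.
  by rewrite rvals_cons; apply/idP/idP => /set_mem h; apply/mem_set.
have pT : exists t, p ord0 t != 0.
  apply/existsP; rewrite -[X in is_true X]negbK negb_exists; apply/negP => /forallP h.
  have := p1 ord0; rewrite big1 => [/eqP|t _]; first by rewrite eq_sym oner_eq0.
  by have := h t; rewrite negbK => /eqP.
pose t0 := [arg max_(t > xchoose pT) weight p' (At t)]%O.
have P0max t : weight p' (At t) <= weight p' (At t0).
  by rewrite /t0; case: arg_maxP => // i _; exact.
set P0 := weight p' (At t0) in P0max.
have P'0 (i : 'I_k) t : 0 <= p' i t by exact: p0.
have P0ge0 : 0 <= P0 := weight_ge0 _ P'0.
have [P00|P00] := eqVneq P0 0.
  rewrite wA big1 ?mul0r// => t _; rewrite (_ : weight _ _ = 0) ?mulr0//.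
  by apply/eqP; rewrite eq_le -{1}P00 P0max weight_ge0.
have P0gt : 0 < P0 by rewrite lt_neqAle eq_sym P00.
have nonempty t : 0 < weight p' (At t) -> At t !=set0.
  rewrite /weight => h; apply/set0P/negP => /eqP At0; move: h.
  by rewrite big_pred0 ?ltxx// => w; rewrite At0; apply/negP => /set_mem.
have Ane : A !=set0 by have [v Av] := nonempty _ P0gt; exists (cons_rV (e t0) v).
(* the sections at [t] and at the heaviest [t0] are interpolated *)
have key t v y0 y1 (u : R) : 0 <= u <= 1 -> At t0 y0 -> At t y1 ->
    dist2 A (cons_rV (e t) v) <=
    u ^+ 2 * b ^+ 2 + (u * sqn (v - y0) + (1 - u) * sqn (v - y1)).
  move=> u01 Ay0 Ay1; have := cA _ _ u Ay0 Ay1 u01.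
  move=> /dist2_le => /(_ (cons_rV (e t) v)) /le_trans; apply.
  rewrite cons_rV_conv cons_rVB sqn_cons_rV.
  have -> : e t - (u * e t0 + (1 - u) * e t) = u * (e t - e t0) by ring.
  rewrite exprMn lerD//.
    rewrite ler_wpM2l ?sqr_ge0// -[leLHS]real_normK ?num_real//.
    by rewrite ler_sqr ?nnegrE// ltW.
  apply: le_trans (sqn_conv _ _ u01); apply: eq_ler; congr sqn.
  by apply/rowP => i; rewrite !mxE; ring.
have dle_conv t v (u : R) : 0 <= u <= 1 -> At t0 !=set0 -> At t !=set0 ->
    dist2 A (cons_rV (e t) v) <= u ^+ 2 * b ^+ 2 +
    (u * dist2 (At t0) v + (1 - u) * dist2 (At t) v).
  move=> u01 At0ne Atne; have /andP[u0 u1] := u01.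
  have := fun y0 y1 => key t v y0 y1 u u01; set x := u ^+ 2 * _; set q := dist2 A _ => h.
  have h1 y1 : At t y1 -> q - x - (1 - u) * sqn (v - y1) <= u * dist2 (At t0) v.
    move=> Ay1; have [u_eq0|un0] := eqVneq u 0.
      by have [y0 Ay0] := At0ne; have := h _ _ Ay0 Ay1; rewrite u_eq0; lra.
    have ugt0 : 0 < u by rewrite lt_neqAle eq_sym un0.
    rewrite [leRHS]mulrC -ler_pdivrMr//; apply: dist2_ge => // y0 Ay0.
    by rewrite ler_pdivrMr//; have := h _ _ Ay0 Ay1; lra.
  have [u_eq1|un1] := eqVneq (1 - u) 0.
    by have [y1 Ay1] := Atne; have := h1 _ Ay1; rewrite u_eq1; lra.
  have ugt1 : 0 < 1 - u by rewrite lt_neqAle eq_sym un1 subr_ge0.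
  suff : (q - x - u * dist2 (At t0) v) / (1 - u) <= dist2 (At t) v.
    by rewrite ler_pdivrMr//; lra.
  apply: dist2_ge => // y1 Ay1.
  by rewrite ler_pdivrMr//; have := h1 _ Ay1; lra.
have step t : \sum_w prodw p' w *
    expR (16^-1 * (dist2 A (rvals (cons_rV t w)) / b ^+ 2)) <=
    P0^-1 * (2 - weight p' (At t) / P0).
  set Pt := weight p' (At t).
  have b20 : 0 < b ^+ 2 by rewrite exprn_gt0.
  (* A section of weight at least [5 / 6] of the heaviest one is mixed with it, with the weight of
     [talagrand_scalar]. A lighter one is replaced altogether by the heaviest, which costs
     [exp (1 / 16) <= 7 / 6 <= 2 - Pt / P0]. *)
  have [r_big|r_small] := leP (5 / 6) (Pt / P0).
    have Ptgt : 0 < Pt.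
      have : 0 < Pt / P0 by lra.
      by rewrite pmulr_lgt0 ?invr_gt0.
    have r1 : Pt / P0 <= 1 by rewrite ler_pdivrMr// mul1r P0max.
    pose u := 6 * (1 - Pt / P0).
    have u01 : 0 <= u <= 1 by apply/andP; split; rewrite /u; lra.
    have dle v := dle_conv t v u u01 (nonempty _ P0gt) (nonempty _ Ptgt).
    have := @young_sum _ (prodw p') (fun w => 16^-1 * (dist2 (At t0) (rvals w) / b ^+ 2))
      (fun w => 16^-1 * (dist2 (At t) (rvals w) / b ^+ 2)) u P0 Pt
      (fun w => prodw_ge0 w (fun i => p0 (lift ord0 i))) u01 P0gt Ptgt
      (IH p' (At t0) (fun i => p0 _) (fun i => p1 _) (cAt t0))
      (IH p' (At t) (fun i => p0 _) (fun i => p1 _) (cAt t)).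
    move=> /(ler_wpM2l (expR_ge0 (16^-1 * u ^+ 2))).
    rewrite mulr_sumr -expRD => h.
    apply: (@le_trans _ _ (expR (16^-1 * u ^+ 2 - (u * ln P0 + (1 - u) * ln Pt)))).
      apply: le_trans h; apply: ler_sum => w _.
      rewrite [leRHS]mulrCA -expRD ler_wpM2l ?prodw_ge0//= ler_expR rvals_cons.
      have := dle (rvals w); rewrite -(@ler_pM2r _ (b ^+ 2)^-1) ?invr_gt0//.
      rewrite mulrDl mulfK ?gt_eqF// mulrDl; lra.
    have := @talagrand_scalar (Pt / P0); rewrite r_big r1 => /(_ isT).
    rewrite -/u -(@ler_pM2l _ P0^-1) ?invr_gt0//; apply: le_trans.
    rewrite -{1}(lnK (_ : P0^-1 \is Num.pos)) ?posrE ?invr_gt0// -expRD ler_expR.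
    rewrite lnV// ln_div//; lra.
  have At0ne := nonempty _ P0gt.
  apply: (@le_trans _ _ (expR (16^-1) * P0^-1)); last first.
    rewrite mulrC ler_pM2l ?invr_gt0//.
    apply: (@le_trans _ _ (7 / 6)); last lra.
    have h76 : (0 : R) < 7 / 6 by lra.
    rewrite -[leRHS]lnK ?posrE// ler_expR (le_trans _ (ln_ge1V h76))//.
    by rewrite invf_div; lra.
  have := IH p' (At t0) (fun i => p0 _) (fun i => p1 _) (cAt t0).
  rewrite mulrC -ler_pdivlMr// mul1r => /(ler_wpM2l (expR_ge0 16^-1)).
  apply: le_trans; rewrite mulr_sumr; apply: ler_sum => w _.
  rewrite [leRHS]mulrCA -expRD ler_wpM2l ?prodw_ge0//.
  rewrite ler_expR rvals_cons.
  have dle : dist2 A (cons_rV (e t) (rvals w)) <=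
      b ^+ 2 + dist2 (At t0) (rvals w).
    rewrite -lerBlDl; apply: dist2_ge => // y Ay; rewrite lerBlDl.
    have Ay' : A (cons_rV (e t0) y) := Ay.
    apply: le_trans (dist2_le _ Ay') _.
    rewrite cons_rVB sqn_cons_rV lerD2r -[leLHS]real_normK ?num_real//.
    by rewrite ler_sqr ?nnegrE// ltW.
  move: dle; rewrite -(@ler_pM2r _ (b ^+ 2)^-1) ?invr_gt0//.
  by rewrite mulrDl divff ?gt_eqF//; lra.
have PA := weight_ge0 A p0.
apply: (@le_trans _ _ (weight p A * (P0^-1 * (2 - weight p A / P0)))).
  rewrite ler_wpM2l// big_cons_rV.
  apply: (@le_trans _ _ (\sum_t p ord0 t * (P0^-1 * (2 - weight p' (At t) / P0)))).
    apply: ler_sum => t _; apply: le_trans (ler_wpM2l (p0 _ _) (step t)).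
    rewrite mulr_sumr; apply: ler_sum => w _.
    by rewrite prodw_cons -mulrA.
  under eq_bigr => t _.
    rewrite (_ : _ * _ = p ord0 t * (2 / P0) - p ord0 t * weight p' (At t) * P0^-1 ^+ 2).
      over.
    by ring.
  by rewrite sumrB -!mulr_suml p1 -wA; apply: eq_ler; ring.
set z := weight p A.
have -> : z * (P0^-1 * (2 - z / P0)) = (z / P0) * (2 - z / P0) by ring.
have := sqr_ge0 (1 - z / P0); lra.
Qed.

End product.
End talagrand.

(** * Elementary estimates for probabilities of events *)

Section probability_bounds.
Context {R : realType} d (T : measurableType d) (P : probability T R).

Definition pr (A : set T) : R := fine (P A).

Lemma prE A : measurable A -> P A = (pr A)%:E.
Proof. by move=> mA; rewrite /pr fineK// fin_num_measure. Qed.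

Lemma pr_ge0 A : 0 <= pr A.
Proof. by rewrite /pr fine_ge0. Qed.

Lemma pr_le A B : measurable A -> measurable B -> A `<=` B -> pr A <= pr B.
Proof.
by move=> mA mB AB; rewrite -lee_fin -!prE// le_measure// inE.
Qed.

Lemma prC A : measurable A -> pr (~` A) = 1 - pr A.
Proof.
move=> mA; apply: EFin_inj; rewrite EFinB -!prE//; last exact: measurableC.
exact: probability_setC.
Qed.

Lemma prU A B : measurable A -> measurable B -> pr (A `|` B) <= pr A + pr B.
Proof.
move=> mA mB; rewrite -lee_fin EFinD -!prE//; last exact: measurableU.
exact: measureU2.
Qed.

Lemma pr0 : pr set0 = 0. Proof. by rewrite /pr measure0. Qed.

Lemma pr_sub_sum (I : Type) (r : seq I) (F : I -> set T) (Q : pred I) A :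
  measurable A -> (forall i, measurable (F i)) ->
  A `<=` [set x | exists2 i, List.In i r & Q i /\ F i x] ->
  pr A <= \sum_(i <- r | Q i) pr (F i).
Proof.
elim: r A => [|i r IH] A mA mF AF.
  rewrite big_nil (_ : A = set0) ?pr0//; rewrite -subset0 => x /AF[? []].
rewrite big_cons; case: ifPn => Qi; last first.
  by apply: IH => // x /AF[j [<- [Qj]|? ?]]; [rewrite Qj in Qi|exists j].
apply: (@le_trans _ _ (pr (F i `|` (A `\` F i)))).
  apply: pr_le => //; first by apply: measurableU => //; exact: measurableD.
  by move=> x Ax; have [?|?] := pselect (F i x); [left|right].
apply: le_trans (prU _ _) _ => //; first exact: measurableD.
rewrite lerD2l; apply: IH => //; first exact: measurableD.
by move=> x [/AF[j [<- [_ ?]|? ?] ?]]; [|exists j].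
Qed.

Lemma pr_sub_fsum (I : finType) (F : I -> set T) (Q : pred I) A :
  measurable A -> (forall i, measurable (F i)) ->
  (forall x, A x -> exists2 i, Q i & F i x) ->
  pr A <= \sum_(i | Q i) pr (F i).
Proof.
move=> mA mF AF; apply: pr_sub_sum => // x /AF[i Qi Fi]; exists i => //.
have : i \in index_enum I by exact: mem_index_enum.
elim: (index_enum I) => //= j r IH; rewrite inE => /orP[/eqP->|/IH]; by [left|right].
Qed.

Lemma pr_fsum (I : finType) (f : T -> I) :
  (forall i, measurable [set x | f x = i]) -> \sum_i pr [set x | f x = i] = 1.
Proof.
move=> mf; apply: EFin_inj; rewrite -sumEFin -(@probability_setT _ _ _ P).
rewrite (_ : setT = \bigcup_(i in [set: I]) [set x | f x = i]); last first.
  by apply/seteqP; split => // x _; exists (f x).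
rewrite measure_fin_bigcup//; last first.
  by move=> i j _ _ [x [/= <- <-]].
  exact: finite_finset.
rewrite (@fsbigE _ _ _ _ _ (index_enum I)) ?index_enum_uniq//; last first.
  by move=> i _; rewrite mem_index_enum.
apply: eq_big => [i|i _]; first by rewrite in_setT.
by rewrite -prE.
Qed.

End probability_bounds.

(** * Talagrand's inequality for bounded real inputs, by discretization *)

Section quasi_convex_concentration.
Context {R : realType} d (Om : measurableType d) (P : probability Om R).
Variables (k : nat) (X : {RV P >-> 'rV[R]_k}) (phi : R -> R) (B : R).
Hypothesis indX : independent_entries P X.
Hypothesis mphi : measurable_fun setT phi.
Hypothesis B0 : 0 < B.
Hypothesis phiB : forall x, `|phi x| <= B.

Let Y w : 'rV[R]_k := \row_i phi (X w ord0 i).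

Lemma sqnD n (a b : 'rV[R]_n) : sqn (a + b) <= 2 * sqn a + 2 * sqn b.
Proof.
rewrite /sqn !mulr_sumr -big_split; apply: ler_sum => i _ /=; rewrite !mxE.
by have := sqr_ge0 (a ord0 i - b ord0 i); nra.
Qed.

Lemma sqnN n (a : 'rV[R]_n) : sqn (- a) = sqn a.
Proof. by apply: eq_bigr => i _; rewrite !mxE sqrrN. Qed.

Section grid.
Variable n : nat.
Hypothesis n0 : (0 < n)%N.

Let dlt : R := B / n%:R.
Let gval (t : 'I_(n.*2.+1)) : R := (t%:R - n%:R) * dlt.
Let gidx (x : R) : 'I_(n.*2.+1) := inord `|Num.floor (phi x / dlt + n%:R)|%N.
Let I w : 'rV['I_(n.*2.+1)]_k := \row_i gidx (X w ord0 i).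
Let p i t := pr P [set w | gidx (X w ord0 i) = t].

Let dlt0 : 0 < dlt. Proof. by rewrite divr_gt0// ltr0n. Qed.

Let gval_dist t t' : `|gval t - gval t'| <= 2 * B.
Proof.
rewrite /gval -mulrBl opprB addrA subrK normrM (gtr0_norm dlt0).
have -> : 2 * B = (n.*2)%:R * dlt.
  by rewrite /dlt -muln2 natrM; field; rewrite pnatr_eq0 -lt0n.
rewrite ler_wpM2r ?(ltW dlt0)// ler_norml; apply/andP.
have t1 : (t%:R : R) <= n.*2%:R by rewrite ler_nat -ltnS.
have t2 : (t'%:R : R) <= n.*2%:R by rewrite ler_nat -ltnS.
have t3 : (0 : R) <= t%:R by []; have t4 : (0 : R) <= t'%:R by [].
by split; lra.
Qed.

Let gidx_close x : `|phi x - gval (gidx x)| <= dlt.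
Proof.
have := phiB x; rewrite ler_norml => /andP[xl xu].
pose z := phi x / dlt + n%:R.
have nd : n%:R * dlt = B by rewrite /dlt mulrC divfK// pnatr_eq0 -lt0n.
have z0 : 0 <= z by rewrite -lerBlDr sub0r lerNl -mulNr ler_pdivrMr// nd; lra.
have zn : z <= n.*2%:R.
  rewrite /z -lerBrDr ler_pdivrMr// -muln2 natrM mulrBl.
  have -> : n%:R * 2 * dlt = 2 * B by rewrite -nd; ring.
  by rewrite nd; lra.
have f0 : (0 <= Num.floor z)%R by rewrite -floor_ge0 in z0 *.
have fz : (`|Num.floor z|%N)%:R = (Num.floor z)%:~R :> R.
  by rewrite -[in RHS](gez0_abs f0) -pmulrn.
have /andP[lez gtz] := floor_itv z; rewrite intrD in gtz.
have idE : nat_of_ord (gidx x) = `|Num.floor z|%N.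
  rewrite /gidx inordK// ltnS -(ler_nat R) fz.
  exact: le_trans lez zn.
rewrite /gval idE fz.
have -> : phi x - ((Num.floor z)%:~R - n%:R) * dlt = (z - (Num.floor z)%:~R) * dlt.
  by rewrite /z; field; rewrite gt_eqF.
rewrite normrM (gtr0_norm dlt0) -[leRHS]mul1r ler_wpM2r ?(ltW dlt0)//.
rewrite ger0_norm; first lra.
lra.
Qed.

Let measurable_gidx t : measurable [set x : R | gidx x = t].
Proof.
have mpsi : measurable_fun setT (fun x => phi x / dlt + n%:R).
  by apply: measurable_funD => //; apply: measurable_funM.
have -> : [set x | gidx x = t] = \bigcup_(z : int)
    (if inord `|z|%N == t then (fun x => phi x / dlt + n%:R) @^-1` `[z%:~R, (z + 1)%:~R[%classic else set0).
  apply/seteqP; split=> [x <-|x [z _]].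
    by exists (Num.floor (phi x / dlt + n%:R)) => //; rewrite eqxx/= in_itv/= floor_itv.
  by case: ifPn => //= /eqP <-; rewrite /= in_itv/= => /floor_def; rewrite /gidx => ->.
apply: countable_bigcupT_measurable => // z; case: ifPn => // _.
by rewrite -[X in measurable X]setTI; exact: mpsi.
Qed.

Let measurable_I i t : measurable [set w | gidx (X w ord0 i) = t].
Proof.
have := measurableT_comp (@measurable_entry _ _ 1 k ord0 i) (measurable_funPT X).
by move=> /(_ measurableT _ (measurable_gidx t)); rewrite setTI.
Qed.

Let measurable_Iw v : measurable [set w | I w = v].
Proof.
have -> : [set w | I w = v] = \bigcap_(i in [set: 'I_k]) [set w | gidx (X w ord0 i) = v ord0 i].
  apply/seteqP; split=> [w <- i _/=|w h]; first by rewrite mxE.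
  by apply/rowP => i; rewrite mxE h.
by apply: fin_bigcap_measurable => // i _.
Qed.

Let pr_I v : pr P [set w | I w = v] = prodw p v.
Proof.
have := indX finset.setT (fun i => measurable_gidx (v ord0 i)).
rewrite /prodw [X in _ = X -> _](eq_bigl predT); last by move=> i; rewrite inE.
move=> <-; congr (fine (P _)); apply/seteqP; split=> [w <- i _/=|w h].
  by rewrite mxE.
by apply/rowP => i; rewrite mxE h// inE.
Qed.

Let sum_p i : \sum_t p i t = 1.
Proof. exact: (@pr_fsum _ _ _ P _ (fun w => gidx (X w ord0 i))). Qed.

(** The inputs are rounded to a grid of mesh [dlt], moving them by a squared distance of at most
    [rho]. Enlarging [A] by this error keeps it convex, and a rounded point of [F] stays at squared
    distance at least [s / 4] from the enlargement because [16 * rho <= s]. The constant is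
    [256 = 16 * 4 * 2 ^+ 2], the last factor from the width [2 * B] of the grid. *)
Lemma talagrand_grid (A F : set 'rV[R]_k) (s : R) : is_convex A ->
  measurable [set w | A (Y w)] -> measurable [set w | F (Y w)] ->
  (forall x y, F x -> A y -> s <= sqn (x - y)) -> 16 * (k%:R * dlt ^+ 2) <= s ->
  pr P [set w | A (Y w)] * pr P [set w | F (Y w)] <= expR (- (s / (256 * B ^+ 2))).
Proof.
move=> cA mA mF FA sd; set rho := k%:R * dlt ^+ 2 in sd.
pose Ad : set 'rV[R]_k := [set z | exists y r, [/\ A y, sqn r <= rho & z = y + r]].
have cAd : is_convex Ad.
  move=> _ _ t [y1 [r1 [Ay1 h1 ->]]] [y2 [r2 [Ay2 h2 ->]]] t01.
  exists (t *: y1 + (1 - t) *: y2), (t *: r1 + (1 - t) *: r2); split.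
  - exact: cA.
  - apply: le_trans (sqn_conv _ _ t01) _; have /andP[t0 t1] := t01; nra.
  - by rewrite !scalerDr addrACA.
have YI w : sqn (Y w - rvals gval (I w)) <= rho.
  rewrite /sqn; apply: (@le_trans _ _ (\sum_(i < k) dlt ^+ 2)).
    apply: ler_sum => i _; rewrite !mxE -real_normK ?num_real//.
    by rewrite ler_sqr ?nnegrE ?(ltW dlt0)// gidx_close.
  by rewrite sumr_const card_ord -[leLHS]mulr_natl.
have B20 : 0 < 2 * B by rewrite mulr_gt0.
have p0 i t : 0 <= p i t by exact: pr_ge0.
have := talagrand_exp B20 gval_dist p0 sum_p cAd.
have wge0 v : 0 <= prodw p v by exact: prodw_ge0.
have [Ad0|/set0P Adne] := eqVneq Ad set0.
  rewrite (_ : [set w | A (Y w)] = set0) ?pr0 ?mul0r ?expR_ge0//.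
  rewrite -subset0 => w Aw; have : set0 (Y w); last by [].
  rewrite -Ad0; exists (Y w), 0; split => //.
    by rewrite /sqn big1 => [|i _]; rewrite ?mxE ?expr0n// mulr_ge0// sqr_ge0.
  by rewrite addr0.
have hA : pr P [set w | A (Y w)] <= weight gval p Ad.
  rewrite /weight; under eq_bigr do rewrite -pr_I.
  apply: pr_sub_fsum => // w Aw; exists (I w) => //; apply/mem_set.
  exists (Y w), (rvals gval (I w) - Y w); split => //.
    by rewrite -opprB sqnN.
  by rewrite subrKC.
have hF : pr P [set w | F (Y w)] * expR (s / (256 * B ^+ 2)) <=
    \sum_v prodw p v * expR (16^-1 * (dist2 Ad (rvals gval v) / (2 * B) ^+ 2)).
  have hF : pr P [set w | F (Y w)] <= \sum_(v | s / 4 <= dist2 Ad (rvals gval v)) prodw p v.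
    under eq_bigr do rewrite -pr_I.
    apply: pr_sub_fsum => // w Fw; exists (I w) => //.
    apply: dist2_ge => // _ [y [r [Ay hr ->]]].
    have : s <= sqn (Y w - y) by exact: FA.
    have -> : Y w - y = (Y w - rvals gval (I w) + r) + (rvals gval (I w) - (y + r)).
      by apply/rowP => i; rewrite !mxE; ring.
    have := sqnD (Y w - rvals gval (I w) + r) (rvals gval (I w) - (y + r)).
    have := sqnD (Y w - rvals gval (I w)) r.
    have := YI w; lra.
  apply: le_trans (ler_wpM2r (expR_ge0 _) hF) _; rewrite mulr_suml.
  apply: (@le_trans _ _ (\sum_(v | s / 4 <= dist2 Ad (rvals gval v))
    prodw p v * expR (16^-1 * (dist2 Ad (rvals gval v) / (2 * B) ^+ 2)))).
    apply: ler_sum => v sv; rewrite ler_wpM2l// ler_expR.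
    have -> : s / (256 * B ^+ 2) = 16^-1 * (s / 4 / (2 * B) ^+ 2).
      by field; rewrite gt_eqF.
    by rewrite ler_wpM2l// ler_wpM2r// invr_ge0 sqr_ge0.
  rewrite [leRHS](bigID (fun v => s / 4 <= dist2 Ad (rvals gval v)))/= lerDl.
  by apply: sumr_ge0 => v _; rewrite mulr_ge0// expR_ge0.
have e0 := expR_gt0 (s / (256 * B ^+ 2)).
move=> h; rewrite expRN -[leRHS]mul1r (ler_pdivlMr _ _ e0) -mulrA.
apply: le_trans h; apply: (ler_pM (pr_ge0 _ _) _ hA hF).
by rewrite mulr_ge0 ?pr_ge0 ?(ltW e0).
Qed.

End grid.

Lemma talagrand (A F : set 'rV[R]_k) (s : R) : is_convex A -> 0 < s ->
  measurable [set w | A (Y w)] -> measurable [set w | F (Y w)] ->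
  (forall x y, F x -> A y -> s <= sqn (x - y)) ->
  pr P [set w | A (Y w)] * pr P [set w | F (Y w)] <= expR (- (s / (256 * B ^+ 2))).
Proof.
move=> cA s0 mA mF FA.
(* The mesh condition of [talagrand_grid] reads [c <= n ^+ 2]; its conclusion does not depend on
   [n]. *)
pose c := 16 * k%:R * B ^+ 2 / s.
have c0 : 0 <= c by rewrite divr_ge0 ?(ltW s0)// mulr_ge0 ?sqr_ge0// mulr_ge0.
pose n := (Num.trunc c).+1.
have cn : c < n%:R by exact: truncnS_gt.
apply: (@talagrand_grid n) => //.
have n1 : (1 : R) <= n%:R by rewrite ler1n.
rewrite expr_div_n; have : c <= n%:R ^+ 2 by nra.
rewrite /c ler_pdivrMr// => h.
rewrite !mulrA ler_pdivrMr; last by rewrite exprn_gt0// (lt_le_trans ltr01).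
by rewrite -mulrA -expr2 [leRHS]mulrC.
Qed.

End quasi_convex_concentration.

(** * Measurability of spectral quantities *)

Section raw_integrals.
Context {R : realType} d (T : measurableType d).
Local Open Scope ereal_scope.
Import HBNNSimple.

(** The integral evaluates its set function only on the measurable level sets of simple functions.
    It can therefore be computed for [mean_esd], a bare set function, by exhibiting a measure with
    the same values. *)
Lemma eq_integral_raw (m1 m2 : set T -> \bar R) (D : set T) (f : T -> \bar R) :
  (forall A, measurable A -> m1 A = m2 A) ->
  \int[m1]_(x in D) f x = \int[m2]_(x in D) f x.
Proof.
move=> m12; have E (h : {nnsfun T >-> R}) : sintegral m1 h = sintegral m2 h.
  by apply: eq_fsbigr => x _; rewrite m12.
rewrite /integral; congr (ereal_sup _ - ereal_sup _); apply/seteqP.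
  by split=> _ [h hg <-]; exists h.
by split=> _ [h hg <-]; exists h.
Qed.

(* No measurability is required: the integral of a nonnegative function is a
   supremum over the simple functions below it. *)
Lemma le_integral_raw (mu : {measure set T -> \bar R}) (D : set T) (f g : T -> \bar R) :
  (forall x, D x -> 0 <= f x) -> (forall x, D x -> f x <= g x) ->
  \int[mu]_(x in D) f x <= \int[mu]_(x in D) g x.
Proof.
move=> f0 fg; rewrite !ge0_integralE//; last first.
  by move=> x Dx; apply: le_trans (f0 _ Dx) (fg _ Dx).
apply: le_ereal_sup => _ [h hf <-]; exists h => // x.
apply: le_trans (hf x) _; rewrite /patch; case: ifPn => // xD.
by apply: fg; exact: set_mem.
Qed.

Lemma integral_ge0_lb (mu : {measure set T -> \bar R}) (D A : set T)
    (f : T -> \bar R) (c : R) : measurable A -> A `<=` D -> (0 <= c)%R ->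
  (forall x, D x -> 0 <= f x) -> (forall x, A x -> c%:E <= f x) ->
  c%:E * mu A <= \int[mu]_(x in D) f x.
Proof.
move=> mA AD c0 f0 fc.
rewrite -(integral_cst mu mA) [leRHS]integral_mkcond [leLHS]integral_mkcond.
apply: le_integral_raw => x _; rewrite /patch.
  by case: ifP => // _; rewrite lee_fin.
case: ifPn => xA.
  have Ax := set_mem xA; rewrite (mem_set (AD _ Ax)); exact: fc.
by case: ifPn => // xD; apply: f0; exact: set_mem.
Qed.

End raw_integrals.

Section matrix_measurability.
Context {R : realType} (p q : nat).

Lemma rat_approx (x t : R) : 0 < t -> exists y : rat, `|x - ratr y| < t.
Proof.
move=> t0; have h : x - t < x + t by lra.
have [y] := rat_in_itvoo h.
by rewrite in_itv/= => xy; exists y; rewrite ltr_norml; lra.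
Qed.

Lemma mx_ballP (A B : 'M[R]_(p, q)) (r : R) : 0 < r ->
  ball A r B <-> forall i j, `|A i j - B i j| < r.
Proof. by move=> r0; split=> [[]|]. Qed.

(** An open set is the union of the balls with rational centres and radii [1 / (n + 1)] that it
    contains; there are countably many, and each is a finite intersection of conditions on
    entries. *)
Lemma measurable_mx_open (U : set 'M[R]_(p, q)) : open U -> measurable U.
Proof.
move=> oU.
pose F (z : 'M[rat]_(p, q) * nat) : set 'M[R]_(p, q) :=
  ball (map_mx ratr z.1 : 'M[R]_(p, q)) (z.2.+1%:R^-1).
have mF z : measurable (F z).
  rewrite /F (_ : ball _ _ = \bigcap_(ij in [set: 'I_p * 'I_q])
    ((fun B : 'M[R]_(p, q) => B ij.1 ij.2) @^-1`
      ball ((map_mx ratr z.1 : 'M[R]_(p, q)) ij.1 ij.2) (z.2.+1%:R^-1))).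
    apply: fin_bigcap_measurable => // -[i j] _ /=.
    rewrite -[X in measurable X]setTI; apply: (@measurable_entry _ R p q i j) => //.
    exact: measurable_ball.
  apply/seteqP; split => [B [_ h] [i j] _|B h]; first exact: h.
  by split=> [|i j]; [rewrite invr_gt0|exact: (h (i, j))].
have -> : U = \bigcup_z (if `[< F z `<=` U >] then F z else set0).
  apply/seteqP; split => [A UA|A [z _]]; last by case: ifPn => // /asboolP; exact.
  have [e /= e0 eU] : exists2 e : R, 0 < e & ball A e `<=` U.
    by have /nbhs_ballP[e e0 ?] := open_nbhs_nbhs (conj oU UA); exists e.
  have [n ne] : exists n : nat, n.+1%:R^-1 < e / 2.
    exists (Num.trunc (2 / e)); rewrite -[ltRHS]invrK ltf_pV2 ?posrE ?invr_gt0 ?divr_gt0//.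
    by rewrite invf_div truncnS_gt.
  have n0 : 0 < n.+1%:R^-1 :> R by rewrite invr_gt0.
  have /choice[f fP] : forall ij : 'I_p * 'I_q, exists x : rat,
      `|A ij.1 ij.2 - ratr x| < n.+1%:R^-1.
    by move=> ij; exact: rat_approx.
  pose Z : 'M[rat]_(p, q) := \matrix_(i, j) f (i, j).
  have FA : F (Z, n) A.
    by apply/mx_ballP => // i j; rewrite !mxE distrC; exact: (fP (i, j)).
  exists (Z, n) => //; case: ifPn => // /asboolP[] B FB; apply/eU/mx_ballP => // i j.
  have /mx_ballP /(_ i j) h1 := FA; have /mx_ballP /(_ i j) h2 := FB.
  have {}h1 := h1 n0; have {}h2 := h2 n0.
  rewrite -[X in `|X|](subrKA ((map_mx ratr Z : 'M[R]_(p, q)) i j)).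
  apply: le_lt_trans (ler_normD _ _) _; rewrite [ltRHS]splitr ltrD//.
    by rewrite distrC; exact: lt_trans h1 ne.
  exact: lt_trans h2 ne.
apply: countable_bigcupT_measurable => // z; case: ifP => // _; exact: mF.
Qed.

Lemma measurable_mx_continuous (f : 'M[R]_(p, q) -> R) :
  continuous f -> measurable_fun setT f.
Proof.
move=> cf; apply: (measurability _ (RGenOInfty.measurableE R)) => //.
move=> _ [_ [a ->] <-]; rewrite setTI; apply: measurable_mx_open.
by move/continuousP : cf; apply; exact: interval_open.
Qed.

End matrix_measurability.

Section eigenvalue_measurability.
Context {R : realType} (n : nat).

(** Eigenvalues are controlled only on symmetric matrices; composing with the symmetric part makes
    them continuous functions on the whole matrix space. *)
Definition symz (T : 'M[R]_n) : 'M[R]_n := 2^-1 *: (T + T^T).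

Lemma symz_sym T : sym_mx (symz T).
Proof. by rewrite /sym_mx/= /symz linearZ/= linearD/= trmxK addrC. Qed.

Lemma symz_id T : sym_mx T -> symz T = T.
Proof.
rewrite /sym_mx/= /symz => ->; apply/matrixP => i j; rewrite !mxE.
by field.
Qed.

Lemma hs_le (E : 'M[R]_n) (e : R) : 0 <= e -> (forall i j, `|E i j| <= e) ->
  hs E <= n%:R * e.
Proof.
move=> e0 Ee; rewrite -[leRHS]ger0_norm ?mulr_ge0// -sqrtr_sqr ler_wsqrtr//.
rewrite exprMn expr2 -mulrA mulr_natl -[X in _ *+ X]card_ord -sumr_const.
apply: ler_sum => i _; rewrite mulr_natl -[X in _ *+ X]card_ord -sumr_const.
apply: ler_sum => j _; rewrite -real_normK ?num_real//.
by rewrite ler_sqr ?nnegrE.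
Qed.

Lemma continuous_evz (i : 'I_n) : continuous (fun T : 'M[R]_n => ev (symz T) i).
Proof.
move=> T; apply: (@cvgrPdist_lt _ _ _ _ (nbhs_filter T) _ _).2 => e e0.
have n0 : 0 < n%:R :> R by rewrite ltr0n (leq_trans _ (ltn_ord i)).
have en : 0 < e / n%:R / 2 by rewrite !divr_gt0.
apply/nbhs_ballP; exists (e / n%:R / 2) => //= S /mx_ballP /(_ _ _) TS.
apply: le_lt_trans (weyl _ (symz_sym T) (symz_sym S)) _.
apply: le_lt_trans (@hs_le _ (e / n%:R / 2) _ _) _; first exact: ltW.
  move=> k l; rewrite !mxE.
  have -> : 2^-1 * (T k l + T l k) - 2^-1 * (S k l + S l k) =
    2^-1 * ((T k l - S k l) + (T l k - S l k)) by ring.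
  rewrite normrM gtr0_norm// -ler_pdivlMl//.
  apply: le_trans (ler_normD _ _) _; rewrite invrK.
  have h1 := ltW (TS en k l); have h2 := ltW (TS en l k).
  by apply: le_trans (lerD h1 h2) _; rewrite -mulr2n -[leLHS]mulr_natl.
have -> : n%:R * (e / n%:R / 2) = e / 2 by field; rewrite gt_eqF.
by rewrite ltr_pdivrMr// ltr_pMr// ltr1n.
Qed.

Context d (Om : measurableType d).
Variable (H : Om -> 'M[R]_n).
Hypothesis mH : measurable_fun setT H.
Hypothesis symH : forall w, sym_mx (H w).

Lemma measurable_ev (i : 'I_n) : measurable_fun setT (fun w => ev (H w) i).
Proof.
under eq_fun do rewrite -(symz_id (symH _)).
exact: (measurableT_comp (measurable_mx_continuous (@continuous_evz i)) mH).
Qed.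

Lemma measurable_tr_fun (f : R -> R) : measurable_fun setT f ->
  measurable_fun setT (fun w => tr_fun f (H w)).
Proof.
move=> mf; under eq_fun do rewrite tr_funE//.
apply: measurable_sum => i.
by apply: measurableT_comp mf _; exact: measurable_ev.
Qed.

End eigenvalue_measurability.

Section esd_integrals.
Context {R : realType} (n : nat).
Local Open Scope ereal_scope.
Implicit Types (T : 'M[R]_n) (f : R -> R).

Lemma ge0_integral_esd T f : sym_mx T -> measurable_fun setT f ->
  (forall x, 0 <= f x)%R ->
  \int[esd T]_x (f x)%:E = (n%:R^-1 * tr_fun f T)%:E.
Proof.
move=> Ts mf f0; rewrite /esd.
have mEf : measurable_fun setT (fun x : measurableTypeR R => (f x)%:E).
  exact/measurable_EFinP.
rewrite ge0_integral_mscale//; last by move=> x _; rewrite lee_fin.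
rewrite ge0_integral_measure_sum//; last by move=> x _; rewrite lee_fin.
rewrite EFinM tr_funE// -sumEFin; congr (_ * _).
apply: eq_bigr => i _; rewrite integral_dirac//.
by rewrite diracT mul1e.
Qed.

Lemma integral_esd T f : sym_mx T -> measurable_fun setT f ->
  \int[esd T]_x (f x)%:E = (n%:R^-1 * tr_fun f T)%:E.
Proof.
move=> Ts mf; rewrite integralE.
have E1 : (fun x : measurableTypeR R => (f x)%:E)^\+ = fun x => (Order.max (f x) 0%R)%:E.
  by apply/funext => x; rewrite funeposE EFin_max.
have E2 : (fun x : measurableTypeR R => (f x)%:E)^\- = fun x => (Order.max (- f x) 0%R)%:E.
  by apply/funext => x; rewrite funenegE EFin_max EFinN.
rewrite E1 E2 !ge0_integral_esd//.
- rewrite -EFinB -mulrBr !tr_funE// -sumrB; congr (_ * _)%:E.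
  apply: eq_bigr => i _; rewrite /Order.max; case: ifP; case: ifP; lra.
- by apply: measurable_maxr => //; exact: measurable_funN.
- by move=> x; rewrite le_max lexx orbT.
- exact: measurable_maxr.
- by move=> x; rewrite le_max lexx orbT.
Qed.

Lemma esdE T (B : set R) : sym_mx T ->
  esd T B = (n%:R^-1 * \sum_(i < n) \1_B (ev T i))%:E.
Proof.
move=> Ts; by rewrite /esd /mscale /msum EFinM -sumEFin; congr (_ * _).
Qed.

Context d (Om : measurableType d) (P : probability Om R).
Variable (H : Om -> 'M[R]_n).
Hypothesis mH : measurable_fun setT H.
Hypothesis symH : forall w, sym_mx (H w).

Lemma integral_mean_esd f : measurable_fun setT f -> (forall x, 0 <= f x)%R ->
  \int[mean_esd P H]_x (f x)%:E = \int[P]_w (n%:R^-1 * tr_fun f (H w))%:E.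
Proof.
move=> mf f0.
have mEf : measurable_fun setT (fun x : measurableTypeR R => (f x)%:E).
  exact/measurable_EFinP.
have mL (i : nat) : measurable_fun setT (fun w => ev (H w) i : measurableTypeR R).
  have [i_lt|i_ge] := ltnP i n; first exact: (measurable_ev mH symH (Ordinal i_lt)).
  rewrite (_ : (fun w => _) = cst 0%R)//; apply/funext => w.
  by rewrite /ev nth_default// size_eigvals.
pose X (i : nat) : {mfun Om >-> measurableTypeR R} :=
  HB.pack_for {mfun Om >-> measurableTypeR R} (fun w => ev (H w) i : measurableTypeR R)
  (isMeasurableFun.Build _ _ _ _ _ (mL i)).
have n1 : (0 <= n%:R^-1 :> R)%R by [].
(* The average of the laws of the ordered eigenvalues: a genuine measure that agrees with [mean_esd]
   on measurable sets. *)
pose M : {measure set (measurableTypeR R) -> \bar R} :=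
  mscale (NngNum n1) (msum (fun i => distribution P (X i)) n).
rewrite (@eq_integral_raw _ _ _ _ M); last first.
  move=> A mA; rewrite /mean_esd; under eq_integral do rewrite esdE//.
  have mI i : measurable_fun setT (fun w => \1_A (ev (H w) i) : R).
    by apply: (measurableT_comp _ (mL i)); exact: measurable_indic.
  have mXA i : measurable (X i @^-1` A).
    by rewrite -[X in measurable X]setTI; exact (mL i measurableT A mA).
  under eq_integral do rewrite EFinM.
  rewrite ge0_integralZl_EFin//; last 2 first.
  - by move=> w _; rewrite lee_fin sumr_ge0.
  - by apply/measurable_EFinP; apply: measurable_sum => i; exact: mI.
  rewrite /M /mscale/= /msum; congr (_ * _).
  under eq_integral do rewrite -sumEFin.
  rewrite ge0_integral_sum//; last by move=> i; apply/measurable_EFinP; exact: mI.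
  rewrite /=; apply: eq_bigr => i _; transitivity (P (X i @^-1` A `&` setT)).
    by rewrite -integral_indic.
  by rewrite setIT.
rewrite ge0_integral_mscale//; last by move=> x _; rewrite lee_fin.
rewrite ge0_integral_measure_sum//; last by move=> x _; rewrite lee_fin.
have f0' (y : measurableTypeR R) : 0 <= (f y)%:E by rewrite lee_fin.
under eq_bigr do rewrite ge0_integral_distribution//.
under [RHS]eq_integral do rewrite EFinM tr_funE// -sumEFin.
have mf' (i : 'I_n) : measurable_fun setT (fun w => (f (ev (H w) i))%:E).
  by apply/measurable_EFinP; exact: (measurableT_comp mf (measurable_ev mH symH i)).
rewrite ge0_integralZl_EFin//; last 2 first.
- by move=> w _; apply: sume_ge0 => i _; rewrite lee_fin.
- by apply: emeasurable_sum => i _; exact: mf'.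
by rewrite ge0_integral_sum// => i w _; rewrite lee_fin.
Qed.

End esd_integrals.

(** * Lipschitz test functions and distances between measures *)

Section lipschitz.
Context {R : realType}.
Implicit Types (f : R -> R).

Lemma lipR_le f (c : R) : 0 <= c -> (forall x y, `|f x - f y| <= c * `|x - y|) ->
  (lipR f <= c%:E)%E.
Proof.
move=> c0 fc; apply: ge_ereal_sup => _ [[x y] _ <-] /=; rewrite lee_fin.
have [->|xy] := eqVneq (x - y) 0; first by rewrite normr0 invr0 mulr0.
by rewrite ler_pdivrMr ?normr_gt0.
Qed.

Lemma lipR_ge f (c : R) : (lipR f <= c%:E)%E ->
  forall x y, `|f x - f y| <= c * `|x - y|.
Proof.
move=> fc x y; have [->|xy] := eqVneq x y; first by rewrite !subrr normr0 mulr0.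
rewrite -ler_pdivrMr ?normr_gt0 ?subr_eq0// -lee_fin; apply: le_trans fc.
by apply: ereal_sup_ubound; exists (x, y).
Qed.

Lemma lipR_ge0 f : (0 <= lipR f)%E.
Proof.
by apply: ereal_sup_ubound; exists (0, 0) => //=; rewrite subrr normr0 mul0r.
Qed.

Lemma supnorm_le f (b : R) : (forall x, `|f x| <= b) -> (supnorm f <= b%:E)%E.
Proof. by move=> fb; apply: ge_ereal_sup => _ [x _ <-]; rewrite lee_fin. Qed.

Lemma supnorm_ge f (b : R) : (supnorm f <= b%:E)%E -> forall x, `|f x| <= b.
Proof.
move=> fb x; rewrite -lee_fin; apply: le_trans fb.
by apply: ereal_sup_ubound; exists x.
Qed.

Lemma supnorm_ge0 f : (0 <= supnorm f)%E.
Proof.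
apply: (@le_trans _ _ `|f 0|%:E); first by rewrite lee_fin.
by apply: ereal_sup_ubound; exists 0.
Qed.

Lemma lip_continuous f (c : R) : (forall x y, `|f x - f y| <= c * `|x - y|) ->
  continuous f.
Proof.
move=> fc x; apply/cvgrPdist_lt => e e0.
have c0 : 0 <= c.
  by have := le_trans (normr_ge0 _) (fc 1 0); rewrite subr0 normr1 mulr1.
have ce : 0 < e / (c + 1) by rewrite divr_gt0//; lra.
apply/nbhs_ballP; exists (e / (c + 1)) => //= y; rewrite /ball/= => xy.
apply: le_lt_trans (fc _ _) _; apply: (@le_lt_trans _ _ (c * (e / (c + 1)))).
  by rewrite ler_wpM2l// ltW.
rewrite mulrA ltr_pdivrMr; last lra.
by rewrite mulrC ltr_pM2l//; lra.
Qed.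

Lemma lip_measurable f (c : R) : (forall x y, `|f x - f y| <= c * `|x - y|) ->
  measurable_fun setT f.
Proof. by move=> /lip_continuous; exact: continuous_measurable_fun. Qed.

Local Open Scope ereal_scope.
Implicit Types mu nu : set (measurableTypeR R) -> \bar R.

(** Dividing by the sum of a sup bound and a Lipschitz constant brings any bounded Lipschitz
    function into the class defining [dBL]. *)
Lemma dBL_ge mu nu f (c b : R) (e : \bar R) :
  (forall x y, `|f x - f y| <= c * `|x - y|)%R -> (forall x, `|f x| <= b)%R ->
  (0 <= c)%R -> (0 < b + c)%R -> dBL mu nu <= e ->
  int_gap mu nu (fun x => (b + c)^-1 * f x)%R <= e.
Proof.
move=> fc fb c0 bc; apply: le_trans; apply: ereal_sup_ubound.
exists (fun x => (b + c)^-1 * f x)%R => //=.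
have bc' : (0 < (b + c)^-1)%R by rewrite invr_gt0.
have b0 : (0 <= b)%R by apply: le_trans (fb 0%R).
apply: (@le_trans _ _ (((b + c)^-1 * c)%:E + ((b + c)^-1 * b)%:E)).
  apply: leeD.
    apply: lipR_le => [|x y]; first by rewrite mulr_ge0// ltW.
    by rewrite -mulrBr normrM gtr0_norm// -mulrA ler_pM2l.
  by apply: supnorm_le => x; rewrite normrM gtr0_norm// ler_pM2l.
by rewrite -EFinD lee_fin -mulrDr [(c + b)%R]addrC mulVf// gt_eqF.
Qed.

Lemma dBL_gtP mu nu (e : \bar R) : e < dBL mu nu <->
  exists2 f : R -> R, lipR f + supnorm f <= 1 & e < int_gap mu nu f.
Proof.
split=> [/ereal_sup_gt[_ [f ? <-] ?]|[f fC /lt_le_trans]]; first by exists f.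
by apply; apply: ereal_sup_ubound; exists f.
Qed.

Lemma dKS_gtP mu nu (e : \bar R) : e < dKS mu nu <->
  exists x : R, e < `| mu `]-oo, x]%classic - nu `]-oo, x]%classic |.
Proof.
split=> [/ereal_sup_gt[_ [x _ <-] ?]|[x /lt_le_trans]]; first by exists x.
by apply; apply: ereal_sup_ubound; exists x.
Qed.

Lemma dBL_class f : lipR f + supnorm f <= 1 ->
  (forall x y, `|f x - f y| <= 1 * `|x - y|)%R /\ (forall x, `|f x| <= 1)%R.
Proof.
move=> h; split.
  by apply: lipR_ge; apply: le_trans h; rewrite leeDl// supnorm_ge0.
by apply: supnorm_ge; apply: le_trans h; rewrite leeDr// lipR_ge0.
Qed.

Lemma dBL_le_W1 mu nu : dBL mu nu <= W1 mu nu.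
Proof.
apply: le_ereal_sup => _ [f /= h <-]; exists f => //=.
by apply: le_trans h; rewrite leeDl// supnorm_ge0.
Qed.

End lipschitz.

Section distance_events.
Context {R : realType} (n : nat) d (Om : measurableType d).
Variable (H : Om -> 'M[R]_n).
Hypothesis mH : measurable_fun setT H.
Hypothesis symH : forall w, sym_mx (H w).

Lemma bounded_integral_fin (nu : probability (measurableTypeR R) R) (f : R -> R) (b : R) :
  measurable_fun setT f -> (forall x, `|f x| <= b) ->
  (\int[nu]_x (f x)%:E)%E \is a fin_num.
Proof.
move=> mf fb; apply: integrable_fin_num => //.
apply: (@le_integrable _ _ _ nu setT measurableT _ (cst b%:E)).
- exact/measurable_EFinP.
- move=> x _; rewrite /= lee_fin; apply: le_trans (fb x) (ler_norm _).
- exact: finite_measure_integrable_cst.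
Qed.

Lemma continuous_sum_ev (f : R -> R) : continuous f ->
  continuous (fun T : 'M[R]_n => \sum_(i < n) f (ev (symz T) i)).
Proof.
move=> cf; apply: continuous_big => [|i _ T]; first exact: add_continuous.
apply: (@continuous_comp _ _ _ (fun T : 'M[R]_n => ev (symz T) i) f); last exact: cf.
exact: continuous_evz.
Qed.

(** The supremum runs over an uncountable class, so measurability is topological: for each test
    function the condition is open in the matrix, and a union of open sets is open. *)
Lemma measurable_dBL_gt (nu : probability (measurableTypeR R) R) (e : R) :
  measurable [set w | (e%:E < dBL (esd (H w)) nu)%E].
Proof.
pose Cl := [set f : R -> R | (lipR f + supnorm f <= 1)%E].
pose U f : set 'M[R]_n := [set T | (e%:E < int_gap (esd (symz T)) nu f)%E].
have -> : [set w | (e%:E < dBL (esd (H w)) nu)%E] = H @^-1` \bigcup_(f in Cl) U f.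
  apply/seteqP; split => w.
    move=> /dBL_gtP[f fC h]; exists f; first exact: fC.
    by rewrite /U /mkset symz_id.
  move=> [f fC h]; apply/dBL_gtP; exists f; first exact: fC.
  by move: h; rewrite /U /mkset symz_id.
rewrite -[X in measurable X]setTI; apply: mH => //; apply: measurable_mx_open.
apply: bigcup_open => f /dBL_class[f1 f2].
have mf := lip_measurable f1; have cf := lip_continuous f1.
pose r := fine (\int[nu]_x (f x)%:E)%E.
have -> : U f = (fun T => `|n%:R^-1 * (\sum_(i < n) f (ev (symz T) i)) - r|) @^-1` [set x | e < x].
  apply/seteqP; split => T; rewrite /U /preimage /mkset /int_gap integral_esd ?tr_funE//; try exact: symz_sym.
    by rewrite -[X in (_ - X)%E](fineK (bounded_integral_fin nu mf f2)) -EFinB lte_fin.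
  by rewrite -[X in (_ - X)%E](fineK (bounded_integral_fin nu mf f2)) -EFinB lte_fin.
apply: open_comp; last exact: open_gt.
move=> T _; apply: (@continuous_comp _ _ _ (fun T : 'M[R]_n => n%:R^-1 * (\sum_(i < n) f (ev (symz T) i)) - r) Num.norm); last exact: norm_continuous.
apply: (@cvgB _ _ _ _ (nbhs_filter T)); last exact: (@cvg_cst _ _ _ _ (nbhs_filter T)).
apply: (@cvgM _ _ _ (nbhs_filter T)); first exact: (@cvg_cst _ _ _ _ (nbhs_filter T)).
exact: (continuous_sum_ev cf).
Qed.

Lemma gap_right (s : seq R) (x : R) :
  exists2 t, 0 < t & forall y, y \in s -> x < y -> x + t < y.
Proof.
elim: s => [|a s [t t0 IH]]; first by exists 1.
have [xa|ax] := ltP x a; last first.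
  exists t => // y; rewrite inE => /orP[/eqP->|]; first by rewrite ltNge ax.
  exact: IH.
have a0 : 0 < (a - x) / 2 by rewrite divr_gt0// subr_gt0.
exists (Num.min t ((a - x) / 2)); first by rewrite lt_min t0.
move=> y; rewrite inE => /orP[/eqP-> _|ys xy].
  by apply: (@le_lt_trans _ _ (x + (a - x) / 2)); [rewrite lerD2l ge_min lexx orbT|lra].
by apply: (@le_lt_trans _ _ (x + t)); [rewrite lerD2l ge_min lexx|exact: IH].
Qed.

Variable (H' : Om -> 'M[R]_n).
Hypothesis mH' : measurable_fun setT H'.
Hypothesis symH' : forall w, sym_mx (H' w).

(** The two distribution functions are right-continuous steps: no eigenvalue lies just to the right
    of [x], so a rational point there gives the same values and rationals suffice in the
    supremum. *)
Lemma measurable_dKS_gt (e : R) :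
  measurable [set w | (e%:E < dKS (esd (H w)) (esd (H' w)))%E].
Proof.
pose F (T : 'M[R]_n) (x : R) : R := n%:R^-1 * \sum_(i < n) \1_(`]-oo, x]%classic : set R) (ev T i).
have mF (T : Om -> 'M[R]_n) x : measurable_fun setT T -> (forall w, sym_mx (T w)) ->
    measurable_fun setT (fun w => F (T w) x).
  move=> mT sT; apply: measurable_funM => //; apply: measurable_sum => i.
  by apply: measurableT_comp (measurable_ev mT sT i); exact: measurable_indic.
have FE w x : (`| esd (H w) `]-oo, x]%classic - esd (H' w) `]-oo, x]%classic | =
    (`|F (H w) x - F (H' w) x|)%:E)%E.
  have E1 : esd (H w) `]-oo, x]%classic = (F (H w) x)%:E := esdE _ (symH w).
  have E2 : esd (H' w) `]-oo, x]%classic = (F (H' w) x)%:E := esdE _ (symH' w).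
  exact: (congr2 (fun a b : \bar R => `|a - b|%E) E1 E2).
have -> : [set w | (e%:E < dKS (esd (H w)) (esd (H' w)))%E] =
    \bigcup_(x : rat) [set w | e < `|F (H w) (ratr x) - F (H' w) (ratr x)|].
  apply/seteqP; split => w; last first.
    move=> [q _]; rewrite /mkset => h; apply/dKS_gtP; exists (ratr q).
    by rewrite FE lte_fin.
  move=> /dKS_gtP[x]; rewrite FE lte_fin => xe.
  have [t t0 tP] := gap_right (eigvals (H w) ++ eigvals (H' w)) x.
  have xt : x < x + t by lra.
  have [q] := rat_in_itvoo xt; rewrite in_itv/= => /andP[xq qt].
  exists q => //; rewrite /mkset.
  suff E T : sym_mx T -> {subset eigvals T <= eigvals (H w) ++ eigvals (H' w)} ->
      F T (ratr q) = F T x.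
    by rewrite !E// => y; rewrite mem_cat => ->; rewrite ?orbT.
  move=> sT sub; congr (_ * _); apply: eq_bigr => i _; rewrite !indicE; congr ((nat_of_bool _)%:R).
  have iT : ev T i \in eigvals T by apply: mem_nth; rewrite size_eigvals.
  apply/idP/idP => /set_mem; rewrite /= in_itv/= => h; apply/mem_set; rewrite /= in_itv/=.
    rewrite leNgt; apply/negP => /(tP _ (sub _ iT)) h'; move: h; lra.
  by apply: le_trans h _; exact: ltW.
apply: bigcupT_measurable_rat => q.
rewrite (_ : [set w | _] = (fun w => `|F (H w) (ratr q) - F (H' w) (ratr q)|) @^-1` `]e, +oo[%classic).
  rewrite -[X in measurable X]setTI.
  apply: (measurableT_comp (@normr_measurable R setT)) => //.
  by apply: measurable_funB; exact: mF.
by apply/seteqP; split => w /=; rewrite in_itv/= andbT.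
Qed.

End distance_events.

(** * Exponential rates *)

Section exponential_rates.
Context {R : realType}.
Local Open Scope ereal_scope.

Lemma lne_le_expR (x : \bar R) (a : R) : (lne x <= a%:E) = (x <= (expR a)%:E).
Proof.
case: x => [x| |] //=; last by rewrite !leNye.
have [x0|x0] := leP x 0%R; first by rewrite leNye lee_fin (le_trans x0)// expR_ge0.
by rewrite !lee_fin -ler_expR lnK ?posrE.
Qed.

Lemma expR_le_lne (x : \bar R) (a : R) : ((expR a)%:E <= x) = (a%:E <= lne x).
Proof.
case: x => [x| |] //=; last by rewrite !leey.
have [x0|x0] := leP x 0%R.
  by rewrite leeNy_eq lee_fin leNgt (le_lt_trans x0) ?expR_gt0.
by rewrite !lee_fin -[in RHS]ler_expR lnK ?posrE.
Qed.

Lemma NlnN_gt0 (N : nat) : (1 < N)%N -> (0 < N%:R * ln N%:R :> R)%R.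
Proof. by move=> N1; rewrite mulr_gt0 ?ltr0n ?(ltnW N1)// ln_gt0// ltr1n. Qed.

Lemma speed_le (x : \bar R) (N : nat) (A : R) : (1 < N)%N ->
  speedNlogN N * lne x <= A%:E -> x <= (expR (A * (N%:R * ln N%:R)))%:E.
Proof.
move=> N1; have p0 := NlnN_gt0 N1; rewrite /speedNlogN => h.
by rewrite -lne_le_expR EFinM muleC -lee_pdivrMl.
Qed.

Lemma superexp_le (F : nat -> \bar R) :
  (fun N => speedNlogN N * lne (F N)) @ \oo --> -oo -> forall A : R,
  exists N0, forall N, (N0 <= N)%N -> F N <= (expR (- A * (N%:R * ln N%:R)))%:E.
Proof.
move=> /cvgeNyPle h A; have [N1 _ hN1] := h (- A)%R.
(* From [N = 2] on, [N ln N] is positive and can be cleared from the rate. *)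
exists (maxn 2 N1) => N; rewrite geq_max => /andP[N2 /hN1]; exact: speed_le.
Qed.

Lemma cvg0_le (F : nat -> \bar R) : F @ \oo --> 0 -> forall e : R, (0 < e)%R ->
  exists N0, forall N, (N0 <= N)%N -> F N <= e%:E.
Proof.
move=> F0 e e0; have : nbhs (0 : \bar R) [set y | y <= e%:E].
  exists e => //= x; rewrite /ball/= sub0r normrN => xe.
  by rewrite lee_fin; apply: ltW; apply: le_lt_trans (ler_norm _) xe.
by move=> /F0[N0 _ h]; exists N0 => N /h.
Qed.

Lemma cvg1_ge (F : nat -> \bar R) : F @ \oo --> 1 -> forall e : R, (0 < e)%R ->
  exists N0, forall N, (N0 <= N)%N -> (1 - e)%:E <= F N.
Proof.
move=> F0 e e0; have : nbhs (1 : \bar R) [set y | (1 - e)%:E <= y].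
  exists e => //= x; rewrite /ball/= => xe.
  by rewrite lee_fin; move: (ler_norm (1 - x)) xe; lra.
by move=> /F0[N0 _ h]; exists N0 => N /h.
Qed.

Lemma limn_esup_bounded (F : nat -> \bar R) : limn_esup F < +oo ->
  exists (C : R) N0, forall N, (N0 <= N)%N -> F N <= C%:E.
Proof.
move=> /ereal_inf_lt[_ [V [N0 _ VN] <-]] h.
have [C hC] : exists C : R, ereal_sup (F @` V) <= C%:E.
  case: (ereal_sup _) h => [r| |] // _; [by exists r|by exists 0%R; rewrite leNye].
exists C, N0 => N /VN VN'; apply: le_trans hC; apply: ereal_sup_ubound.
by exists N.
Qed.

End exponential_rates.

(** * Counting large eigenvalues *)

Section median_concentration.
Context {R : realType} d (Om : measurableType d) (P : probability Om R).

Lemma pr_cvg1 (f : Om -> R) : measurable_fun setT f ->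
  exists k : nat, 2^-1 <= pr P [set w | f w <= k%:R].
Proof.
move=> mf.
have mA (k : nat) : measurable [set w | f w <= k%:R].
  rewrite (_ : [set w | _] = f @^-1` `]-oo, k%:R]%classic); last first.
    by apply/seteqP; split => w /=; rewrite in_itv.
  by rewrite -[X in measurable X]setTI; exact: mf.
have := @nondecreasing_cvg_mu _ _ _ P (fun k => [set w | f w <= k%:R]) mA.
rewrite (_ : \bigcup_n _ = setT); last first.
  apply/seteqP; split => // w _; exists (Num.trunc `|f w|).+1 => //=.
  by apply: le_trans (ler_norm _) (ltW (truncnS_gt _)).
move=> /(_ measurableT) h; have /h : {homo (fun k : nat => [set w | f w <= k%:R]) : n m / (n <= m)%N >-> (n <= m)%O}.
  by move=> m n mn; apply/subsetPset => w /= /le_trans; apply; rewrite ler_nat.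
have half : (0 : R) < 2^-1 by [].
move=> hc; have : (P \o (fun k : nat => [set w | f w <= k%:R])) x @[x --> \oo] --> 1%E.
  by rewrite -(probability_setT P); exact: hc.
move=> /cvg1_ge/(_ _ half)[k /(_ k (leqnn k))] /=.
by rewrite prE// lee_fin => hk; exists k; move: hk; lra.
Qed.

Variables (k : nat) (X : {RV P >-> 'rV[R]_k}) (phi : R -> R) (B : R).
Hypothesis indX : independent_entries P X.
Hypothesis mphi : measurable_fun setT phi.
Hypothesis B0 : 0 < B.
Hypothesis phiB : forall x, `|phi x| <= B.

Let Y w : 'rV[R]_k := \row_i phi (X w ord0 i).

Variables (f : 'rV[R]_k -> R) (L : R).
Hypothesis f0 : forall x, 0 <= f x.
Hypothesis f_quasi_convex : forall a, is_convex [set x | f x <= a].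
Hypothesis f_lip : forall x y, f x <= f y + L * Num.sqrt (sqn (x - y)).
Hypothesis L0 : 0 <= L.
Hypothesis mfY : measurable_fun setT (fun w => f (Y w)).

Let mle a : measurable [set w | f (Y w) <= a].
Proof.
rewrite (_ : [set w | _] = (fun w => f (Y w)) @^-1` `]-oo, a]%classic); last first.
  by apply/seteqP; split => w /=; rewrite in_itv.
by rewrite -[X in measurable X]setTI; exact: mfY.
Qed.

Let mlt a : measurable [set w | a < f (Y w)].
Proof.
rewrite (_ : [set w | _] = ~` [set w | f (Y w) <= a]); first exact: measurableC.
by apply/seteqP; split => w /=; rewrite ltNge => /negP.
Qed.

(** Talagrand's inequality for a convex sublevel set and a superlevel set; the Lipschitz bound keeps
    them at distance at least [s]. *)
Lemma quasi_convex_pair (a s : R) : 0 < s ->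
  pr P [set w | f (Y w) <= a] * pr P [set w | a + L * s < f (Y w)] <=
    expR (- (s ^+ 2 / (256 * B ^+ 2))).
Proof.
move=> s0; have s20 : 0 < s ^+ 2 by rewrite exprn_gt0.
have := @talagrand _ _ _ _ _ X _ _ indX mphi B0 phiB [set x | f x <= a]
  [set x | a + L * s < f x] _ (@f_quasi_convex a) s20 (mle a) (mlt _).
apply => x y /= fx fy.
rewrite leNgt; apply/negP => xy; move: fx; apply/negP; rewrite -leNgt.
apply: le_trans (f_lip x y) _; rewrite lerD// ler_wpM2l//.
by rewrite -(ger0_norm (ltW s0)) -sqrtr_sqr ler_wsqrtr// ltW.
Qed.

(** [M] is the least natural number with [P (f <= M) >= 1/2], so also [P (f > M - 1) >= 1/2]. The
    pair inequality at [M] controls the upper tail and, ending at [M - 1], the lower one. The 1 in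
    the deviation pays for the integer median, the 4 for two tails and two divisions by [1/2]. *)
Lemma quasi_convex_median : exists M : R, forall s, 0 < s ->
  pr P [set w | 1 + L * s < `|f (Y w) - M| ] <= 4 * expR (- (s ^+ 2 / (256 * B ^+ 2))).
Proof.
have [k0 hk0] := pr_cvg1 mfY.
have ex : exists k : nat, 2^-1 <= pr P [set w | f (Y w) <= k%:R] by exists k0.
have [M hM Mmin] := ex_minnP ex.
have hM' : 2^-1 <= pr P [set w | M%:R - 1 < f (Y w)].
  have -> : [set w | M%:R - 1 < f (Y w)] = ~` [set w | f (Y w) <= M%:R - 1].
    by apply/seteqP; split => w /=; rewrite ltNge => /negP.
  rewrite prC//; suff : pr P [set w | f (Y w) <= M%:R - 1] <= 2^-1 by lra.
  case: M hM Mmin => [|M] hM Mmin.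
    rewrite (_ : [set w | _] = set0) ?pr0//.
    by rewrite -subset0 => w /=; have := f0 (Y w); lra.
  have -> : M.+1%:R - 1 = M%:R :> R by rewrite -natr1 addrK.
  rewrite leNgt; apply/negP => /ltW /Mmin; by rewrite ltnn.
exists M%:R => s s0; set q := expR _.
have q0 : 0 <= q by exact: expR_ge0.
have h1 : pr P [set w | M%:R + L * s < f (Y w)] <= 2 * q.
  have := quasi_convex_pair M%:R s0; rewrite -/q.
  have := pr_ge0 P [set w | M%:R + L * s < f (Y w)]; nra.
have h2 : pr P [set w | f (Y w) <= M%:R - 1 - L * s] <= 2 * q.
  have := quasi_convex_pair (M%:R - 1 - L * s) s0; rewrite -/q subrK.
  have := pr_ge0 P [set w | f (Y w) <= M%:R - 1 - L * s]; nra.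
have mm : measurable [set w | 1 + L * s < `|f (Y w) - M%:R| ].
  rewrite (_ : [set w | _] = (fun w => `|f (Y w) - M%:R|) @^-1` `]1 + L * s, +oo[%classic).
    rewrite -[X in measurable X]setTI.
    apply: (measurableT_comp (@normr_measurable R setT)) => //.
    exact: measurable_funB.
  by apply/seteqP; split => w /=; rewrite in_itv/= andbT.
apply: (@le_trans _ _ (pr P ([set w | M%:R + L * s < f (Y w)] `|`
    [set w | f (Y w) <= M%:R - 1 - L * s]))).
  apply: pr_le => //; first exact: measurableU.
  move=> w /=; rewrite ltr_normr => /orP[h|h]; [left|right]; lra.
by apply: le_trans (prU _ _ _) _ => //; lra.
Qed.

End median_concentration.

(** * Hinge sums over the eigenvalues as functions of the input *)

Section truncated_trace.
Context {R : realType}.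

Definition hinge (K x : R) : R := Num.max (`|x| - K) 0.

Lemma hinge_ge0 K x : 0 <= hinge K x.
Proof. by rewrite le_max lexx orbT. Qed.

Lemma hinge_subgradient K x : subgradient (hinge K) x.
Proof.
rewrite /hinge; have [h|h] := leP (`|x| - K) 0.
  exists 0, 0; split => [|y]; rewrite mul0r addr0; last by rewrite le_max lexx orbT.
  by apply/max_idPr.
have [x0|x0] := leP 0 x.
  exists 1, (- K); split => [|y]; rewrite mul1r; last by rewrite le_max lerD2r ler_norm.
  by rewrite -[X in _ = X - _]ger0_norm//; apply/max_idPl/ltW.
exists (- 1), (- K); split => [|y]; rewrite mulN1r; last first.
  by rewrite le_max lerD2r -normrN ler_norm.
by rewrite -[X in _ = X - _]ltr0_norm//; apply/max_idPl/ltW.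
Qed.

Lemma hinge_lip K x y : `|hinge K x - hinge K y| <= 1 * `|x - y|.
Proof.
rewrite mul1r /hinge.
have h1 : `|x| - `|y| <= `|x - y| by rewrite lerBlDr -{1}(subrK y x) ler_normD.
have h2 : `|y| - `|x| <= `|x - y|.
  by rewrite distrC lerBlDr -{1}(subrK x y) ler_normD.
have h3 := normr_ge0 (x - y).
by rewrite /Order.max; do 2 case: ifP => ?; rewrite ler_norml; lra.
Qed.

Variables (k N : nat) (Phi : 'rV[R]_k -> 'M[R]_N) (L : R).
Hypothesis Phi_sym : forall x, sym_mx (Phi x).
Hypothesis Phi_lip : (lip_sym Phi <= L%:E)%E.
Hypothesis Phi_conv : forall A : set 'M[R]_N, A `<=` @sym_mx R N -> convex_set A ->
  convex_set (Phi @^-1` A).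
Hypothesis L0 : 0 <= L.

Lemma sqn_eq0 n (v : 'rV[R]_n) : sqn v = 0 -> v = 0.
Proof.
move=> /eqP; rewrite psumr_eq0 => [/allP h|i _]; last by rewrite sqr_ge0.
apply/rowP => i; rewrite mxE; apply/eqP; rewrite -sqrf_eq0.
by have := h i (mem_index_enum i).
Qed.

(** [symF_norm] counts each off-diagonal pair once and the Hilbert-Schmidt norm counts it twice. *)
Lemma hs_symF (E : 'M[R]_N) : sym_mx E -> hs E <= Num.sqrt 2 * symF_norm E.
Proof.
move=> Es; rewrite /hs /symF_norm -sqrtrM//; apply: ler_wsqrtr.
have -> : \sum_i \sum_j E i j ^+ 2 =
    \sum_(i < N) \sum_(j < N | (i <= j)%N) E i j ^+ 2 +
    \sum_(i < N) \sum_(j < N | ~~ (i <= j)%N) E i j ^+ 2.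
  by rewrite -big_split; apply: eq_bigr => i _; rewrite (bigID (fun j : 'I_N => (i <= j)%N)).
rewrite mulr_natl mulr2n lerD2l.
under eq_bigr do rewrite big_mkcond.
rewrite exchange_big; apply: ler_sum => i _; rewrite -big_mkcond.
have Eij (j : 'I_N) : E j i = E i j by rewrite -[in LHS](Es : E^T = E) mxE.
under eq_bigr do rewrite Eij.
rewrite [leRHS]big_mkcond [leLHS]big_mkcond; apply: ler_sum => j _.
case: ifP => [|_]; last by case: ifP => // _; exact: sqr_ge0.
by rewrite -ltnNge => /ltnW ->.
Qed.

Lemma Phi_hs x y : hs (Phi x - Phi y) <= Num.sqrt 2 * L * Num.sqrt (sqn (x - y)).
Proof.
have Es : sym_mx (Phi x - Phi y).
  by rewrite /sym_mx/= linearB/= (Phi_sym x : _^T = _) (Phi_sym y : _^T = _).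
apply: le_trans (hs_symF Es) _; rewrite -mulrA ler_wpM2l ?sqrtr_ge0//.
have [xy|xy] := eqVneq (sqn (x - y)) 0.
  have /eqP := sqn_eq0 xy; rewrite subr_eq0 => /eqP ->; rewrite !subrr.
  rewrite /symF_norm big1 ?sqrtr0 ?mulr_ge0 ?sqrtr_ge0// => i _.
  by rewrite big1// => j _; rewrite mxE expr0n.
have xy0 : 0 < Num.sqrt (sqn (x - y)) by rewrite sqrtr_gt0 lt_neqAle eq_sym xy sqn_ge0.
rewrite -ler_pdivrMr// -lee_fin; apply: le_trans Phi_lip.
by apply: ereal_sup_ubound; exists (x, y).
Qed.

(* The trace of a convex function is convex on symmetric matrices, so its
   sublevel sets are convex and pull back along [Phi]. *)
Lemma tr_hinge_quasi_convex K a : is_convex [set x | tr_fun (hinge K) (Phi x) <= a].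
Proof.
pose A := [set T : 'M[R]_N | sym_mx T /\ tr_fun (hinge K) T <= a].
have cA : convex_set A.
  move=> T S l /set_mem[Ts Ta] /set_mem[Ss Sa]; apply/mem_set; split.
    by rewrite /sym_mx/= linearD/= !linearZ/= (Ts : _^T = _) (Ss : _^T = _).
  have l01 : 0 <= l%:num <= 1 by rewrite ge0 le1.
  apply: le_trans (tr_fun_convex Ts Ss l01 (hinge_subgradient K)) _.
  have /andP[l0 l1] := l01; nra.
move=> x y t Ax Ay /andP[t0 t1].
pose l : {i01 R} := Itv01 t0 t1.
have cP : convex_set (Phi @^-1` A) by apply: Phi_conv cA => T [].
have inA z : tr_fun (hinge K) (Phi z) <= a -> z \in Phi @^-1` A.
  by move=> h; apply/mem_set; split.
by have /set_mem[_] := cP x y l (inA _ Ax) (inA _ Ay).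
Qed.

Lemma tr_hinge_lip K x y : tr_fun (hinge K) (Phi x) <= tr_fun (hinge K) (Phi y) +
  Num.sqrt (2 * N%:R) * L * Num.sqrt (sqn (x - y)).
Proof.
apply: le_trans (tr_fun_lip (Phi_sym x) (Phi_sym y) (hinge_subgradient K) ler01 (hinge_lip K)) _.
rewrite lerD2l mul1r [2 * _]mulrC sqrtrM ?ler0n// -!mulrA ler_wpM2l ?sqrtr_ge0//.
by rewrite mulrA Phi_hs.
Qed.

End truncated_trace.

Section eigenvalue_counts.
Context {R : realType} (N : nat).
Implicit Types T S : 'M[R]_N.

(** The left half-line is closed so that the number of eigenvalues outside is [N - F K + F (- K)],
    with [F x] the number of eigenvalues in []-oo, x]]; [dKS] then compares such numbers
    directly. *)
Definition outside (K x : R) : R :=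
  \1_(`]K, +oo[%classic : set R) x + \1_(`]-oo, (- K)]%classic : set R) x.

Definition count_outside (K : R) T : R := tr_fun (outside K) T.

Lemma indic_itvE (i : interval R) x : \1_([set` i] : set R) x = (x \in i)%:R :> R.
Proof.
rewrite indicE; congr ((nat_of_bool _)%:R).
by apply/idP/idP => [/set_mem//|h]; apply/mem_set.
Qed.

Lemma outsideE K x : outside K x = (K < x)%R%:R + (x <= - K)%R%:R.
Proof. by rewrite /outside !indic_itvE !in_itv/= andbT. Qed.

Lemma measurable_outside K : measurable_fun setT (outside K).
Proof. by apply: measurable_funD; exact: measurable_indic. Qed.

Lemma tr_fun_le T (f g : R -> R) : sym_mx T -> (forall x, f x <= g x) ->
  tr_fun f T <= tr_fun g T.
Proof. by move=> Ts fg; rewrite !tr_funE// ler_sum. Qed.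

Lemma tr_funB T (f g : R -> R) : sym_mx T ->
  tr_fun (fun x => f x - g x) T = tr_fun f T - tr_fun g T.
Proof. by move=> Ts; rewrite !tr_funE// sumrB. Qed.

(** The difference of the hinges rises linearly from 0 at [|x| = K] to 1 at [|x| = K + 1], so it
    lies between the two indicators. *)
Lemma hinge_diff_ge K x : 0 <= K -> outside (K + 1) x <= hinge K x - hinge (K + 1) x.
Proof.
move=> K0; rewrite outsideE /hinge.
have n1 := ler_norm x; have n2 := ler_norm (- x); rewrite normrN in n2.
case: (ltP (K + 1) x) => h1; case: (leP x (- (K + 1))) => h2 /=;
  case: (leP (`|x| - K) 0) => h3; case: (leP (`|x| - (K + 1)) 0) => h4; lra.
Qed.

Lemma hinge_diff_le K x : 0 <= K -> hinge K x - hinge (K + 1) x <= outside K x.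
Proof.
move=> K0; rewrite outsideE /hinge.
have [x0|x0] := leP 0 x; [rewrite ger0_norm//|rewrite ltr0_norm//];
  case: (ltP K x) => h1; case: (leP x (- K)) => h2 /=;
  [case: (leP (x - K) 0) => h3; case: (leP (x - (K + 1)) 0) => h4; lra..|
   case: (leP (- x - K) 0) => h3; case: (leP (- x - (K + 1)) 0) => h4; lra| | | ];
  case: (leP (- x - K) 0) => h3; case: (leP (- x - (K + 1)) 0) => h4; lra.
Qed.

Lemma count_ge T K : 0 <= K -> sym_mx T ->
  count_outside (K + 1) T <= tr_fun (hinge K) T - tr_fun (hinge (K + 1)) T.
Proof.
by move=> K0 Ts; rewrite -tr_funB// tr_fun_le// => x; exact: hinge_diff_ge.
Qed.

Lemma count_le T K : 0 <= K -> sym_mx T ->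
  tr_fun (hinge K) T - tr_fun (hinge (K + 1)) T <= count_outside K T.
Proof.
by move=> K0 Ts; rewrite -tr_funB// tr_fun_le// => x; exact: hinge_diff_le.
Qed.

Hypothesis N0 : (0 < N)%N.

Definition cdf_count T (x : R) : R := \sum_(i < N) (ev T i <= x)%R%:R.

Lemma count_outsideE K T : sym_mx T ->
  count_outside K T = N%:R - cdf_count T K + cdf_count T (- K).
Proof.
move=> Ts; rewrite /count_outside tr_funE// /cdf_count.
under eq_bigr do rewrite outsideE; rewrite big_split/=; congr (_ + _).
have -> : N%:R = \sum_(i < N) (1 : R) by rewrite sumr_const card_ord.
rewrite -sumrB; apply: eq_bigr => i _.
by case: ltP => _ /=; rewrite ?subr0 ?subrr.
Qed.

Lemma cdf_count_dKS T S (a x : R) : sym_mx T -> sym_mx S ->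
  ~ (a%:E < dKS (esd T) (esd S))%E -> `|cdf_count T x - cdf_count S x| <= N%:R * a.
Proof.
move=> Ts Ss TS; rewrite leNgt; apply/negP => h; apply: TS; apply/dKS_gtP; exists x.
have E (Z : 'M[R]_N) : sym_mx Z -> esd Z `]-oo, x]%classic = (N%:R^-1 * cdf_count Z x)%:E.
  move=> Zs; apply: etrans (esdE _ Zs) _; congr (_ * _)%:E; apply: eq_bigr => i _.
  by rewrite indic_itvE in_itv.
rewrite (_ : (`|_|)%E = (`|N%:R^-1 * cdf_count T x - N%:R^-1 * cdf_count S x|)%:E); last first.
  exact: (congr2 (fun a b : \bar R => `|a - b|%E) (E _ Ts) (E _ Ss)).
rewrite lte_fin -mulrBr normrM gtr0_norm ?invr_gt0 ?ltr0n//.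
by rewrite -(@ltr_pM2l _ N%:R) ?ltr0n// mulVKf ?pnatr_eq0 -?lt0n.
Qed.

Lemma count_dKS T S (a K : R) : sym_mx T -> sym_mx S ->
  ~ (a%:E < dKS (esd T) (esd S))%E ->
  `|count_outside K T - count_outside K S| <= 2 * (N%:R * a).
Proof.
move=> Ts Ss TS; rewrite !count_outsideE//.
have /ler_normlP[h1 h2] := cdf_count_dKS K Ts Ss TS.
have /ler_normlP[h3 h4] := cdf_count_dKS (- K) Ts Ss TS.
apply/ler_normlP; move: h1 h2 h3 h4; move: (cdf_count T K) (cdf_count T (- K)).
move: (cdf_count S K) (cdf_count S (- K)) (N%:R : R) (N%:R * a) => x1 x2 n y x3 x4.
by move=> *; split; lra.
Qed.

End eigenvalue_counts.

Section count_concentration.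
Context {R : realType} d (Om : measurableType d) (P : probability Om R).
Variables (k N : nat) (X : {RV P >-> 'rV[R]_k}) (Phi : 'rV[R]_k -> 'M[R]_N).
Variables (L a : R).
Hypothesis N0 : (0 < N)%N.
Hypothesis indX : independent_entries P X.
Hypothesis Phi_sym : forall x, sym_mx (Phi x).
Hypothesis Phi_lip : (lip_sym Phi <= L%:E)%E.
Hypothesis Phi_conv : forall A : set 'M[R]_N, A `<=` @sym_mx R N -> convex_set A ->
  convex_set (Phi @^-1` A).
Hypothesis L0 : 0 <= L.
Hypothesis a0 : 0 < a.

Let phi (x : R) : R := if `|x| < a / L then x else 0.
Let Xc w : 'rV[R]_k := \row_i phi (X w ord0 i).

Let mphi : measurable_fun setT phi.
Proof.
rewrite /phi; apply: measurable_fun_ifT => //.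
apply: measurable_fun_ltr => //.
Qed.

Lemma measurable_Phi (Y : Om -> 'rV[R]_k) : measurable_fun setT Y ->
  measurable_fun setT (fun w => Phi (Y w)).
Proof.
move=> mY; apply: measurable_fun_mx => i j.
suff cP : continuous (fun x => Phi x i j).
  exact: (measurableT_comp (measurable_mx_continuous cP) mY).
move=> x; apply: (@cvgrPdist_le _ _ _ _ (nbhs_filter x) _ _).2 => e e0.
pose C := Num.sqrt 2 * L * Num.sqrt k%:R + 1.
have C0 : 0 < C by rewrite ltr_wpDl// !mulr_ge0// sqrtr_ge0.
have eC : 0 < e / C by rewrite divr_gt0.
apply/nbhs_ballP; exists (e / C) => //= y /mx_ballP /(_ _ _) xy.
have h1 : `|Phi x i j - Phi y i j| <= hs (Phi x - Phi y).
  rewrite -sqrtr_sqr ler_wsqrtr// (bigD1 i)//= (bigD1 j)//= !mxE -addrA lerDl.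
  by rewrite addr_ge0// sumr_ge0// => l _; rewrite ?sqr_ge0// sumr_ge0// => ? _; exact: sqr_ge0.
apply: le_trans h1 _; apply: le_trans (Phi_hs Phi_sym Phi_lip L0 x y) _.
have h2 : Num.sqrt (sqn (x - y)) <= Num.sqrt k%:R * (e / C).
  rewrite -[e / C]ger0_norm ?(ltW eC)// -sqrtr_sqr -sqrtrM// ler_wsqrtr//.
  rewrite mulr_natl -[X in _ *+ X]card_ord -sumr_const; apply: ler_sum => l _.
  rewrite !mxE -real_normK ?num_real// ler_sqr ?nnegrE ?(ltW eC)//.
  by have := xy eC ord0 l => /ltW.
apply: le_trans (ler_wpM2l _ h2) _; first by rewrite mulr_ge0// sqrtr_ge0.
rewrite mulrA -ler_pdivlMr ?divr_gt0 ?invr_gt0//.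
rewrite invf_div mulrCA divff ?gt_eqF// mulr1 /C lerDl//.
Qed.

Lemma measurable_Xc : measurable_fun setT Xc.
Proof.
apply: measurable_fun_mx => i j; under eq_fun do rewrite mxE.
have mX : measurable_fun setT (fun w => X w ord0 j).
  exact: (measurableT_comp (@measurable_entry _ _ 1 k ord0 j) (measurable_funPT X)).
exact: (measurableT_comp mphi mX).
Qed.

(** The hinge sum has Lipschitz constant [sqrt (2 N) * L] and the truncated inputs are bounded by
    [a / L], so that [L] cancels and [512 = 2 * 256]. If [L = 0] the hinge sum is constant. *)
Lemma hinge_cut_concentration (K t : R) : 0 < t -> exists M : R,
  pr P [set w | 1 + t < `|tr_fun (hinge K) (Phi (Xc w)) - M| ] <=
    4 * expR (- (t ^+ 2 / (512 * N%:R * a ^+ 2))).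
Proof.
move=> t0; have [L_eq0|L_neq0] := eqVneq L 0.
  exists (tr_fun (hinge K) (Phi 0)); rewrite (_ : [set w | _] = set0).
    by rewrite pr0 mulr_ge0 ?expR_ge0.
  rewrite -subset0 => w /=; apply/negP; rewrite -leNgt.
  have h1 := tr_hinge_lip Phi_sym Phi_lip L0 K (Xc w) 0.
  have h2 := tr_hinge_lip Phi_sym Phi_lip L0 K 0 (Xc w).
  rewrite L_eq0 mulr0 !mul0r !addr0 in h1 h2.
  rewrite (_ : _ - _ = 0) ?normr0; first lra.
  by apply/eqP; rewrite subr_eq0 eq_le h1 h2.
have L_gt0 : 0 < L by rewrite lt_neqAle eq_sym L_neq0.
have B0 : 0 < a / L by rewrite divr_gt0.
have phiB x : `|phi x| <= a / L.
  by rewrite /phi; case: ifPn => [/ltW//|_]; rewrite normr0 ltW.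
have Lam0 : 0 < Num.sqrt (2 * N%:R) * L by rewrite mulr_gt0// sqrtr_gt0 mulr_gt0// ltr0n.
have mf : measurable_fun setT (fun w => tr_fun (hinge K) (Phi (Xc w))).
  apply: (measurable_tr_fun (measurable_Phi measurable_Xc)) => [w|]; first exact: Phi_sym.
  exact: lip_measurable (hinge_lip K).
have [M hM] := @quasi_convex_median _ _ _ P k X phi (a / L) indX mphi B0 phiB
  (fun x => tr_fun (hinge K) (Phi x)) (Num.sqrt (2 * N%:R) * L)
  (fun x => sumr_ge0 _ (fun y _ => hinge_ge0 K y))
  (fun b => @tr_hinge_quasi_convex _ _ _ _ Phi_sym Phi_conv K b)
  (tr_hinge_lip Phi_sym Phi_lip L0 K) (ltW Lam0) mf.
exists M; have := hM (t / (Num.sqrt (2 * N%:R) * L)) (divr_gt0 t0 Lam0).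
rewrite mulrCA divff ?gt_eqF// mulr1.
have -> : (t / (Num.sqrt (2 * N%:R) * L)) ^+ 2 / (256 * (a / L) ^+ 2) =
    t ^+ 2 / (512 * N%:R * a ^+ 2).
  rewrite !expr_div_n exprMn sqr_sqrtr ?mulr_ge0//.
  field; rewrite ?gt_eqF ?ltr0n//=.
by [].
Qed.

(* Both hinge sums of the truncated input concentrate and their difference is
   sandwiched by eigenvalue counts, so a crude bound of probability 3/4 on the
   count at [K] locates that difference and self-improves to an exponential
   bound on the count at [K + 1]. *)
Lemma count_concentration (K A0 t q : R) : 0 <= K -> 0 < t ->
  pr P [set w | A0 < count_outside K (Phi (X w))] <= 4^-1 ->
  pr P [set w | (a%:E < dKS (esd (Phi (X w))) (esd (Phi (Xc w))))%E] <= q ->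
  q + 8 * expR (- (t ^+ 2 / (512 * N%:R * a ^+ 2))) < 3 / 4 ->
  pr P [set w | A0 + 4 * (N%:R * a) + 4 + 4 * t < count_outside (K + 1) (Phi (X w))]
    <= q + 8 * expR (- (t ^+ 2 / (512 * N%:R * a ^+ 2))).
Proof.
move=> K0 t0 h1 h2 h3; set e := expR _ in h3 *.
have K10 : 0 <= K + 1 by lra.
have [M1 hM1] := hinge_cut_concentration K t0.
have [M2 hM2] := hinge_cut_concentration (K + 1) t0.
rewrite -/e in hM1 hM2.
have mPX := measurable_Phi (measurable_funPT X).
have mPXc := measurable_Phi measurable_Xc.
have mcount J : measurable_fun setT (fun w => count_outside J (Phi (X w))).
  by apply: (measurable_tr_fun mPX) => [w|]; [exact: Phi_sym|exact: measurable_outside].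
have mhinge J : measurable_fun setT (fun w => tr_fun (hinge J) (Phi (Xc w))).
  apply: (measurable_tr_fun mPXc) => [w|]; first exact: Phi_sym.
  exact: lip_measurable (hinge_lip J).
have mgt (f : Om -> R) c : measurable_fun setT f -> measurable [set w | c < f w].
  move=> mf; rewrite (_ : [set w | _] = f @^-1` `]c, +oo[%classic).
    by rewrite -[X in measurable X]setTI; exact: mf.
  by apply/seteqP; split => w /=; rewrite in_itv/= andbT.
have mabs (f : Om -> R) M : measurable_fun setT f ->
    measurable_fun setT (fun w => `|f w - M|).
  move=> mf; apply: (measurableT_comp (@normr_measurable R setT)) => //.
  exact: measurable_funB.
pose B1 := [set w | (a%:E < dKS (esd (Phi (X w))) (esd (Phi (Xc w))))%E].
pose B2 := [set w | 1 + t < `|tr_fun (hinge K) (Phi (Xc w)) - M1| ].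
pose B3 := [set w | 1 + t < `|tr_fun (hinge (K + 1)) (Phi (Xc w)) - M2| ].
pose B4 := [set w | A0 < count_outside K (Phi (X w))].
have mB1 : measurable B1.
  by apply: measurable_dKS_gt => // w; exact: Phi_sym.
have mB2 : measurable B2 by apply: mgt; exact: mabs.
have mB3 : measurable B3 by apply: mgt; exact: mabs.
have mB4 : measurable B4 by exact: mgt.
have m123 : measurable (B1 `|` B2 `|` B3) by apply: measurableU => //; exact: measurableU.
have p123 : pr P (B1 `|` B2 `|` B3) <= q + 8 * e.
  apply: le_trans (prU _ _ _) _ => //; first exact: measurableU.
  have := prU P mB1 mB2; rewrite -/B1 -/B2 -/B3 in h2 hM1 hM2; lra.
have near w : ~ (B1 `|` B2 `|` B3) w ->
    [/\ ~ (a%:E < dKS (esd (Phi (X w))) (esd (Phi (Xc w))))%E,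
     `|tr_fun (hinge K) (Phi (Xc w)) - M1| <= 1 + t &
     `|tr_fun (hinge (K + 1)) (Phi (Xc w)) - M2| <= 1 + t].
  move=> nw; split.
  - by move=> h; apply: nw; left; left.
  - by rewrite leNgt; apply/negP => h; apply: nw; left; right.
  - by rewrite leNgt; apply/negP => h; apply: nw; right.
have [w0 nw0 nB4] : exists2 w, ~ (B1 `|` B2 `|` B3) w & ~ B4 w.
  apply: contrapT => no; have : pr P setT <= pr P (B1 `|` B2 `|` B3 `|` B4).
    apply: pr_le => //; first exact: measurableU.
    move=> w _; apply: contrapT => nw; apply: no; exists w => h; apply: nw.
      by left.
    by right.
  have := prU P m123 mB4.
  have -> : pr P setT = 1 by rewrite /pr probability_setT.
  rewrite -/B4 in h1; lra.
have M12 : M1 - M2 <= A0 + 2 * (N%:R * a) + 2 + 2 * t.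
  have [g1 /ler_normlP[? ?] /ler_normlP[? ?]] := near _ nw0.
  have /ler_normlP[? ?] := count_dKS N0 K (Phi_sym (X w0)) (Phi_sym (Xc w0)) g1.
  have := count_le K0 (Phi_sym (Xc w0)).
  have : count_outside K (Phi (X w0)) <= A0 by rewrite leNgt; exact/negP.
  lra.
apply: le_trans p123; apply: pr_le => //; first exact: mgt.
move=> w /= hw; apply: contrapT => /near[g1 /ler_normlP[? ?] /ler_normlP[? ?]].
move: hw; have /ler_normlP[? ?] := count_dKS N0 (K + 1) (Phi_sym (X w)) (Phi_sym (Xc w)) g1.
have := count_ge K0 (Phi_sym (Xc w)).
lra.
Qed.

End count_concentration.

(** * Determinants *)

Section bounded_integrals.
Context {R : realType} d (T : measurableType d) (P : probability T R).
Implicit Types f g : T -> R.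

Lemma bounded_integrable f (b : R) : measurable_fun setT f ->
  (forall x, `|f x| <= b) -> P.-integrable setT (EFin \o f).
Proof.
move=> mf fb; apply: (@le_integrable _ _ _ P setT measurableT _ (cst b%:E)).
- exact/measurable_EFinP.
- move=> x _; rewrite /= lee_fin; apply: le_trans (fb x) (ler_norm _).
- exact: finite_measure_integrable_cst.
Qed.

Lemma bounded_RintegralE f (b : R) : measurable_fun setT f ->
  (forall x, `|f x| <= b) -> (\int[P]_x (f x)%:E = (\int[P]_x f x)%:E)%E.
Proof.
move=> mf fb; rewrite /Rintegral fineK//; apply: integrable_fin_num => //.
exact: bounded_integrable mf fb.
Qed.

Lemma Rintegral_prob_cst (c : R) : \int[P]_x c = c.
Proof.
have PT : fine (P setT) = 1 by rewrite (probability_setT P).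
by rewrite Rintegral_cst// PT mulr1.
Qed.

Lemma Rintegral_prob_le f g (b : R) : measurable_fun setT f -> measurable_fun setT g ->
  (forall x, `|f x| <= b) -> (forall x, `|g x| <= b) ->
  (forall x, f x <= g x) -> \int[P]_x f x <= \int[P]_x g x.
Proof.
move=> mf mg fb gb fg; apply: le_Rintegral => //.
  exact: bounded_integrable mf fb.
exact: bounded_integrable mg gb.
Qed.

Lemma Rintegral_prob_shift f (b c : R) : measurable_fun setT f ->
  (forall x, `|f x| <= b) -> \int[P]_x (f x - c) = \int[P]_x f x - c.
Proof.
move=> mf fb; rewrite RintegralB//.
- by rewrite Rintegral_prob_cst.
- exact: bounded_integrable mf fb.
- by apply: (@bounded_integrable _ `|c|).
Qed.

End bounded_integrals.

Section test_functions.
Context {R : realType}.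
Variables (f : R -> R) (b c : R).
Hypothesis f_lip : forall x y, `|f x - f y| <= c * `|x - y|.
Hypothesis f_bdd : forall x, `|f x| <= b.
Hypothesis c0 : 0 <= c.
Hypothesis bc0 : 0 < b + c.
Implicit Types nu : probability (measurableTypeR R) R.

Let mf : measurable_fun setT f := lip_measurable f_lip.

Let scaled_gap (x y e : R) :
  (`|((b + c)^-1 * x)%:E - ((b + c)^-1 * y)%:E| <= e%:E)%E -> `|x - y| <= (b + c) * e.
Proof.
rewrite -EFinB lee_fin -mulrBr normrM gtr0_norm ?invr_gt0//.
by rewrite ler_pdivrMl.
Qed.

Let scaled_prob nu :
  (\int[nu]_x ((b + c)^-1 * f x)%:E = ((b + c)^-1 * \int[nu]_x f x)%:E)%E.
Proof.
have mf' : measurable_fun setT (fun x => (b + c)^-1 * f x) by exact: measurable_funM.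
have fb' x : `|(b + c)^-1 * f x| <= (b + c)^-1 * b.
  by rewrite normrM gtr0_norm ?invr_gt0// ler_wpM2l// invr_ge0 ltW.
rewrite (bounded_RintegralE nu mf' fb') RintegralZl//.
exact: (@bounded_integrable _ _ (measurableTypeR R) nu f b mf f_bdd).
Qed.

Lemma dBL_prob (nu1 nu2 : probability (measurableTypeR R) R) (e : R) :
  (dBL nu1 nu2 <= e%:E)%E ->
  `|\int[nu1]_x f x - \int[nu2]_x f x| <= (b + c) * e.
Proof.
move=> /(dBL_ge f_lip f_bdd c0 bc0); rewrite /int_gap !scaled_prob.
exact: scaled_gap.
Qed.

Lemma dBL_esd n (T : 'M[R]_n) nu (e : R) : sym_mx T ->
  ~ (e%:E < dBL (esd T) nu)%E ->
  `|n%:R^-1 * tr_fun f T - \int[nu]_x f x| <= (b + c) * e.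
Proof.
move=> Ts /negP; rewrite -leNgt => /(dBL_ge f_lip f_bdd c0 bc0).
rewrite /int_gap scaled_prob integral_esd//; last exact: measurable_funM.
have -> : n%:R^-1 * tr_fun (fun x => (b + c)^-1 * f x) T =
    (b + c)^-1 * (n%:R^-1 * tr_fun f T).
  by rewrite !tr_funE// -mulr_sumr mulrCA.
exact: scaled_gap.
Qed.

Hypothesis f0 : forall x, 0 <= f x.

Lemma tr_fun_bounded n (T : 'M[R]_n) : sym_mx T ->
  0 <= n%:R^-1 * tr_fun f T <= b.
Proof.
move=> Ts; rewrite tr_funE//; apply/andP; split.
  by rewrite mulr_ge0// sumr_ge0.
have [n0|n0] := posnP n.
  have -> : n%:R^-1 = 0 :> R by rewrite n0 invr0.
  by rewrite mul0r (le_trans _ (f_bdd 0)).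
rewrite ler_pdivrMl ?ltr0n// mulr_natl -[X in _ *+ X]card_ord -sumr_const.
by apply: ler_sum => i _; apply: le_trans (ler_norm _) (f_bdd _).
Qed.

Lemma dBL_mean_esd n d (Om : measurableType d) (P : probability Om R)
    (H : Om -> 'M[R]_n) nu (e : R) : measurable_fun setT H ->
  (forall w, sym_mx (H w)) -> (dBL (mean_esd P H) nu <= e%:E)%E ->
  `|\int[P]_w (n%:R^-1 * tr_fun f (H w)) - \int[nu]_x f x| <= (b + c) * e.
Proof.
move=> mH sH /(dBL_ge f_lip f_bdd c0 bc0); rewrite /int_gap scaled_prob.
have bc1 : 0 <= (b + c)^-1 by rewrite invr_ge0 ltW.
rewrite integral_mean_esd//; last 2 first.
- exact: measurable_funM.
- by move=> x; rewrite mulr_ge0.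
have mtr : measurable_fun setT (fun w => n%:R^-1 * tr_fun f (H w)).
  by apply: measurable_funM => //; exact: measurable_tr_fun.
under eq_integral => w _.
  rewrite (_ : n%:R^-1 * tr_fun (fun x => (b + c)^-1 * f x) (H w) =
    (b + c)^-1 * (n%:R^-1 * tr_fun f (H w))); last first.
    by rewrite !tr_funE// -mulr_sumr mulrCA.
  rewrite EFinM; over.
rewrite ge0_integralZl_EFin//; last 2 first.
- by move=> w _; have /andP[] := tr_fun_bounded (sH w).
- exact/measurable_EFinP.
have hb w : `|n%:R^-1 * tr_fun f (H w)| <= b.
  by have /andP[h1 h2] := tr_fun_bounded (sH w); rewrite ger0_norm.
rewrite (bounded_RintegralE P mtr hb) -EFinM.
exact: scaled_gap.
Qed.

End test_functions.

(** * The clamped logarithm as a bounded Lipschitz function *)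

Section clamped_logarithm.
Context {R : realType}.

Definition clampln (eta K x : R) : R := ln (Num.min (Num.max `|x| eta) K).

Variables (eta K : R).
Hypothesis eta0 : 0 < eta.
Hypothesis eta1 : eta <= 1.
Hypothesis K1 : 1 <= K.

Let clamp (x : R) := Num.min (Num.max `|x| eta) K.

Let clamp_ge x : eta <= clamp x.
Proof. by rewrite /clamp le_min le_max lexx orbT (le_trans eta1). Qed.

Let clamp_le x : clamp x <= K.
Proof. by rewrite /clamp ge_min lexx orbT. Qed.

Let clamp_gt0 x : 0 < clamp x. Proof. exact: lt_le_trans (clamp_ge x). Qed.

Lemma clampln_ge x : ln eta <= clampln eta K x.
Proof. by rewrite /clampln -/(clamp x) ler_ln ?posrE// clamp_ge. Qed.

Lemma clampln_le x : clampln eta K x <= ln K.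
Proof.
by rewrite /clampln -/(clamp x) ler_ln ?posrE ?clamp_le// (lt_le_trans ltr01).
Qed.

Lemma clampln_bdd x : `|clampln eta K x| <= ln K - ln eta.
Proof.
have h1 : ln eta <= 0 by exact: ln_le0.
have h2 : 0 <= ln K by exact: ln_ge0.
by have h3 := clampln_ge x; have h4 := clampln_le x; rewrite ler_norml; lra.
Qed.

Let clamp_lip x y : `|clamp x - clamp y| <= `|x - y|.
Proof.
have h1 : `|x| - `|y| <= `|x - y| by rewrite lerBlDr -{1}(subrK y x) ler_normD.
have h2 : `|y| - `|x| <= `|x - y|.
  by rewrite distrC lerBlDr -{1}(subrK x y) ler_normD.
have h3 := normr_ge0 (x - y).
have Keta : eta <= K by exact: le_trans eta1 K1.
rewrite /clamp; case: (leP `|x| eta) => ?; case: (leP `|y| eta) => ?;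
  rewrite ?(min_idPl Keta); apply/ler_normlP.
- by split; lra.
- by case: (leP `|y| K) => ?; split; lra.
- by case: (leP `|x| K) => ?; split; lra.
- by case: (leP `|x| K) => ?; case: (leP `|y| K) => ?; split; lra.
Qed.

Let clampln_lip1 x y : clampln eta K x - clampln eta K y <= eta^-1 * `|x - y|.
Proof.
have xy := le_trans (ler_norm _) (clamp_lip x y).
rewrite /clampln -/(clamp x) -/(clamp y) -ln_div ?posrE//.
have -> : clamp x / clamp y = 1 + (clamp x - clamp y) / clamp y.
  by rewrite mulrBl divff ?gt_eqF// subrKC.
apply: le_trans (le_ln1Dx _) _.
  rewrite mulrBl divff ?gt_eqF// ltrBrDr addNr divr_gt0//.
rewrite ler_pdivrMr// mulrAC.
have h : 1 <= eta^-1 * clamp y by rewrite ler_pdivlMl// mulr1.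
by have := normr_ge0 (x - y); nra.
Qed.

Lemma clampln_lip x y : `|clampln eta K x - clampln eta K y| <= eta^-1 * `|x - y|.
Proof.
apply/ler_normlP; split; last exact: clampln_lip1.
by rewrite opprB distrC; exact: clampln_lip1.
Qed.

Lemma measurable_clampln : measurable_fun setT (clampln eta K).
Proof. exact: lip_measurable clampln_lip. Qed.

End clamped_logarithm.

(** * Comparison of powers of N with N ln N *)

Section asymptotics.
Context {R : realType}.

Lemma near_powR_ge (c B : R) : 0 < c -> \forall N \near \oo, B <= N%:R `^ c.
Proof.
move=> c0; have := nbhs_infty_ger (`|B| `^ c^-1).
apply: filterS => N BN; apply: le_trans (ler_norm _) _.
have -> : `|B| = (`|B| `^ c^-1) `^ c by rewrite -powRrM mulVf ?gt_eqF// powRr1.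
by apply: ge0_ler_powR; rewrite ?nnegrE ?powR_ge0// ltW.
Qed.

Lemma near_NlnN_ge (B : R) : \forall N \near \oo, B * N%:R <= N%:R * ln (N%:R : R).
Proof.
have := nbhs_infty_ger (expR B); apply: filterS => N BN.
rewrite mulrC ler_wpM2l// -ler_expR lnK ?posrE//.
exact: lt_le_trans (expR_gt0 _) BN.
Qed.

Lemma near_small_powR (a b C e : R) : a < b -> 0 < e ->
  \forall N \near \oo, C * N%:R `^ a <= e * N%:R `^ b.
Proof.
move=> ab e0; have ba : 0 < b - a by rewrite subr_gt0.
have h1 := near_powR_ge (C / e) ba; have h2 := nbhs_infty_gt 0%N.
near=> N; have N0 : (0 : R) < N%:R by rewrite ltr0n; near: N.
have -> : N%:R `^ b = N%:R `^ (b - a) * N%:R `^ a.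
  by rewrite -powRD ?subrK//; apply/implyP => _; rewrite gt_eqF.
rewrite mulrA ler_wpM2r ?powR_ge0// mulrC -ler_pdivrMr//.
by near: N.
Unshelve. all: by end_near. Qed.

Lemma near_powR_NlnN (c A : R) : 0 < c ->
  \forall N \near \oo, A * (N%:R * ln (N%:R : R)) <= N%:R `^ (1 + c).
Proof.
move=> c0; have c20 : 0 < c / 2 by rewrite divr_gt0.
have h1 := @near_powR_ge (c / 2) (`|A| * (2 / c)) c20; have h2 := nbhs_infty_gt 0%N.
near=> N; have N0 : (0 : R) < N%:R by rewrite ltr0n; near: N.
have N1 : (1 : R) <= N%:R by rewrite ler1n -(ltr0n R).
have l0 : 0 <= ln (N%:R : R) by exact: ln_ge0.
have l1 : ln (N%:R : R) <= (2 / c) * N%:R `^ (c / 2).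
  have : ln (N%:R `^ (c / 2)) <= N%:R `^ (c / 2) by apply/ltW/ln_sublinear/powR_gt0.
  by rewrite ln_powR -ler_pdivlMl// invf_div.
have -> : N%:R `^ (1 + c) = N%:R * (N%:R `^ (c / 2) * N%:R `^ (c / 2)).
  rewrite -powRD -?splitr; last by apply/implyP => _; rewrite gt_eqF.
  by rewrite powRD ?powRr1 ?ltW//; apply/implyP => _; rewrite gt_eqF.
rewrite mulrCA ler_wpM2l ?(ltW N0)//.
apply: (@le_trans _ _ (`|A| * ((2 / c) * N%:R `^ (c / 2)))).
  apply: (@le_trans _ _ (`|A| * ln (N%:R : R))).
    by rewrite ler_wpM2r// ler_norm.
  by rewrite ler_wpM2l.
rewrite mulrA ler_wpM2r ?powR_ge0//.
by near: N.
Unshelve. all: by end_near. Qed.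

End asymptotics.

Section ge0_real_integrals.
Context {R : realType} d (T : measurableType d) (mu : {measure set T -> \bar R}).
Local Open Scope ereal_scope.

Lemma ge0_integral_EFinD (f g : T -> R) :
  measurable_fun setT f -> measurable_fun setT g ->
  (forall x, 0 <= f x)%R -> (forall x, 0 <= g x)%R ->
  \int[mu]_x (f x + g x)%:E = \int[mu]_x (f x)%:E + \int[mu]_x (g x)%:E.
Proof.
move=> mf mg f0 g0; under eq_integral do rewrite EFinD.
have f1 x : setT x -> 0 <= (f x)%:E by rewrite lee_fin.
have g1 x : setT x -> 0 <= (g x)%:E by rewrite lee_fin.
have mf1 : measurable_fun setT (EFin \o f) by exact/measurable_EFinP.
have mg1 : measurable_fun setT (EFin \o g) by exact/measurable_EFinP.
exact: (ge0_integralD mu measurableT f1 mf1 g1 mg1).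
Qed.

Lemma ge0_integral_EFinZ (f : T -> R) (c : R) : measurable_fun setT f ->
  (forall x, 0 <= f x)%R -> (0 <= c)%R ->
  \int[mu]_x (c * f x)%:E = c%:E * \int[mu]_x (f x)%:E.
Proof.
move=> mf f0 c0; under eq_integral do rewrite EFinM.
have f1 x : setT x -> 0 <= (f x)%:E by rewrite lee_fin.
have mf1 : measurable_fun setT (EFin \o f) by exact/measurable_EFinP.
exact: (ge0_integralZl_EFin mu measurableT f1 mf1 c0).
Qed.

End ge0_real_integrals.

Section determinant_bound.
Context {R : realType} (N : nat).
Implicit Types T : 'M[R]_N.

(** The factor whose expected product over the spectrum enters [coarse_bounds], where [s] is a power
    of [N]. *)
Definition large_factor (s x : R) : R := 1 + `|x| * (expR s < `|x|)%R%:R.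

Lemma large_factor_ge1 s x : 1 <= large_factor s x.
Proof. by rewrite /large_factor lerDl mulr_ge0. Qed.

(** One factor for each range of [|x|]: the clamped value up to [K], the factor [expR s] between [K]
    and [expR s], and [large_factor] beyond. In each range the other two factors are at least 1 or
    are kept. *)
Lemma abs_le_factors (eta K s x : R) : 0 < eta -> eta <= 1 -> 1 <= K -> 0 <= s ->
  `|x| <= expR (clampln eta K x) * expR (outside K x * s) * large_factor s x.
Proof.
move=> e0 e1 K1 s0; have K0 : 0 < K by exact: lt_le_trans K1.
have m0 : 0 < Num.min (Num.max `|x| eta) K by rewrite lt_min K0 lt_max e0 orbT.
rewrite /clampln lnK ?posrE//; have f1 := large_factor_ge1 s x.
have f2 : 1 <= expR (outside K x * s).
  rewrite -expR0 ler_expR outsideE mulr_ge0//; by rewrite addr_ge0.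
have [xK|Kx] := leP `|x| K.
  have h : `|x| <= Num.min (Num.max `|x| eta) K by rewrite le_min xK le_max lexx.
  by rewrite -[leLHS]mulr1 -mulrA ler_pM// mulr_ege1.
have hK : Num.min (Num.max `|x| eta) K = K.
  by apply/min_idPr; rewrite le_max (ltW Kx).
have hout : outside K x = 1.
  rewrite outsideE; have [x0|x0] := leP 0 x; [rewrite ger0_norm// in Kx|rewrite ltr0_norm// in Kx].
    by rewrite Kx leNgt (_ : - K < x) ?addr0//; lra.
  have h1 : x <= - K by lra.
  have h2 : x <= K by lra.
  by rewrite h1 ltNge h2 add0r.
rewrite hK hout mul1r; rewrite hout mul1r in f2.
rewrite /large_factor in f1 *; case: ltP f1 => h /= f1.
  rewrite mulr1 -[leLHS]mul1r; apply: ler_pM => //.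
    by rewrite -[1]mulr1 ler_pM.
  by rewrite lerDr.
rewrite mulr0 addr0 mulr1; apply: le_trans h _.
by rewrite ler_peMl// expR_ge0.
Qed.

Lemma abs_det_le T (eta K s : R) : sym_mx T ->
  0 < eta -> eta <= 1 -> 1 <= K -> 0 <= s ->
  `|\det T| <= expR (tr_fun (clampln eta K) T) * expR (count_outside K T * s) *
    \prod_(x <- eigvals T) large_factor s x.
Proof.
move=> Ts e0 e1 K1 s0; rewrite det_ev// normr_prod.
rewrite (@big_eigvals _ _ 1 *%R T (large_factor s) Ts).
rewrite tr_funE// /count_outside tr_funE// mulr_suml !expR_sum -!big_split/=.
by apply: ler_prod => i _; rewrite normr_ge0 abs_le_factors.
Qed.

Lemma young_trunc (x s delta : R) : 0 <= x -> 0 < delta ->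
  x <= expR s \/ x <= expR (- delta * s) * x `^ (1 + delta).
Proof.
move=> x0 d0; have [h|h] := leP x (expR s); [by left|right].
have xgt : 0 < x by exact: lt_trans (expR_gt0 _) h.
rewrite powRD; last by apply/implyP => _; rewrite gt_eqF.
rewrite powRr1// mulrCA -{1}[x]mulr1 ler_wpM2l//.
rewrite mulNr expRN ler_pdivlMl ?expR_gt0// mulr1.
rewrite /powR gt_eqF// ler_expR ler_wpM2l ?(ltW d0)//.
by rewrite -ler_expR lnK ?posrE// ltW.
Qed.

Context d (Om : measurableType d) (P : probability Om R).
Variable (H : Om -> 'M[R]_N).
Hypothesis mH : measurable_fun setT H.
Hypothesis symH : forall w, sym_mx (H w).

Lemma measurable_det : measurable_fun setT (fun w => \det (H w)).
Proof.
under eq_fun do rewrite det_ev//.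
by apply: measurable_prod => i _; exact: measurable_ev.
Qed.

Lemma measurable_large_factor s : measurable_fun setT (fun w => \prod_(x <- eigvals (H w)) large_factor s x).
Proof.
have E w := @big_eigvals _ _ 1 *%R (H w) (large_factor s) (symH w).
under eq_fun do rewrite E.
apply: measurable_prod => i _.
have mx := measurable_ev mH symH i.
rewrite /large_factor.
have mabs : measurable_fun setT (fun w => `|ev (H w) i|).
  exact: (measurableT_comp (@normr_measurable R setT) mx).
apply: measurable_funD => //; apply: measurable_funM => //.
rewrite (_ : (fun _ => _) = (fun w => \1_(`]expR s, +oo[%classic : set R) `|ev (H w) i|)).
  by apply: measurableT_comp mabs; exact: measurable_indic.
by apply/funext => w; rewrite indic_itvE in_itv/= andbT.
Qed.

(* On the good event at most [n1] eigenvalues exceed [K] and each of them costs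
   a factor [expR s], up to the product of the factors beyond [expR s]; on the
   bad event [young_trunc] trades the determinant for its moment. *)
Lemma expected_det_le (nu : probability (measurableTypeR R) R)
    (eta K s e1 n1 delta A1 B1 M1 : R) (w1 : R) :
  (0 < N)%N -> 0 < eta -> eta <= 1 -> 1 <= K -> 0 <= s -> 0 < delta ->
  (\int[P]_w (\prod_(x <- eigvals (H w)) large_factor s x)%:E <= (expR w1)%:E)%E ->
  pr P ([set w | (e1%:E < dBL (esd (H w)) nu)%E] `|`
    [set w | n1 < count_outside K (H w)]) <= expR (- B1) ->
  (\int[P]_w (`|\det (H w)| `^ (1 + delta))%:E <= (expR M1)%:E)%E ->
  (\int[P]_w (`|\det (H w)|)%:E <=
    (expR (N%:R * (\int[nu]_x clampln eta K x + (ln K - ln eta + eta^-1) * e1) + n1 * s + w1)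
    + expR (A1 - B1) + expR (M1 - delta * A1))%:E)%E.
Proof.
move=> N0 eta0 eta1 K1 s0 d0 hW hB hM.
set I := \int[nu]_x _; set C := ln K - ln eta + eta^-1.
set Bad := (X in pr P X) in hB.
have mcount : measurable_fun setT (fun w => count_outside K (H w)).
  by apply: measurable_tr_fun => //; exact: measurable_outside.
have mBad : measurable Bad.
  apply: measurableU; first exact: measurable_dBL_gt.
  rewrite (_ : [set w | _] = (fun w => count_outside K (H w)) @^-1` `]n1, +oo[%classic).
    by rewrite -[X in measurable X]setTI; exact: mcount.
  by apply/seteqP; split => w /=; rewrite in_itv/= andbT.
pose E1 := expR (N%:R * (I + C * e1) + n1 * s).
have C0 : 0 < C.
  have := ln_le0 eta1; have := ln_ge0 K1; have : 0 < eta^-1 by rewrite invr_gt0.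
  by rewrite /C; lra.
have pointwise w : `|\det (H w)| <= E1 * \prod_(x <- eigvals (H w)) large_factor s x +
   (expR A1 * \1_Bad w + expR (- delta * A1) * `|\det (H w)| `^ (1 + delta)).
  have Wge0 : 0 <= \prod_(x <- eigvals (H w)) large_factor s x.
    by apply: prodr_ge0 => x _; apply: le_trans (large_factor_ge1 s x).
  have t1 : 0 <= E1 * \prod_(x <- eigvals (H w)) large_factor s x.
    by rewrite mulr_ge0// expR_ge0.
  have t2 : 0 <= expR (- delta * A1) * `|\det (H w)| `^ (1 + delta).
    by rewrite mulr_ge0 ?expR_ge0 ?powR_ge0.
  have [bad|good] := pselect (Bad w).
    rewrite indicE mem_set// mulr1.
    have [h|h] := @young_trunc _ A1 _ (normr_ge0 (\det (H w))) d0.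
      by apply: le_trans h _; lra.
    by apply: le_trans h _; have := expR_ge0 A1; lra.
  apply: le_trans (abs_det_le (symH w) eta0 eta1 K1 s0) _.
  have g1 : ~ (e1%:E < dBL (esd (H w)) nu)%E by move=> h; apply: good; left.
  have g2 : count_outside K (H w) <= n1.
    by rewrite leNgt; apply/negP => h; apply: good; right.
  have := dBL_esd (clampln_lip eta0 eta1 K1) (clampln_bdd eta0 eta1 K1)
    (ltW (_ : 0 < eta^-1)) C0 (symH w) g1.
  rewrite invr_gt0 => /(_ eta0)/ler_normlP[_]; rewrite -/I -/C => h.
  apply: (@le_trans _ _ (E1 * \prod_(x <- eigvals (H w)) large_factor s x)); last first.
    by rewrite lerDl addr_ge0// mulr_ge0// expR_ge0.
  rewrite ler_wpM2r// -expRD ler_expR lerD//; last by rewrite ler_wpM2r.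
  by rewrite -ler_pdivrMl ?ltr0n//; lra.
have mW := measurable_large_factor s.
have mD : measurable_fun setT (fun w => `|\det (H w)| `^ (1 + delta)).
  apply: (@measurableT_comp _ _ _ _ _ _ (fun x : R => x `^ (1 + delta))) => //.
  exact: (measurableT_comp (@normr_measurable R setT) measurable_det).
have mB : measurable_fun setT (\1_Bad : Om -> R) by exact: measurable_indic.
have Wge0 w : 0 <= \prod_(x <- eigvals (H w)) large_factor s x.
  by apply: prodr_ge0 => x _; apply: le_trans (large_factor_ge1 s x).
have D0 w : 0 <= `|\det (H w)| `^ (1 + delta) by exact: powR_ge0.
have I0 w : 0 <= \1_Bad w :> R by rewrite indicE.
have E10 : 0 <= E1 := expR_ge0 _.
have mul0 (c : R) (f : Om -> R) : 0 <= c -> (forall w, 0 <= f w) ->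
  forall w, 0 <= c * f w by move=> c0 f0 w; rewrite mulr_ge0.
have add0 (f g : Om -> R) : (forall w, 0 <= f w) -> (forall w, 0 <= g w) ->
  forall w, 0 <= f w + g w by move=> f0 g0 w; rewrite addr_ge0.
have mZ (c : R) (f : Om -> R) : measurable_fun setT f -> measurable_fun setT (fun w => c * f w).
  by move=> mf; exact: measurable_funM.
pose maj w := E1 * \prod_(x <- eigvals (H w)) large_factor s x +
   (expR A1 * \1_Bad w + expR (- delta * A1) * `|\det (H w)| `^ (1 + delta)).
apply: (@le_trans _ _ (\int[P]_w (maj w)%:E)%E).
  apply: le_integral_raw => w _; first by rewrite lee_fin.
  by rewrite lee_fin; exact: pointwise.
rewrite ge0_integral_EFinD; last 4 first.
- exact: mZ.
- by apply: measurable_funD; exact: mZ.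
- exact: mul0.
- by apply: add0; apply: mul0 => //; exact: expR_ge0.
rewrite ge0_integral_EFinD; last 4 first.
- exact: mZ.
- exact: mZ.
- by apply: mul0 => //; exact: expR_ge0.
- by apply: mul0 => //; exact: expR_ge0.
rewrite !ge0_integral_EFinZ ?expR_ge0// -addrA EFinD; apply: leeD.
  by rewrite expRD EFinM; apply: lee_wpmul2l => //; rewrite lee_fin expR_ge0.
rewrite EFinD; apply: leeD.
  have -> : (\int[P]_x (\1_Bad x)%:E = (pr P Bad)%:E)%E.
    by rewrite integral_indic// setIT; exact: prE.
  by rewrite -EFinM lee_fin expRD ler_wpM2l ?expR_ge0.
rewrite [M1 - _]addrC -mulNr expRD EFinM; apply: lee_wpmul2l => //.
Qed.

End determinant_bound.

(** * Locally uniform control of spectra and determinants *)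

Section bump.
Context {R : realType}.

(* A Lipschitz test function dominating the indicator of [K + 1 <= `|x|]. *)
Definition bump (K x : R) : R := hinge K x - hinge (K + 1) x.

Lemma bump_lip K x y : `|bump K x - bump K y| <= 2 * `|x - y|.
Proof.
have /ler_normlP[h1 h2] := hinge_lip K x y.
have /ler_normlP[h3 h4] := hinge_lip (K + 1) x y.
by rewrite /bump; apply/ler_normlP; split; lra.
Qed.

Lemma bump01 K x : 0 <= bump K x <= 1.
Proof.
rewrite /bump /hinge.
by case: (leP (`|x| - K) 0) => ?; case: (leP (`|x| - (K + 1)) 0) => ?; lra.
Qed.

Lemma bump_ge0 K x : 0 <= bump K x. Proof. by have /andP[] := bump01 K x. Qed.

Lemma bump_bdd K x : `|bump K x| <= 1.
Proof. by have /andP[h1 h2] := bump01 K x; rewrite ger0_norm. Qed.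

Lemma bump_in K x : `|x| <= K -> bump K x = 0.
Proof.
by move=> xK; rewrite /bump /hinge; case: (leP (`|x| - K) 0) => ?;
  case: (leP (`|x| - (K + 1)) 0) => ?; lra.
Qed.

Lemma bump_out K x : K + 1 <= `|x| -> bump K x = 1.
Proof.
by move=> xK; rewrite /bump /hinge; case: (leP (`|x| - K) 0) => ?;
  case: (leP (`|x| - (K + 1)) 0) => ?; lra.
Qed.

Lemma measurable_bump K : measurable_fun setT (bump K).
Proof. exact: lip_measurable (bump_lip K). Qed.

Implicit Types nu : probability (measurableTypeR R) R.

Lemma measurable_abs_gt (K : R) : measurable ([set x : R | K < `|x|] : set (measurableTypeR R)).
Proof.
rewrite (_ : [set x | _] = (@Num.norm R R) @^-1` `]K, +oo[%classic).
  rewrite -[X in measurable X]setTI.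
  exact: (@normr_measurable R setT).
by apply/seteqP; split => x /=; rewrite in_itv/= andbT.
Qed.

Lemma integral_eq0_outside nu (K : R) (f : R -> R) : measurable_fun setT f ->
  (forall x, `|x| <= K -> f x = 0) -> nu [set x | K < `|x|] = 0%E ->
  \int[nu]_x f x = 0.
Proof.
move=> mf fK nuK; rewrite /Rintegral.
have -> : (\int[nu]_x (f x)%:E = \int[nu]_x cst 0%E x)%E.
  apply: ae_eq_integral => //; first exact/measurable_EFinP.
  exists [set x | K < `|x|]; split => //; first exact: measurable_abs_gt.
  move=> x /= h; rewrite ltNge; apply/negP => xK; apply: h => _.
  by rewrite fK.
by rewrite integral0.
Qed.

Lemma support_of_bump nu (K : R) : \int[nu]_x bump K x <= 0 ->
  nu [set x | K + 1 < `|x|] = 0%E.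
Proof.
move=> h; apply/eqP; rewrite eq_le measure_ge0 andbT.
rewrite -[leLHS]mul1e.
have := @integral_ge0_lb _ _ _ nu setT [set x | K + 1 < `|x|]
  (fun x => (bump K x)%:E) 1 (measurable_abs_gt _) (@subsetT _ _) ler01.
have h0 : forall x : measurableTypeR R, setT x -> (0 <= (bump K x)%:E)%E.
  by move=> x _; rewrite lee_fin bump_ge0.
move=> H0; apply: le_trans (H0 h0 _) _; first by move=> x /= /ltW/bump_out ->.
rewrite (bounded_RintegralE nu (measurable_bump K) (bump_bdd K)).
by rewrite lee_fin.
Qed.

End bump.

Section family.
Context {R : realType} {m : nat} {d : nat -> measure_display}
  {Om : forall N, measurableType (d N)} (P : forall N, probability (Om N) R)
  (H : forall N, 'rV[R]_m -> {RV (P N) >-> 'M[R]_N})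
  (mu : nat -> 'rV[R]_m -> probability (measurableTypeR R) R)
  (muoo : 'rV[R]_m -> probability (measurableTypeR R) R).
Hypothesis H_sym : forall N u w, sym_mx (H N u w).
Variable Q : set 'rV[R]_m.

(** Test functions are taken nonnegative because the integral against [mean_esd] is evaluated only
    for those; a bounded function can be shifted by a constant. *)
Definition spectral_control (K : R) : Prop :=
  (forall u, Q u -> muoo u [set x | K < `|x|] = 0%E) /\
  (forall (f : R -> R) (b c : R), (forall x y, `|f x - f y| <= c * `|x - y|) ->
     (forall x, `|f x| <= b) -> 0 <= c -> 0 < b + c -> (forall x, 0 <= f x) ->
     forall e : R, 0 < e -> \forall N \near \oo, forall u, Q u ->
       `|\int[P N]_w (N%:R^-1 * tr_fun f (H N u w)) - \int[muoo u]_x f x| <= e).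

Definition determinant_control (K : R) : Prop :=
  (forall eta e : R, 0 < eta -> eta <= 1 -> 0 < e -> \forall N \near \oo, forall u, Q u ->
     (\int[P N]_w (`|\det (H N u w)|)%:E <=
       (expR (N%:R * (\int[muoo u]_x clampln eta K x + e)))%:E)%E) /\
  (exists delta C : R, 0 < delta /\ \forall N \near \oo, forall u, Q u ->
     (\int[P N]_w (`|\det (H N u w)| `^ (1 + delta))%:E <=
       (expR (C * (N%:R * ln N%:R)))%:E)%E).

Variables (k1 k2 : R).
Hypothesis k10 : 0 < k1.
Hypothesis k20 : 0 < k2.
Hypothesis mean_mu : forall u N, Q u -> (0 < N)%N ->
  (dBL (mean_esd (P N) (H N u)) (mu N u) <= (N%:R `^ (- k1))%:E)%E.
Hypothesis mu_muoo : forall u N, Q u -> (0 < N)%N ->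
  (dBL (mu N u) (muoo u) <= (N%:R `^ (- k2))%:E)%E.

Lemma near_powRN_le (k e C : R) : 0 < k -> 0 < e ->
  \forall N \near \oo, C * N%:R `^ (- k) <= e.
Proof.
move=> k0 e0; have kk : - k < 0 by rewrite oppr_lt0.
have := @near_small_powR R (- k) 0 C e kk e0.
by apply: filterS => N; rewrite powRr0 mulr1.
Qed.

Lemma compact_support_bound :
  (exists K : set R, compact K /\ forall u N, Q u -> (0 < N)%N -> mu N u (~` K) = 0%E) ->
  exists2 K : R, 1 <= K & forall u N, Q u -> (0 < N)%N -> mu N u [set x | K < `|x|] = 0%E.
Proof.
move=> [K [cK muK]]; have [M [_ hM]] := compact_bounded cK.
have hM1 := hM (Num.max M 0 + 1).
have MK : forall x, K x -> `|x| <= Num.max M 0 + 1.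
  by apply: hM1; apply: (@le_lt_trans _ _ (Num.max M 0)); rewrite ?le_max ?lexx// ltrDl.
exists (Num.max M 0 + 1) => [|u N Qu N0]; first by rewrite lerDr le_max lexx orbT.
apply/eqP; rewrite eq_le measure_ge0 andbT -(muK u N Qu N0) le_measure ?inE//.
- exact: measurable_abs_gt.
- apply: measurableC; apply: closed_measurable; exact: compact_closed.
- by move=> x /= xM /MK; rewrite leNgt xM.
Qed.

Variable K1 : R.
Hypothesis K11 : 1 <= K1.
Hypothesis muK1 : forall u N, Q u -> (0 < N)%N -> mu N u [set x | K1 < `|x|] = 0%E.

(** The bump vanishes on [[-K1, K1]], which carries [mu N u], so its mean is a pure [dBL] error. The
    3 is its sup bound 1 plus its Lipschitz constant 2. *)
Lemma mean_bump u N : Q u -> (0 < N)%N ->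
  \int[P N]_w (N%:R^-1 * tr_fun (bump K1) (H N u w)) <= 3 * N%:R `^ (- k1).
Proof.
move=> Qu N0; have b0 : (0 : R) < 1 + 2 by [].
have /ler_normlP[_] := dBL_mean_esd (bump_lip K1) (bump_bdd K1) (ler0n R 2) b0 (bump_ge0 K1)
  (measurable_funPT (H N u)) (@H_sym N u) (mean_mu Qu N0).
rewrite (integral_eq0_outside (measurable_bump K1) (@bump_in _ K1) (muK1 Qu N0)).
rewrite subr0; lra.
Qed.

(** The bump at [K1] integrates to 0 against every [mu N u], hence against the limit; it equals 1
    from [K1 + 1] on. *)
Lemma limit_support u : Q u -> muoo u [set x | K1 + 1 < `|x|] = 0%E.
Proof.
move=> Qu; apply: support_of_bump; apply/ler_addgt0Pr => e e0; rewrite add0r.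
have [N0 _ hN] := near_powRN_le 3 k20 e0.
have h := hN (maxn N0 1) (leq_maxl _ _).
have N1 : (0 < maxn N0 1)%N by rewrite leq_max orbT.
have b0 : (0 : R) < 1 + 2 by [].
have /ler_normlP[h1 _] := dBL_prob (bump_lip K1) (bump_bdd K1) (ler0n R 2) b0 (mu_muoo Qu N1).
move: h1; rewrite (integral_eq0_outside (measurable_bump K1) (@bump_in _ K1) (muK1 Qu N1)).
lra.
Qed.

Lemma spectral_control_limit (K : R) : K1 + 1 <= K -> spectral_control K.
Proof.
move=> KK; split=> [u Qu|f b c f_lip f_bdd c0 bc0 f0 e e0].
  apply/eqP; rewrite eq_le measure_ge0 andbT -(limit_support Qu) le_measure ?inE//.
  - exact: measurable_abs_gt.
  - exact: measurable_abs_gt.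
  - by move=> x /=; exact: le_lt_trans.
have e20 : 0 < e / 2 by rewrite divr_gt0.
have h1 := near_powRN_le (b + c) k10 e20; have h2 := near_powRN_le (b + c) k20 e20.
have h3 := nbhs_infty_gt 0%N.
near=> N => u Qu; have N0 : (0 < N)%N by near: N.
have /ler_normlP[g1 g2] := dBL_mean_esd f_lip f_bdd c0 bc0 f0
  (measurable_funPT (H N u)) (@H_sym N u) (mean_mu Qu N0).
have /ler_normlP[g3 g4] := dBL_prob f_lip f_bdd c0 bc0 (mu_muoo Qu N0).
have g5 : (b + c) * N%:R `^ (- k1) <= e / 2 by near: N.
have g6 : (b + c) * N%:R `^ (- k2) <= e / 2 by near: N.
apply/ler_normlP; split; lra.
Unshelve. all: by end_near. Qed.

End family.

(** * Convexity-preserving functionals *)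

Section probability_events.
Context {R : realType} d (Om : measurableType d) (P : probability Om R).

Lemma pr_le_EFin A (y : R) : measurable A -> (P A <= y%:E)%E -> pr P A <= y.
Proof. by move=> mA h; rewrite -lee_fin; have <- := prE P mA. Qed.

Lemma measurable_ltr_set (f : Om -> R) (c : R) : measurable_fun setT f ->
  measurable [set w | c < f w].
Proof.
move=> mf; rewrite (_ : [set w | _] = f @^-1` `]c, +oo[%classic).
  by rewrite -[X in measurable X]setTI; exact: mf.
by apply/seteqP; split => w /=; rewrite in_itv/= andbT.
Qed.

Lemma markov_pr (f : Om -> R) (a b c : R) : measurable_fun setT f ->
  (forall w, `|f w| <= b) -> (forall w, 0 <= f w) -> 0 < a -> \int[P]_w f w <= c ->
  pr P [set w | a < f w] <= c / a.
Proof.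
move=> mf fb f0 a0 fc; have mA := measurable_ltr_set a mf.
rewrite ler_pdivlMr// mulrC -lee_fin EFinM.
have hP := prE P mA; rewrite -hP.
apply: (@le_trans _ _ (\int[P]_w (f w)%:E)%E); last first.
  by rewrite (bounded_RintegralE P mf fb) lee_fin.
by apply: integral_ge0_lb => //; [exact: ltW|move=> x _; rewrite lee_fin|
  move=> x /= /ltW; rewrite lee_fin].
Qed.

End probability_events.

Section convexity_core.
Context {R : realType} {m : nat} {d : nat -> measure_display}
  {Om : forall N, measurableType (d N)} (P : forall N, probability (Om N) R)
  (H : forall N, 'rV[R]_m -> {RV (P N) >-> 'M[R]_N})
  (mu : nat -> 'rV[R]_m -> probability (measurableTypeR R) R)
  (muoo : 'rV[R]_m -> probability (measurableTypeR R) R).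
Hypothesis H_sym : forall N u w, sym_mx (H N u w).
Context (Q : set 'rV[R]_m) (M : nat -> nat)
  (X : forall N, 'rV[R]_m -> {RV (P N) >-> 'rV[R]_(M N)})
  (Phi : forall N, 'rV[R]_m -> 'rV[R]_(M N) -> 'M[R]_N).
Arguments X : clear implicits.
Arguments Phi : clear implicits.
Hypothesis hPhi : forall N u, (0 < N)%N ->
  [/\ (forall w, H N u w = Phi N u (X N u w)),
      independent_entries (P N) (X N u),
      (forall x, sym_mx (Phi N u x)),
      (lip_sym (Phi N u) < +oo)%E &
      (forall A : set 'M[R]_N, A `<=` @sym_mx R N -> convex_set A ->
         convex_set (Phi N u @^-1` A))].
Variables (kappa delta : R).
Hypothesis kappa0 : 0 < kappa.
Hypothesis delta0 : 0 < delta.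
Hypothesis hcut : cut_close X Phi Q kappa.
Hypothesis hcoarse : coarse_bounds H Q delta.
Hypothesis mean_mu : forall u N, Q u -> (0 < N)%N ->
  (dBL (mean_esd (P N) (H N u)) (mu N u) <= (N%:R `^ (- kappa))%:E)%E.
Hypothesis hconc : superexp_concentration H muoo.
Variable r : R.
Hypothesis r0 : 0 < r.
Hypothesis Qr : Q `<=` eball (m := m) r.
Variable K1 : R.
Hypothesis K11 : 1 <= K1.
Hypothesis muK1 : forall u N, Q u -> (0 < N)%N -> mu N u [set x | K1 < `|x|] = 0%E.

Variable b : R.
Hypothesis b0 : 0 < b.
Hypothesis bk : 2 * b <= kappa.
Hypothesis b1 : 2 * b <= 1.

Let K10 : 0 <= K1. Proof. exact: le_trans K11. Qed.

(** Markov's inequality for the bump, whose mean is at most [3 N^(-kappa)]: the threshold 12 is four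
    times 3. This is the crude bound that [count_concentration] improves. *)
Lemma markov_count u N : Q u -> (0 < N)%N ->
  pr (P N) [set w | 12 * (N%:R * N%:R `^ (- kappa)) < count_outside (K1 + 1) (H N u w)]
    <= 4^-1.
Proof.
move=> Qu N0; have NR : (0 : R) < N%:R by rewrite ltr0n.
have p0 : 0 < N%:R `^ (- kappa) :> R by exact: powR_gt0.
have mH := measurable_funPT (H N u); have sH := @H_sym N u.
pose f w := N%:R^-1 * tr_fun (bump K1) (H N u w).
have mf : measurable_fun setT f.
  apply: measurable_funM => //.
  exact: (measurable_tr_fun mH sH (measurable_bump K1)).
have f01 w : 0 <= f w <= 1.
  exact: (tr_fun_bounded (bump_bdd K1) (bump_ge0 K1) (sH w)).
have f0 w : 0 <= f w by have /andP[] := f01 w.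
have fb w : `|f w| <= 1 by rewrite ger0_norm//; have /andP[] := f01 w.
have a0 : 0 < 12 * N%:R `^ (- kappa) :> R by rewrite mulr_gt0.
have h := markov_pr mf fb f0 a0 (mean_bump H_sym mean_mu muK1 Qu N0).
have -> : (4^-1 : R) = 3 * N%:R `^ (- kappa) / (12 * N%:R `^ (- kappa)).
  by field; rewrite gt_eqF.
apply: le_trans h; apply: pr_le.
- apply: measurable_ltr_set; exact: (measurable_tr_fun mH sH (measurable_outside _)).
- exact: measurable_ltr_set.
- move=> w /= h; rewrite /f ltr_pdivlMl//.
  have h1 : count_outside (K1 + 1) (H N u w) <= tr_fun (bump K1) (H N u w).
    by apply: tr_fun_le => // x; exact: hinge_diff_ge.
  by apply: lt_le_trans h1; move: h; rewrite mulrCA.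
Qed.

Lemma lip_sym_fine u N : (0 < N)%N ->
  (lip_sym (Phi N u) <= (fine (lip_sym (Phi N u)))%:E)%E /\ 0 <= fine (lip_sym (Phi N u)).
Proof.
move=> N0; have [_ _ _ L1 _] := hPhi u N0.
have L0 : (0 <= lip_sym (Phi N u))%E.
  apply: le_trans (_ : _ <= (symF_norm (Phi N u 0 - Phi N u 0) / enorm (0 - 0 : 'rV[R]_(M N)))%:E)%E _.
    by rewrite lee_fin divr_ge0// sqrtr_ge0.
  by apply: ereal_sup_ubound; exists (0, 0).
by rewrite fineK ?fine_ge0// ge0_fin_numE.
Qed.

Lemma near_cut_bound (A : R) : \forall N \near \oo, forall u, Q u ->
  pr (P N) [set w | ((N%:R `^ (- kappa))%:E <
     dKS (esd (Phi N u (X N u w)))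
         (esd (Phi N u (\row_i (if (`|X N u w ord0 i| < N%:R `^ (- kappa) / fine (lip_sym (Phi N u)))%R
           then X N u w ord0 i else 0)%R))))%E] <= expR (- A * (N%:R * ln N%:R)).
Proof.
have [N0 hN0] := superexp_le hcut A.
exists (maxn 1 N0) => // N /=; rewrite geq_max => /andP[N1 NN0] u Qu.
have [_ indX sPhi _ cPhi] := hPhi u N1.
have [L1 L0] := lip_sym_fine u N1.
have a0 : 0 < N%:R `^ (- kappa) :> R by apply: powR_gt0; rewrite ltr0n.
apply: pr_le_EFin.
  have mX := measurable_funPT (X N u).
  have mXc := @measurable_Xc _ _ _ (P N) _ (X N u) (fine (lip_sym (Phi N u))) (N%:R `^ (- kappa)).
  have m1 := measurable_Phi sPhi L1 L0 mX.
  have m2 := measurable_Phi sPhi L1 L0 mXc.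
  exact: (measurable_dKS_gt m1 (fun w => sPhi _) m2 (fun w => sPhi _)).
apply: le_trans (hN0 N NN0); apply: ereal_sup_ubound; exists u => //.
Qed.

(** With [a = N^(-kappa)] and [t = N^(1-b)] the exponent [t^2 / (512 N a^2)] is
    [N^(1+2(kappa-b)) / 512], which dominates [N ln N] since [b < kappa]. As [N a <= t] and
    [1 <= t], the threshold [12 N a + 4 N a + 4 + 4 t] is at most [24 t]. *)
Lemma near_count (A : R) : \forall N \near \oo, forall u, Q u ->
  pr (P N) [set w | 24 * N%:R `^ (1 - b) < count_outside (K1 + 2) (H N u w)]
    <= expR (- A * (N%:R * ln N%:R)).
Proof.
(* The extra unit absorbs the constant [9 = 1 + 8]: once [N ln N >= 12] it gains a factor 13, and
   [9 / 13 < 3 / 4] also meets the condition of [count_concentration]. *)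
pose A' := Num.max A 0 + 1.
have kb : 0 < 2 * (kappa - b) by rewrite mulr_gt0// subr_gt0 (lt_le_trans _ bk)// ltr_pMl// ltr1n.
have h1 := near_cut_bound A'; have h2 := near_powR_NlnN (512 * A') kb.
have h3 := @near_NlnN_ge R 1; have h4 := nbhs_infty_ger (12 : R).
have h5 := nbhs_infty_gt 0%N.
near=> N; have N0 : (0 < N)%N by near: N.
have g1 : forall u, Q u -> pr (P N) [set w | ((N%:R `^ (- kappa))%:E <
     dKS (esd (Phi N u (X N u w)))
         (esd (Phi N u (\row_i (if (`|X N u w ord0 i| < N%:R `^ (- kappa) / fine (lip_sym (Phi N u)))%R
           then X N u w ord0 i else 0)%R))))%E] <= expR (- A' * (N%:R * ln N%:R)) by near: N.
have g2 : 512 * A' * (N%:R * ln N%:R) <= N%:R `^ (1 + 2 * (kappa - b)) by near: N.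
have g3 : 1 * N%:R <= N%:R * ln N%:R :> R by near: N.
have g4 : 12 <= N%:R :> R by near: N.
move=> u Qu.
have NR : (0 : R) < N%:R by rewrite ltr0n.
have NR1 : (1 : R) <= N%:R by rewrite ler1n.
have [EH indX sPhi _ cPhi] := hPhi u N0.
have [L1 L0] := lip_sym_fine u N0.
set a : R := N%:R `^ (- kappa); have a0 : 0 < a by exact: powR_gt0.
set t : R := N%:R `^ (1 - b); have t0 : 0 < t by exact: powR_gt0.
set y := N%:R * ln N%:R : R.
have y12 : 12 <= y by rewrite /y; lra.
have nz : (N%:R == 0 :> R) = false by rewrite gt_eqF.
have E1 : t ^+ 2 / (512 * N%:R * a ^+ 2) = 512^-1 * N%:R `^ (1 + 2 * (kappa - b)).
  have -> : N%:R `^ (1 + 2 * (kappa - b)) = t ^+ 2 * (N%:R^-1 * (a^-1) ^+ 2).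
    rewrite -powRN opprK !expr2 -[N%:R^-1]powR_inv1 ?ler0n// /t.
    rewrite -!powRD ?nz ?implybT//; congr powR; ring.
  by field; rewrite !gt_eqF.
have tb : 8 * expR (- (t ^+ 2 / (512 * N%:R * a ^+ 2))) <= 8 * expR (- A' * y).
  suff h : A' * y <= 512^-1 * N%:R `^ (1 + 2 * (kappa - b)).
    by rewrite E1 mulNr; apply: ler_wpM2l => //; rewrite ler_expR lerN2.
  by move: g2; rewrite -/y; move: (_ `^ _) (A') y12 => z A1 _; lra.
have expA : 9 * expR (- A' * y) <= 9 / 13 * expR (- (Num.max A 0) * y).
  have -> : - A' * y = - y + - Num.max A 0 * y by rewrite /A'; ring.
  rewrite expRD mulrA; apply: ler_wpM2r; first exact: expR_ge0.
  rewrite expRN; apply: ler_wpM2l; first by [].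
  rewrite lef_pV2 ?posrE ?expR_gt0//.
  by apply: le_trans (expR_ge1Dx y); lra.
have mA1 : expR (- (Num.max A 0) * y) <= expR (- A * y).
  by rewrite ler_expR !mulNr lerN2 ler_wpM2r ?le_max ?lexx//; lra.
have mA2 : expR (- (Num.max A 0) * y) <= 1.
  by rewrite -expR0 ler_expR mulNr oppr_le0 mulr_ge0 ?le_max ?lexx ?orbT//; lra.
have hq : pr (P N) [set w | (a%:E <
     dKS (esd (Phi N u (X N u w)))
         (esd (Phi N u (\row_i (if (`|X N u w ord0 i| < a / fine (lip_sym (Phi N u)))%R
           then X N u w ord0 i else 0)%R))))%E] <= expR (- A' * y) by exact: g1.
have h34 : expR (- A' * y) + 8 * expR (- (t ^+ 2 / (512 * N%:R * a ^+ 2))) < 3 / 4 by lra.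
have EPhi c K : [set w | c < count_outside K (Phi N u (X N u w))] =
    [set w | c < count_outside K (H N u w)].
  by apply/seteqP; split => w; rewrite /mkset EH.
have hA0 : pr (P N) [set w | 12 * (N%:R * a) < count_outside (K1 + 1) (Phi N u (X N u w))] <= 4^-1.
  by rewrite EPhi; exact: markov_count.
have K110 : 0 <= K1 + 1 := addr_ge0 K10 ler01.
have := count_concentration N0 indX sPhi L1 cPhi L0 a0 K110 t0 hA0 hq h34.
rewrite EPhi (_ : K1 + 1 + 1 = K1 + 2); last by rewrite -addrA.
move=> hfin; apply: le_trans (le_trans _ hfin) _; last first.
  by apply: le_trans (lerD (lexx _) tb) _; move: expA mA1; have := expR_ge0 (- (Num.max A 0) * y); lra.
have mcount c : measurable [set w | c < count_outside (K1 + 2) (H N u w)].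
  apply: measurable_ltr_set.
  exact: (measurable_tr_fun (measurable_funPT (H N u)) (@H_sym N u) (measurable_outside _)).
have mono c1 c2 : c1 <= c2 ->
    pr (P N) [set w | c2 < count_outside (K1 + 2) (H N u w)] <=
    pr (P N) [set w | c1 < count_outside (K1 + 2) (H N u w)].
  move=> c12; apply: (pr_le (P N) (mcount c2) (mcount c1)) => w /=.
  exact: le_lt_trans.
have Na : N%:R * a <= t.
  rewrite /a -[X in X * _]powRr1 ?ler0n// -powRD ?nz ?implybT//.
  by rewrite ler_powR//; lra.
have t1 : 1 <= t.
  have h : 0 <= 1 - b by rewrite subr_ge0 (le_trans _ b1)// ler_peMl ?ler1n// ltW.
  by rewrite -(powRr0 N%:R); exact: ler_powR.
apply: mono; by move: (N%:R * a) (t) Na t1 => x z; lra.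
Unshelve. all: by end_near. Qed.

Lemma near_bad_event (e1 A : R) : 0 < e1 -> \forall N \near \oo, forall u, Q u ->
  pr (P N) ([set w | (e1%:E < dBL (esd (H N u w)) (muoo u))%E] `|`
    [set w | 24 * N%:R `^ (1 - b) < count_outside (K1 + 2) (H N u w)]) <=
  expR (- A * (N%:R * ln N%:R)).
Proof.
move=> e10; have h1 := near_count (A + 1).
have [N1 hN1] := superexp_le (hconc r0 e10) (A + 1).
have h2 := nbhs_infty_ge N1; have h3 := @near_NlnN_ge R 1; have h4 := nbhs_infty_gt 0%N.
near=> N.
have g1 : forall u, Q u ->
  pr (P N) [set w | 24 * N%:R `^ (1 - b) < count_outside (K1 + 2) (H N u w)]
    <= expR (- (A + 1) * (N%:R * ln N%:R)) by near: N.
have g2 : (N1 <= N)%N by near: N.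
have g3 : 1 * N%:R <= N%:R * ln N%:R :> R by near: N.
have N0 : (0 < N)%N by near: N.
move=> u Qu; have mH := measurable_funPT (H N u); have sH := @H_sym N u.
have mA := measurable_dBL_gt mH sH (muoo u) e1.
have mB : measurable [set w | 24 * N%:R `^ (1 - b) < count_outside (K1 + 2) (H N u w)].
  apply: measurable_ltr_set; exact: (measurable_tr_fun mH sH (measurable_outside _)).
apply: (le_trans (prU (P N) mA mB)).
have q1 := g1 u Qu.
have q2 : pr (P N) [set w | (e1%:E < dBL (esd (H N u w)) (muoo u))%E] <=
    expR (- (A + 1) * (N%:R * ln N%:R)).
  apply: pr_le_EFin => //; apply: le_trans (hN1 N g2); apply: ereal_sup_ubound.
  by exists u => //; exact: Qr.
set y := N%:R * ln N%:R in g3 q1 q2 *.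
have y1 : 1 <= y.
  by apply: le_trans g3; rewrite mul1r ler1n.
apply: (le_trans (lerD q2 q1)).
have -> : - (A + 1) * y = - y + - A * y by ring.
rewrite expRD -mulrDl -[leRHS]mul1r; apply: ler_wpM2r; first exact: expR_ge0.
have : expR (- y) <= 2^-1.
  rewrite expRN lef_pV2 ?posrE ?expR_gt0//.
  by apply: le_trans (expR_ge1Dx y); by move: y1; move: (y) => z; lra.
by move: (expR _) => z; lra.
Unshelve. all: by end_near. Qed.

Lemma determinant_moment : exists C : R, \forall N \near \oo, forall u, Q u ->
  (\int[P N]_w (`|\det (H N u w)| `^ (1 + delta))%:E <=
    (expR (C * (N%:R * ln N%:R)))%:E)%E.
Proof.
have [_ _ /limn_esup_bounded[C [N1 hC]]] := hcoarse; exists C.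
have h1 := nbhs_infty_ge N1; have h2 := nbhs_infty_gt 1%N.
near=> N; have N2 : (1 < N)%N by near: N.
have g1 : (N1 <= N)%N by near: N.
move=> u Qu; apply: speed_le => //; apply: le_trans (hC N g1).
by apply: ereal_sup_ubound; exists u => //; rewrite unlock.
Unshelve. all: by end_near. Qed.

Lemma near_large_factor (s e : R) : 0 < s -> 0 < e -> \forall N \near \oo, forall u, Q u ->
  (\int[P N]_w (\prod_(x <- eigvals (H N u w)) large_factor (N%:R `^ s) x)%:E <=
    (expR (N%:R * e))%:E)%E.
Proof.
move=> s0 e0; have [/(_ s s0)/cvg0_le/(_ e e0)[N1 hN1] _ _] := hcoarse.
have h1 := nbhs_infty_ge N1; have h2 := nbhs_infty_gt 0%N.
near=> N; have N0 : (0 < N)%N by near: N.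
have g1 : (N1 <= N)%N by near: N.
move=> u Qu; rewrite -lne_le_expR EFinM -lee_pdivrMl ?ltr0n//.
apply: le_trans (hN1 N g1); apply: ereal_sup_ubound; exists u => //.
by rewrite unlock.
Unshelve. all: by end_near. Qed.

(** Each of the three terms is at most [expR (n * (I + e / 2))], and the other half of the slack
    gives [3 <= expR (n * (e / 2))]. The lower bound [l] of [I] lets [expR (- y)] count as one of
    them even when [I] is negative. *)
Lemma exp_absorb (n I e l y c a1 a2 : R) : 2 <= n * (e / 2) -> l <= I -> - l * n <= y ->
  0 <= n -> 0 <= e -> c <= n * (I + e / 2) -> a1 <= - y -> a2 <= - y ->
  expR c + expR a1 + expR a2 <= expR (n * (I + e)).
Proof.
move=> h1 h2 h3 n0 e0 hc ha1 ha2.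
have hy : - y <= n * (I + e / 2).
  have : 0 <= n * (I + e / 2 - l) by rewrite mulr_ge0//; lra.
  by nra.
have -> : n * (I + e) = n * (I + e / 2) + n * (e / 2) by field.
rewrite expRD; set E := expR (n * (I + e / 2)).
have E0 : 0 < E by exact: expR_gt0.
have e1 : expR c <= E by rewrite ler_expR.
have e2 : expR a1 <= E by rewrite ler_expR (le_trans ha1).
have e3 : expR a2 <= E by rewrite ler_expR (le_trans ha2).
have : 3 <= expR (n * (e / 2)).
  by apply: le_trans (expR_ge1Dx _); move: h1; move: (n * _) => z; lra.
move=> h; apply: (@le_trans _ _ (E * 3)); first by move: e1 e2 e3; move: (expR c) (expR a1) (expR a2) => x z t; lra.
by rewrite ler_pM2l.
Qed.

Lemma Rintegral_clampln_ge (nu : probability (measurableTypeR R) R) (eta K : R) :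
  0 < eta -> eta <= 1 -> 1 <= K -> ln eta <= \int[nu]_x clampln eta K x.
Proof.
move=> eta0 eta1 K0; rewrite -[leLHS](Rintegral_prob_cst nu).
apply: (@Rintegral_prob_le _ _ _ nu _ _ (Num.max `|ln eta| (ln K - ln eta))) => //.
- exact: measurable_clampln.
- by move=> x; rewrite le_max lexx.
- by move=> x; rewrite le_max clampln_bdd ?orbT.
- by move=> x; exact: clampln_ge.
Qed.

(** [expected_det_le] with [s = N^(b/2)] and at most [24 N^(1-b)] outliers, whose joint cost
    [24 N^(1-b/2)] is [o(N)]. The [dBL] error, the outliers and the large factors take [e / 8]
    each. *)
Lemma convexity_determinant_control : determinant_control H muoo Q (K1 + 2).
Proof.
split; last first.
  by have [C hC] := determinant_moment; exists delta, C.
move=> eta e eta0 eta1 e0; have [C hC] := determinant_moment.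
have K1' : 1 <= K1 + 2 by apply: le_trans K11 _; rewrite lerDl.
pose c := ln (K1 + 2) - ln eta + eta^-1.
have c0 : 0 < c.
  have h1 := ln_le0 eta1; have h2 := ln_ge0 K1'.
  have h3 : 0 < eta^-1 by rewrite invr_gt0.
  by rewrite /c ltr_wpDl// subr_ge0 (le_trans h1).
pose e1 := e / (8 * c); have e10 : 0 < e1 by rewrite divr_gt0// mulr_gt0.
(* Cutting the determinant at [exp (a1 N ln N)] makes the moment of order [1 + delta] beat its bound
   by one unit of [N ln N]; bad events of exponent [a1 + 1] gain the same unit. *)
pose a1 := (`|C| + 1) / delta.
have h1 := near_bad_event (a1 + 1) e10.
have b20 : 0 < b / 2 by rewrite divr_gt0.
have e80 : 0 < e / 8 by rewrite divr_gt0.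
have h2 := near_large_factor b20 e80.
have bb : 1 - b / 2 < 1 by rewrite ltrBlDr ltrDl.
have h3 := @near_small_powR R (1 - b / 2) 1 24 (e / 8) bb e80.
have h4 := near_NlnN_ge (- ln eta); have h5 := nbhs_infty_gt 0%N.
have h6 := nbhs_infty_ger (2 / (e / 2)).
near=> N.
have g1 : forall u, Q u -> pr (P N) ([set w | (e1%:E < dBL (esd (H N u w)) (muoo u))%E] `|`
    [set w | 24 * N%:R `^ (1 - b) < count_outside (K1 + 2) (H N u w)]) <=
    expR (- (a1 + 1) * (N%:R * ln N%:R)) by near: N.
have g2 : forall u, Q u ->
  (\int[P N]_w (\prod_(x <- eigvals (H N u w)) large_factor (N%:R `^ (b / 2)) x)%:E <=
    (expR (N%:R * (e / 8)))%:E)%E by near: N.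
have g3 : 24 * N%:R `^ (1 - b / 2) <= e / 8 * N%:R `^ 1 by near: N.
have g4 : - ln eta * N%:R <= N%:R * ln N%:R by near: N.
have g5 : forall u, Q u -> (\int[P N]_w (`|\det (H N u w)| `^ (1 + delta))%:E <=
    (expR (C * (N%:R * ln N%:R)))%:E)%E by near: N.
have g6 : 2 / (e / 2) <= N%:R :> R by near: N.
have N0 : (0 < N)%N by near: N.
have NR : (0 : R) < N%:R by rewrite ltr0n.
have NR1 : (1 : R) <= N%:R by rewrite ler1n.
move=> u Qu; have mH := measurable_funPT (H N u); have sH := @H_sym N u.
have y0 : 0 <= N%:R * ln N%:R :> R by rewrite mulr_ge0// ln_ge0.
have := expected_det_le (nu := muoo u) (eta := eta) (K := K1 + 2) (s := N%:R `^ (b / 2)) (e1 := e1)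
  (n1 := 24 * N%:R `^ (1 - b)) (delta := delta)
  (B1 := (a1 + 1) * (N%:R * ln N%:R)) (M1 := C * (N%:R * ln N%:R)) (w1 := N%:R * (e / 8))
  mH sH (a1 * (N%:R * ln N%:R)) N0 eta0 eta1 K1' (powR_ge0 _ _) delta0 (g2 u Qu).
rewrite -mulNr => /(_ (g1 u Qu) (g5 u Qu)) h; apply: le_trans h _; rewrite lee_fin.
apply: (@exp_absorb _ _ _ (ln eta) (N%:R * ln N%:R)) => //.
- by rewrite -ler_pdivrMr// divr_gt0.
- exact: Rintegral_clampln_ge.
- exact: ltW.
- rewrite -/c; have -> : c * e1 = e / 8 by rewrite /e1; field; rewrite gt_eqF.
  have -> : 24 * N%:R `^ (1 - b) * N%:R `^ (b / 2) = 24 * N%:R `^ (1 - b / 2).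
    have -> : 1 - b / 2 = 1 - b + b / 2 by field.
    have nz : (N%:R == 0 :> R) = false by rewrite gt_eqF.
    by rewrite -mulrA -powRD ?nz ?implybT.
  have := g3; rewrite powRr1 ?ler0n//.
  move: (24 * N%:R `^ (1 - b / 2)) => z hz; rewrite !mulrDr.
  move: (N%:R * \int[muoo u]_x clampln eta (K1 + 2) x) => I.
  by have ne : 0 <= N%:R * e := mulr_ge0 (ltW NR) (ltW e0); lra.
- by rewrite -mulrDl opprD addrA subrr add0r mulN1r.
- rewrite [delta * _]mulrA (_ : delta * a1 = `|C| + 1); last by rewrite /a1 mulrC divfK// gt_eqF.
  have hCC : C - (`|C| + 1) <= - 1 by rewrite opprD addrA gerDr subr_le0 ler_norm.
  by have := ler_wpM2r y0 hCC; rewrite mulrBl mulN1r.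
Unshelve. all: by end_near. Qed.

End convexity_core.

Section convexity_case.
Context {R : realType} {m : nat} {d : nat -> measure_display}
  {Om : forall N, measurableType (d N)} (P : forall N, probability (Om N) R)
  (H : forall N, 'rV[R]_m -> {RV (P N) >-> 'M[R]_N})
  (mu : nat -> 'rV[R]_m -> probability (measurableTypeR R) R)
  (muoo : 'rV[R]_m -> probability (measurableTypeR R) R).

Lemma continuous_enorm : continuous (@enorm R m).
Proof.
move=> x; apply: (@continuous_comp _ _ _ (fun u : 'rV[R]_m => \sum_i u ord0 i ^+ 2) Num.sqrt).
  suff h : continuous (fun u : 'rV[R]_m => \sum_i u ord0 i ^+ 2) by exact: h.
  apply: continuous_big => [|i _ u]; first exact: add_continuous.
  by apply: (@cvgM _ _ _ (nbhs_filter u)); exact: coord_continuous.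
exact: sqrt_continuous.
Qed.

Lemma compact_eball (Q : set 'rV[R]_m) : compact Q -> exists2 r : R, 0 < r & Q `<=` eball r.
Proof.
move=> cQ; have : compact (@enorm R m @` Q).
  by apply: continuous_compact cQ; apply: continuous_subspaceT; exact: continuous_enorm.
move=> /compact_bounded[M [_ hM]].
exists (Num.max M 0 + 2) => [|u Qu].
  by rewrite ltr_wpDl// le_max lexx orbT.
have hMM : M < Num.max M 0 + 1.
  by apply: (@le_lt_trans _ _ (Num.max M 0)); rewrite ?le_max ?lexx// ltrDl.
have := hM _ hMM (enorm u) (ex_intro2 _ _ u Qu erefl).
rewrite /eball/= => h; apply: (le_lt_trans (ler_norm _)); apply: (le_lt_trans h).
by rewrite ltrD2l ltr1n.
Qed.

Lemma convexity_control (Q : set 'rV[R]_m) :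
  (forall N u w, sym_mx (H N u w)) -> convexity_preserving H mu ->
  limit_measures mu muoo dBL -> superexp_concentration H muoo ->
  compact Q -> Q !=set0 ->
  exists K : R, [/\ 1 <= K, spectral_control H muoo Q K & determinant_control H muoo Q K].
Proof.
move=> H_sym [M [X [Phi [M0 hPhi hQ]]]] hlim hconc cQ Q0.
have [kappa [delta [kappa0 delta0 [mean_mu supp_mu _] hcoarse hcut]]] := hQ Q cQ Q0.
have [k2 k20 hk2] := hlim Q cQ.
have mu_muoo u N : Q u -> (0 < N)%N -> (dBL (mu N u) (muoo u) <= (N%:R `^ (- k2))%:E)%E.
  by move=> Qu N0; have [h _] := hk2 u Qu; exact: h.
have [r r0 Qr] := compact_eball cQ.
have [K1 K11 muK1] := compact_support_bound supp_mu.
pose b := Num.min kappa 1 / 2.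
have b0 : 0 < b by rewrite divr_gt0// lt_min kappa0 ltr01.
have bk : 2 * b <= kappa by rewrite /b mulrC divfK ?pnatr_eq0// ge_min lexx.
have b1 : 2 * b <= 1 by rewrite /b mulrC divfK ?pnatr_eq0// ge_min lexx orbT.
exists (K1 + 2); split.
- by apply: le_trans K11 _; rewrite lerDl.
- apply: (spectral_control_limit H_sym kappa0 k20 mean_mu mu_muoo muK1).
  by rewrite lerD2l ler1n.
- have := convexity_determinant_control H_sym hPhi delta0 hcut hcoarse mean_mu hconc
    r0 Qr K11 muK1.
  by move=> h; exact: (h _ b0 bk b1).
Qed.

End convexity_case.

(** * Concentrated inputs *)

Section exponential_tail.
Context {R : realType} d (Om : measurableType d) (P : probability Om R).

(** Slicing by slabs: on [(k+1) t < Z <= (k+2) t] the exponential is at most its value at the upper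
    end, so the tail hypothesis makes the contribution of this slab at most [2^-(k+1)]. These sum to
    1, and [Z <= t] contributes [expR (a * t)]. *)
Lemma exp_tail (Z : Om -> R) (a t : R) : measurable_fun setT Z -> 0 < t -> 0 <= a ->
  (forall k : nat, pr P [set w | k.+1%:R * t < Z w] <=
     expR (- (a * (k.+2%:R * t))) / (2 ^ k.+1)%:R) ->
  (\int[P]_w (expR (a * Z w))%:E <= (expR (a * t) + 1)%:E)%E.
Proof.
move=> mZ t0 a0 htail.
pose A k := [set w | k.+1%:R * t < Z w].
have mA k : measurable (A k) by exact: measurable_ltr_set.
pose F k w := (expR (a * (k.+2%:R * t)) * \1_(A k) w)%:E.
have F0 k w : (0 <= F k w)%E by rewrite lee_fin mulr_ge0 ?expR_ge0// indicE.
have mF k : measurable_fun setT (F k).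
  by apply/measurable_EFinP; apply: measurable_funM => //; exact: measurable_indic.
have S0 w : (0 <= \sum_(k <oo) F k w)%E by apply: nneseries_ge0.
have pointwise w : ((expR (a * Z w))%:E <= (expR (a * t))%:E + \sum_(k <oo) F k w)%E.
  have [Zt|tZ] := leP (Z w) t.
    apply: (@le_trans _ _ (expR (a * t))%:E); last by rewrite leeDl.
    by rewrite lee_fin ler_expR ler_wpM2l.
  have ex : exists n : nat, Z w <= n%:R * t.
    exists (Num.bound (Z w / t)); rewrite -ler_pdivrMr//.
    by apply/ltW/archi_boundP; rewrite divr_ge0 ?ltW// (lt_trans t0).
  case: (ex_minnP ex) => n hn nmin.
  case: n => [|[|k]] in hn nmin.
  - by move: hn; rewrite mul0r leNgt (lt_trans t0).
  - by move: hn; rewrite mul1r leNgt tZ.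
  have Ak : A k w.
    by rewrite /A /mkset ltNge; apply/negP => /nmin; rewrite ltnn.
  apply: (@le_trans _ _ (F k w)).
    by rewrite /F indicE mem_set// mulr1 lee_fin ler_expR ler_wpM2l.
  apply: (@le_trans _ _ (\sum_(k <oo) F k w)%E); last by rewrite leeDr// lee_fin expR_ge0.
  apply: le_trans (nneseries_lim_ge (m := 0) k.+1 _); last by move=> *; exact: F0.
  by rewrite big_nat_recr//= leeDr// sume_ge0.
apply: (@le_trans _ _ (\int[P]_w ((expR (a * t))%:E + \sum_(k <oo) F k w))%E).
  by apply: le_integral_raw => w _; [rewrite lee_fin expR_ge0|exact: pointwise].
rewrite ge0_integralD//; last exact: ge0_emeasurable_sum.
rewrite EFinD; apply: leeD.
  have /(bounded_RintegralE P (measurable_cst _))-> : forall w : Om,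
    `|cst (expR (a * t)) w| <= `|expR (a * t)| by [].
  by rewrite Rintegral_prob_cst.
rewrite integral_nneseries//.
apply: le_trans (epsilon_trick0 xpredT ler01).
apply: lee_nneseries => k _; first by move=> *; exact: integral_ge0.
rewrite /F ge0_integral_EFinZ ?expR_ge0//.
have -> : (\int[P]_x (\1_(A k) x)%:E = (pr P (A k))%:E)%E.
  by rewrite integral_indic// setIT; exact: prE.
rewrite -EFinM lee_fin; apply: le_trans (ler_wpM2l (expR_ge0 _) (htail k)) _.
by rewrite [leLHS]mulrA -expRD subrr expR0.
Qed.

End exponential_tail.

Section truncated_logarithm.
Context {R : realType}.

(** The shift by [ln eta] makes the function nonnegative and the factor [eta] makes it 1-Lipschitz,
    hence admissible for [W1]. It is unbounded, so no estimate of large eigenvalues is required in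
    this setting. *)
Definition truncln (eta x : R) : R := eta * (ln (Num.max `|x| eta) - ln eta).

Variable eta : R.
Hypothesis eta0 : 0 < eta.
Hypothesis eta1 : eta <= 1.

Let max_gt0 (x : R) : 0 < Num.max `|x| eta.
Proof. by rewrite lt_max eta0 orbT. Qed.

Lemma truncln_ge0 x : 0 <= truncln eta x.
Proof.
apply: mulr_ge0; first exact: ltW.
by rewrite subr_ge0 ler_ln ?posrE// le_max lexx orbT.
Qed.

Lemma trunclnE (K x : R) : eta <= K -> `|x| <= K ->
  truncln eta x = eta * (clampln eta K x - ln eta).
Proof.
move=> eK xK; rewrite /truncln /clampln (min_idPl _)//.
by rewrite ge_max xK.
Qed.

Lemma truncln_lip x y : `|truncln eta x - truncln eta y| <= 1 * `|x - y|.
Proof.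
pose K := Num.max (Num.max `|x| `|y|) 1.
have K1 : 1 <= K by rewrite le_max lexx orbT.
have eK : eta <= K by exact: le_trans K1.
rewrite (@trunclnE K x) ?(@trunclnE K y)//; last 2 first.
- by rewrite !le_max lexx !orbT.
- by rewrite !le_max lexx.
rewrite -mulrBr opprB addrA subrK normrM gtr0_norm// -ler_pdivlMl// mul1r.
exact: clampln_lip.
Qed.

Lemma measurable_truncln : measurable_fun setT (truncln eta).
Proof. exact: lip_measurable truncln_lip. Qed.

(** The concentration hypothesis divides by the Lipschitz constant, which must therefore be
    positive: the values at 0 and at [2 * eta] differ by [eta * ln 2]. *)
Lemma lipR_truncln : (lipR (truncln eta) < +oo)%E /\ 0 < fine (lipR (truncln eta)) <= 1.
Proof.
have h := lipR_le ler01 truncln_lip; have h0 := lipR_ge0 (truncln eta).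
have hf : lipR (truncln eta) \is a fin_num by rewrite ge0_fin_numE// (le_lt_trans h) ?ltry.
split; first by rewrite (le_lt_trans h) ?ltry.
rewrite -!lte_fin -lee_fin fineK// h andbT lt_neqAle h0 andbT; apply/eqP => E.
have := @lipR_ge _ (truncln eta) 0; rewrite -E => /(_ (lexx _) (2 * eta) 0).
rewrite mul0r /truncln normr0 (max_idPr (ltW eta0)) subrr mulr0 subr0.
have h2 : eta <= 2 * eta by rewrite ler_peMl ?ler1n// ltW.
rewrite (gtr0_norm (mulr_gt0 (ltr0Sn R 1) eta0)) (max_idPl h2).
rewrite lnM ?posrE// addrK normr_le0 mulf_eq0 (gt_eqF eta0)/= gt_eqF// ln_gt0//.
by rewrite ltr1n.
Qed.

Lemma integral_truncln (nu : probability (measurableTypeR R) R) (K : R) : 1 <= K ->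
  nu [set x | K < `|x|] = 0%E ->
  (\int[nu]_x (truncln eta x)%:E = (eta * (\int[nu]_x clampln eta K x - ln eta))%:E)%E.
Proof.
move=> K1 nuK.
have mc : measurable_fun setT (clampln eta K) by exact: measurable_clampln.
have bc := clampln_bdd eta0 eta1 K1.
have mg : measurable_fun setT (fun x => eta * (clampln eta K x - ln eta)).
  by apply: measurable_funM => //; exact: measurable_funB.
have -> : (\int[nu]_x (truncln eta x)%:E =
           \int[nu]_x (eta * (clampln eta K x - ln eta))%:E)%E.
  apply: ae_eq_integral => //.
  - by apply/measurable_EFinP; exact: measurable_truncln.
  - exact/measurable_EFinP.
  exists [set x | K < `|x|]; split => //; first exact: measurable_abs_gt.
  move=> x /= h; rewrite ltNge; apply/negP => xK; apply: h => _.
  by rewrite (trunclnE (le_trans eta1 K1) xK).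
have bs x : `|clampln eta K x - ln eta| <= ln K - ln eta + `|ln eta|.
  by apply: le_trans (ler_normB _ _) _; rewrite lerD2r.
have ms : measurable_fun setT (fun x => clampln eta K x - ln eta) by exact: measurable_funB.
rewrite ge0_integral_EFinZ ?ltW//; last first.
  by move=> x; rewrite subr_ge0 clampln_ge.
rewrite (bounded_RintegralE nu ms bs) -EFinM; congr (_ * _)%:E.
exact: (Rintegral_prob_shift nu _ mc bc).
Qed.

Lemma abs_det_truncln N (T : 'M[R]_N) : sym_mx T -> (0 < N)%N ->
  `|\det T| <= expR (N%:R * (eta^-1 * (N%:R^-1 * tr_fun (truncln eta) T) + ln eta)).
Proof.
move=> Ts N0; have NR : (N%:R : R) != 0 by rewrite pnatr_eq0 -lt0n.
have -> : N%:R * (eta^-1 * (N%:R^-1 * tr_fun (truncln eta) T) + ln eta) =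
    \sum_(i < N) (ln (Num.max `|ev T i| eta)).
  rewrite tr_funE// mulrDr mulrCA [N%:R * (N%:R^-1 * _)]mulrA mulfV// mul1r.
  rewrite mulr_sumr [N%:R * _]mulr_natl -[X in _ *+ X]card_ord -sumr_const -big_split/=.
  apply: eq_bigr => i _; rewrite /truncln mulrA mulVf ?gt_eqF// mul1r.
  by rewrite subrK.
rewrite expR_sum det_ev// normr_prod; apply: ler_prod => i _.
by rewrite normr_ge0 lnK ?posrE// le_max lexx.
Qed.

End truncated_logarithm.

Section concentrated_core.
Context {R : realType} {m : nat} {d : nat -> measure_display}
  {Om : forall N, measurableType (d N)} (P : forall N, probability (Om N) R)
  (H : forall N, 'rV[R]_m -> {RV (P N) >-> 'M[R]_N})
  (mu : nat -> 'rV[R]_m -> probability (measurableTypeR R) R)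
  (muoo : 'rV[R]_m -> probability (measurableTypeR R) R).
Hypothesis H_sym : forall N u w, sym_mx (H N u w).
Variables (Q : set 'rV[R]_m) (k1 k2 eps0 : R).
Hypothesis k10 : 0 < k1.
Hypothesis k20 : 0 < k2.
Hypothesis eps00 : 0 < eps0.
Hypothesis mean_mu : forall u N, Q u -> (0 < N)%N ->
  (W1 (mean_esd (P N) (H N u)) (mu N u) <= (N%:R `^ (- k1))%:E)%E.
Hypothesis mu_muoo : forall u N, Q u -> (0 < N)%N ->
  (W1 (mu N u) (muoo u) <= (N%:R `^ (- k2))%:E)%E.
Hypothesis hconc : linear_statistics_concentrate H Q eps0.
Variable K : R.
Hypothesis K1 : 1 <= K.
Hypothesis muK : forall u N, Q u -> (0 < N)%N -> mu N u [set x | K < `|x|] = 0%E.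
Hypothesis muooK : forall u, Q u -> muoo u [set x | K < `|x|] = 0%E.

Variable eta : R.
Hypothesis eta0 : 0 < eta.
Hypothesis eta1 : eta <= 1.

Let Y N u w := N%:R^-1 * tr_fun (truncln eta) (H N u w).

Let mY N u : measurable_fun setT (@Y N u).
Proof.
apply: measurable_funM => //.
exact: (measurable_tr_fun (measurable_funPT (H N u)) (@H_sym N u) (measurable_truncln eta0 eta1)).
Qed.

Lemma mean_truncln u N : Q u -> (0 < N)%N -> exists2 y : R,
  (\int[P N]_w (@Y N u w)%:E = y%:E)%E &
  y <= eta * (\int[muoo u]_x clampln eta K x - ln eta) + N%:R `^ (- k1) + N%:R `^ (- k2).
Proof.
move=> Qu N0; have l1 := lipR_le ler01 (truncln_lip eta0 eta1).
have W1_ge (nu1 nu2 : set (measurableTypeR R) -> \bar R) (e : R) : (W1 nu1 nu2 <= e%:E)%E ->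
    (int_gap nu1 nu2 (truncln eta) <= e%:E)%E.
  by apply: le_trans; apply: ereal_sup_ubound; exists (truncln eta).
have := W1_ge _ _ _ (mean_mu Qu N0); have := W1_ge _ _ _ (mu_muoo Qu N0).
rewrite /int_gap (integral_mean_esd (P N) (measurable_funPT (H N u)) (@H_sym N u)
  (measurable_truncln eta0 eta1) (truncln_ge0 eta0)).
rewrite (integral_truncln eta0 eta1 K1 (muK Qu N0)) (integral_truncln eta0 eta1 K1 (muooK Qu)).
rewrite -/(@Y N u) -EFinB lee_fin => /ler_normlP[_ h1].
(* Finiteness of the mean comes from the distance: an infinite mean would make the [W1] gap
   infinite. *)
case E : (\int[P N]_w _)%E => [y| |] // h2; exists y => //.
move: h2; rewrite -EFinB lee_fin => /ler_normlP[_ h2].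
by move: h1 h2; move: (_ `^ _) (_ `^ _) (eta * _) (eta * _) => a b c e; lra.
Qed.

(* The exponent [1 + e1] of the concentration hypothesis beats the loss
   [N `^ zeta] for [zeta = e1 / 2], hence exponential tails at any rate [L]. *)
Lemma near_truncln_tail (L t0 : R) : 0 < t0 -> 0 <= L ->
  \forall N \near \oo, forall u y, Q u -> (\int[P N]_w (@Y N u w)%:E = y%:E)%E ->
    forall t, t0 <= t -> pr (P N) [set w | t < @Y N u w - y] <= expR (- (L * (N%:R * t))).
Proof.
move=> t00 L0; pose e1 := Num.min eps0 1.
have e10 : 0 < e1 by rewrite lt_min eps00 ltr01.
have e120 : 0 < e1 / 2 by rewrite divr_gt0.
have [c c0 hc] := hconc e120.
have te0 : 0 < t0 `^ e1 by exact: powR_gt0.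
have h1 := near_powR_ge (L / (c * t0 `^ e1)) e120.
have h2 := nbhs_infty_gt 0%N; have h3 := nbhs_infty_ger (t0^-1).
near=> N; have N0 : (0 < N)%N by near: N.
have g1 : L / (c * t0 `^ e1) <= N%:R `^ (e1 / 2) by near: N.
have g3 : t0^-1 <= N%:R by near: N.
move=> u y Qu EY t tt; have tpos : 0 < t by exact: lt_le_trans tt.
have NR : (0 : R) < N%:R by rewrite ltr0n.
have [lf /andP[q0 q1]] := lipR_truncln eta0 eta1.
have := hc u N (truncln eta) t Qu N0 lf tpos.
set q := fine _ in q0 q1 *; rewrite /=; set s := N%:R * t / q.
have E1 : (N%:R^-1%:E * 'E_(P N)[fun w => tr_fun (truncln eta) (H N u w)] = y%:E)%E.
  rewrite -EY /Y ge0_integral_EFinZ ?invr_ge0 ?ler0n//; first by rewrite unlock.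
    exact: (measurable_tr_fun (measurable_funPT (H N u)) (@H_sym N u) (measurable_truncln eta0 eta1)).
  move=> w; have sH := @H_sym N u w; rewrite tr_funE//.
  by apply: sumr_ge0 => i _; exact: truncln_ge0.
rewrite E1 => h.
have mA : measurable [set w | t < @Y N u w - y].
  by apply: measurable_ltr_set; exact: measurable_funB.
have mB : measurable [set w | t < `|@Y N u w - y|].
  apply: measurable_ltr_set.
  apply: (measurableT_comp (@normr_measurable R setT)); exact: measurable_funB.
apply: (@le_trans _ _ (pr (P N) [set w | t < `|@Y N u w - y|])).
  by apply: pr_le => // w /= hw; apply: lt_le_trans hw (ler_norm _).
have {}h : pr (P N) [set w | t < `|@Y N u w - y|] <=
    expR (- (c / N%:R `^ (e1 / 2) * Num.min (s ^+ 2) (s `^ (1 + eps0)))).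
  exact: pr_le_EFin.
apply: le_trans h _; rewrite ler_expR lerN2.
have Nt : 1 <= N%:R * t0 by rewrite -ler_pdivrMr// div1r.
have Ntt : N%:R * t0 <= N%:R * t by rewrite ler_wpM2l// ltW.
have sN : N%:R * t <= s.
  by rewrite /s ler_pdivlMr// ler_piMr// ltW// mulr_gt0.
have s1 : 1 <= s by apply: le_trans sN; exact: le_trans Ntt.
have s0 : 0 < s by exact: lt_le_trans s1.
have sE (x : R) : s `^ (1 + x) = s * s `^ x.
  by rewrite powRD ?powRr1 ?ltW//; apply/implyP => _; rewrite gt_eqF.
(* Since [s >= 1] and [e1] is at most both 1 and [eps0], each power in the minimum dominates [s]
   times the power [e1] of [s]. *)
have hmin : (N%:R * t) * (N%:R * t0) `^ e1 <= Num.min (s ^+ 2) (s `^ (1 + eps0)).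
  have hs : (N%:R * t0) `^ e1 <= s `^ e1.
    apply: ge0_ler_powR; rewrite ?nnegrE ?(ltW e10) ?(ltW s0)//.
      by apply: le_trans Nt.
    exact: le_trans sN.
  rewrite le_min; apply/andP; split.
    have -> : s ^+ 2 = s * s `^ 1 by rewrite powRr1 ?ltW.
    apply: ler_pM => //; rewrite ?powR_ge0//; first by rewrite ltW// mulr_gt0.
    by apply: le_trans hs _; apply: ler_powR => //; rewrite /e1 ge_min lexx orbT.
  rewrite sE; apply: ler_pM => //; rewrite ?powR_ge0//; first by rewrite ltW// mulr_gt0.
  by apply: le_trans hs _; apply: ler_powR => //; rewrite /e1 ge_min lexx.
have cN0 : 0 <= c / N%:R `^ (e1 / 2) by rewrite divr_ge0 ?powR_ge0// ltW.
apply: le_trans (ler_wpM2l cN0 hmin).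
rewrite [leRHS]mulrCA [leLHS]mulrC; apply: ler_wpM2l; first by rewrite ltW// mulr_gt0.
rewrite powRM ?(ltW NR) ?(ltW t00)//.
have -> : N%:R `^ e1 = N%:R `^ (e1 / 2) * N%:R `^ (e1 / 2) :> R.
  by rewrite -powRD -?splitr//; apply/implyP => _; rewrite gt_eqF.
have p0 : 0 < N%:R `^ (e1 / 2) :> R by exact: powR_gt0.
have -> : c / N%:R `^ (e1 / 2) * (N%:R `^ (e1 / 2) * N%:R `^ (e1 / 2) * t0 `^ e1) =
    N%:R `^ (e1 / 2) * (c * t0 `^ e1) by field; rewrite gt_eqF.
by rewrite -ler_pdivrMr// mulr_gt0.
Unshelve. all: by end_near. Qed.

(** A power [p] of the determinant is at most a constant times [exp (a0 N (Y - y))] with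
    [a0 = p / eta], so [exp_tail] applies as soon as the tails of [Y - y] decay faster than this
    rate. The step [t] is chosen with [a0 N t = N p e / 4]. *)
Lemma near_concentrated_moment (p e : R) : 0 < p -> 0 < e ->
  \forall N \near \oo, forall u, Q u ->
    (\int[P N]_w (`|\det (H N u w)| `^ p)%:E <=
      (expR (p * (N%:R * (\int[muoo u]_x clampln eta K x + e))))%:E)%E.
Proof.
move=> p0 e0; pose a0 := p / eta; have a00 : 0 < a0 by rewrite divr_gt0.
pose t := eta * e / 4; have t0 : 0 < t by rewrite divr_gt0// mulr_gt0.
(* In the rate [2 * a0 + 1] the first term covers the upper end of the slab, as
   [k + 2 <= 2 (k + 1)]; the second gives the factor [2^-(k+1)], as [N t >= 1] and [2 <= e]. *)
have L0 : 0 <= 2 * a0 + 1 by rewrite addr_ge0// mulr_ge0// ltW.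
have h1 := near_truncln_tail t0 L0.
have h2 := nbhs_infty_gt 0%N; have h3 := nbhs_infty_ger (t^-1).
have h4 := @near_powRN_le R k1 t 1 k10 t0.
have h5 := @near_powRN_le R k2 t 1 k20 t0.
have h6 := nbhs_infty_ger (p * e / 4)^-1.
near=> N; have N0 : (0 < N)%N by near: N.
have g1 : forall u y, Q u -> (\int[P N]_w (@Y N u w)%:E = y%:E)%E ->
    forall s, t <= s -> pr (P N) [set w | s < @Y N u w - y] <= expR (- ((2 * a0 + 1) * (N%:R * s))).
  by near: N.
have g3 : t^-1 <= N%:R by near: N.
have g4 : 1 * N%:R `^ (- k1) <= t by near: N.
have g5 : 1 * N%:R `^ (- k2) <= t by near: N.
have g6 : (p * e / 4)^-1 <= N%:R by near: N.
move=> u Qu; have [y EY yle] := mean_truncln Qu N0.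
have NR : (0 : R) < N%:R by rewrite ltr0n.
set I := \int[muoo u]_x _ in yle *.
have Nt : 1 <= N%:R * t by rewrite -ler_pdivrMr// div1r.
have mZ : measurable_fun setT (fun w => @Y N u w - y) by exact: measurable_funB.
have aN0 : 0 <= a0 * N%:R := mulr_ge0 (ltW a00) (ltW NR).
have tail (k : nat) : pr (P N) [set w | k.+1%:R * t < @Y N u w - y] <=
    expR (- (a0 * N%:R * (k.+2%:R * t))) / (2 ^ k.+1)%:R.
  have tk : t <= k.+1%:R * t by apply: ler_peMl; [exact: ltW|rewrite ler1n].
  apply: le_trans (g1 u y Qu EY _ tk) _.
  have p2 : (0 : R) < (2 ^ k.+1)%:R by rewrite ltr0n expn_gt0.
  rewrite ler_pdivlMr//.
  have h2k : (2 ^ k.+1)%:R <= expR k.+1%:R :> R.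
    rewrite natrX -[k.+1%:R]mulr1 expRM_natl; apply: lerXn2r; rewrite ?nnegrE ?expR_ge0//.
    by apply: le_trans (expR_ge1Dx 1); rewrite -[1 + 1]/2%:R.
  apply: le_trans (ler_wpM2l (expR_ge0 _) h2k) _; rewrite -expRD ler_expR.
  have kt : k.+1%:R <= k.+1%:R * (N%:R * t) by rewrite ler_peMr.
  have kk : k.+2%:R <= 2 * k.+1%:R :> R.
    by rewrite -natrM ler_nat mul2n -addnn addSnnS addnS ltnS leq_addl.
  have h : a0 * N%:R * (k.+2%:R * t) <= a0 * N%:R * (2 * k.+1%:R * t).
    by rewrite ler_wpM2l// ler_wpM2r// ltW.
  have -> : (2 * a0 + 1) * (N%:R * (k.+1%:R * t)) =
    a0 * N%:R * (2 * k.+1%:R * t) + k.+1%:R * (N%:R * t) by ring.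
  move: h kt; move: (a0 * N%:R * (2 * k.+1%:R * t)) (a0 * N%:R * (k.+2%:R * t)) => x1 x2.
  by move: (k.+1%:R * (N%:R * t)) (k.+1%:R) => x3 x4; lra.
have hexp := exp_tail mZ t0 aN0 tail.
pose c0 := p * (N%:R * (eta^-1 * y + ln eta)).
have pointwise w : `|\det (H N u w)| `^ p <= expR c0 * expR (a0 * N%:R * (@Y N u w - y)).
  have hd := abs_det_truncln eta0 (@H_sym N u w) N0.
  apply: (@le_trans _ _ (expR (N%:R * (eta^-1 * @Y N u w + ln eta)) `^ p)).
    by apply: ge0_ler_powR; rewrite ?nnegrE ?expR_ge0// ltW.
  rewrite -expRM -expRD ler_expR /c0 /a0.
  by rewrite le_eqVlt; apply/orP; left; apply/eqP; field; rewrite gt_eqF.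
apply: (@le_trans _ _ (\int[P N]_w (expR c0 * expR (a0 * N%:R * (@Y N u w - y)))%:E)%E).
  by apply: le_integral_raw => w _; rewrite lee_fin ?powR_ge0//; exact: pointwise.
rewrite ge0_integral_EFinZ ?expR_ge0//; last first.
  by apply: measurableT_comp => //; exact: measurable_funM.
apply: (le_trans (lee_wpmul2l _ hexp)); first by rewrite lee_fin expR_ge0.
rewrite -EFinM lee_fin.
have pe0 : 0 < p * e / 4 by rewrite divr_gt0// mulr_gt0.
have Npe : 1 <= N%:R * (p * e / 4) by rewrite -ler_pdivrMr// div1r.
have at0 : a0 * N%:R * t = N%:R * (p * e / 4) by rewrite /a0 /t; field; rewrite gt_eqF.
have two : expR (a0 * N%:R * t) + 1 <= expR (N%:R * (p * e / 4) + N%:R * (p * e / 4)).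
  rewrite at0 expRD; set E := expR _.
  have E2 : 2 <= E by apply: le_trans (expR_ge1Dx _); lra.
  by nra.
apply: (le_trans (ler_wpM2l (expR_ge0 _) two)); rewrite -expRD ler_expR /c0.
have hy : eta^-1 * y <= I - ln eta + e / 2.
  rewrite ler_pdivrMl//; apply: le_trans yle _.
  have -> : eta * (I - ln eta + e / 2) = eta * (I - ln eta) + t + t by rewrite /t; field.
  by move: g4 g5; rewrite !mul1r => g4 g5; rewrite -!addrA; apply: lerD => //; exact: lerD.
have hy2 : p * (N%:R * (eta^-1 * y + ln eta)) <= p * (N%:R * (I + e / 2)).
  by rewrite ler_pM2l// ler_pM2l//; move: hy; move: (eta^-1 * y) => x; lra.
apply: le_trans (lerD hy2 (lexx _)) _.
by rewrite le_eqVlt; apply/orP; left; apply/eqP; field.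
Unshelve. all: by end_near. Qed.

End concentrated_core.

Section concentrated_case.
Context {R : realType} {m : nat} {d : nat -> measure_display}
  {Om : forall N, measurableType (d N)} (P : forall N, probability (Om N) R)
  (H : forall N, 'rV[R]_m -> {RV (P N) >-> 'M[R]_N})
  (mu : nat -> 'rV[R]_m -> probability (measurableTypeR R) R)
  (muoo : 'rV[R]_m -> probability (measurableTypeR R) R).

Lemma concentrated_control (Q : set 'rV[R]_m) :
  (forall N u w, sym_mx (H N u w)) -> concentrated_input H mu ->
  limit_measures mu muoo W1 -> compact Q -> Q !=set0 ->
  exists K : R, [/\ 1 <= K, spectral_control H muoo Q K & determinant_control H muoo Q K].
Proof.
move=> H_sym hH hlim cQ Q0.
have [k1 [eps0 [k10 eps00 [mean_mu supp_mu _] hL _]]] := hH Q cQ Q0.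
have [k2 k20 hk2] := hlim Q cQ.
have mu_muoo u N : Q u -> (0 < N)%N -> (W1 (mu N u) (muoo u) <= (N%:R `^ (- k2))%:E)%E.
  by move=> Qu N0; have [h _] := hk2 u Qu; exact: h.
have [K1 K11 muK1] := compact_support_bound supp_mu.
have mean_mu' u N : Q u -> (0 < N)%N ->
    (dBL (mean_esd (P N) (H N u)) (mu N u) <= (N%:R `^ (- k1))%:E)%E.
  by move=> Qu N0; apply: le_trans (dBL_le_W1 _ _) (mean_mu _ _ Qu N0).
have mu_muoo' u N : Q u -> (0 < N)%N -> (dBL (mu N u) (muoo u) <= (N%:R `^ (- k2))%:E)%E.
  by move=> Qu N0; apply: le_trans (dBL_le_W1 _ _) (mu_muoo _ _ Qu N0).
have K2 : 1 <= K1 + 1 by apply: le_trans K11 _; rewrite lerDl.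
have sc := spectral_control_limit H_sym k10 k20 mean_mu' mu_muoo' muK1 (lexx _).
have muK2 u N : Q u -> (0 < N)%N -> mu N u [set x | K1 + 1 < `|x|] = 0%E.
  move=> Qu N0; apply/eqP; rewrite eq_le measure_ge0 andbT -(muK1 u N Qu N0) le_measure ?inE//.
  - exact: measurable_abs_gt.
  - exact: measurable_abs_gt.
  - by move=> x /=; apply: lt_trans; rewrite ltrDl.
have hmom := near_concentrated_moment H_sym k10 k20 eps00 mean_mu mu_muoo hL K2 muK2 sc.1.
exists (K1 + 1); split => //; split.
  move=> eta e eta0 eta1 e0; have := hmom eta eta0 eta1 1 e ltr01 e0.
  apply: filterS => N hN u Qu; have := hN u Qu; rewrite mul1r.
  by under eq_integral do rewrite powRr1//.
(* The second moment is already [exp (O(N))]: take [p = 2] and [eta = 1], for which the clamped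
   logarithm lies between 0 and [ln (K1 + 1)]. *)
exists 1, (2 * (ln (K1 + 1) + 1)); split => //.
have h1 := hmom 1 ltr01 (lexx _) (1 + 1) 1 (addr_gt0 ltr01 ltr01) ltr01.
have h2 := @near_NlnN_ge R 1.
near=> N.
have g1 : forall u, Q u -> (\int[P N]_w (`|\det (H N u w)| `^ (1 + 1))%:E <=
      (expR ((1 + 1) * (N%:R * (\int[muoo u]_x clampln 1 (K1 + 1) x + 1))))%:E)%E by near: N.
have g2 : 1 * N%:R <= N%:R * ln N%:R :> R by near: N.
move=> u Qu; apply: le_trans (g1 u Qu) _; rewrite lee_fin ler_expR -[1 + 1]/2%:R -mulrA.
rewrite ler_pM2l//; rewrite mul1r in g2.
have l0 : 0 <= ln (K1 + 1) + 1 by rewrite addr_ge0// ln_ge0.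
apply: le_trans (ler_wpM2l l0 g2); rewrite mulrC ler_wpM2r ?ler0n// lerD2r.
rewrite -[leRHS](Rintegral_prob_cst (muoo u)).
apply: (@Rintegral_prob_le _ _ _ (muoo u) _ _ (ln (K1 + 1))) => //.
- exact: measurable_clampln.
- by move=> x; have := clampln_bdd ltr01 (lexx _) K2 x; rewrite ln1 subr0.
- by move=> x; rewrite ger0_norm ?ln_ge0.
- by move=> x; exact: clampln_le.
Unshelve. all: by end_near. Qed.

End concentrated_case.

(** * The logarithmic potential *)

Section logarithmic_potential.
Context {R : realType}.
Implicit Types nu : probability (measurableTypeR R) R.

(* The singularity is summed over geometric shells: with [expR La = 4 `^ b^-1]
   the mass of the [j]-th shell decays like [4 ^- j], the logarithm grows
   like [j]. *)
Definition shell (s t : R) : set (measurableTypeR R) := [set x : R | s <= `|x| < t].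

Lemma measurable_shell s t : measurable (shell s t).
Proof.
rewrite (_ : shell s t = (@Num.norm R R) @^-1` `[s, t[%classic).
  rewrite -[X in measurable X]setTI; exact: (@normr_measurable R setT).
by apply/seteqP; split => x /=; rewrite in_itv.
Qed.

(** The exponent [k], which may exceed 1, is lowered to [b <= 1]: this weakens the density bound
    because [|x| <= 1], and makes it largest at the inner radius [s]. The factor [2 * t] is the
    length of an interval containing the shell. *)
Lemma shell_mass nu (k b s t : R) : 0 < k -> b <= k -> b <= 1 -> 0 < s -> s <= t -> t <= 1 ->
  t <= k -> density_near0 nu `[- k, k]%classic k ->
  (nu (shell s t) <= (k^-1 * s `^ (b - 1) * (2 * t))%:E)%E.
Proof.
move=> k0 bk b1 s0 st t1 tk [g [mg g0 gnu gk]].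
have sub : shell s t `<=` `[- k, k]%classic.
  move=> x /= /andP[_ xt]; have := lt_le_trans xt tk; rewrite ltr_norml in_itv/=.
  by move=> /andP[h1 h2]; rewrite !ltW.
rewrite (gnu _ (measurable_shell s t) sub).
have c0 : 0 <= k^-1 * s `^ (b - 1) by rewrite mulr_ge0 ?powR_ge0// invr_ge0 ltW.
apply: (@le_trans _ _ (\int[lebesgue_measure]_(x in shell s t) (k^-1 * s `^ (b - 1))%:E)%E).
  apply: le_integral_raw => x /[dup] xS /= /andP[sx xt]; rewrite lee_fin; first exact/g0/sub.
  have x0 : 0 < `|x| by exact: lt_le_trans sx.
  have xk : 0 < `|x| < k by rewrite x0 (lt_le_trans xt).
  apply: le_trans (ltW (gk x xk)) _; rewrite ler_pM2l ?invr_gt0//.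
  rewrite /powR !gt_eqF// ler_expR.
  have l1 : ln s <= ln `|x| by rewrite ler_ln ?posrE.
  have l2 : ln `|x| <= 0 by apply: ln_le0; apply: le_trans (ltW xt) t1.
  by nra.
rewrite integral_cst; last exact: measurable_shell.
rewrite [X in (_ <= X)%E]EFinM; apply: lee_wpmul2l => //.
apply: (@le_trans _ _ (lebesgue_measure `]- t, t[%classic)).
  apply: le_measure; rewrite ?inE; [exact: measurable_shell|exact: measurable_itv|].
  by move=> x /= /andP[_]; rewrite in_itv/= ltr_norml.
have t0 : 0 < t by exact: lt_le_trans st.
have -> : lebesgue_measure `]- t, t[%classic = (2 * t)%:E.
  by rewrite lebesgue_measure_itv/= lte_fin gtrN// -EFinB; congr EFin; ring.
by [].
Qed.

Lemma log_singularity (k : R) : 0 < k -> forall e : R, 0 < e ->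
  exists2 eta0 : R, 0 < eta0 <= 1 &
  forall nu eta, density_near0 nu `[- k, k]%classic k -> 0 < eta <= eta0 ->
    (\int[nu]_x (Num.max 0 (ln eta - ln `|x|))%:E <= e%:E)%E.
Proof.
move=> k0 e e0; pose b := Num.min k 1 / 2.
have b0 : 0 < b by rewrite divr_gt0// lt_min k0 ltr01.
have bk2 : 2 * b <= k by rewrite /b mulrC divfK ?pnatr_eq0// ge_min lexx.
have b12 : 2 * b <= 1 by rewrite /b mulrC divfK ?pnatr_eq0// ge_min lexx orbT.
have bk : b <= k by lra.
have b1 : b <= 1 by lra.
pose La := ln 4 / b; have l4 : 0 < ln 4 :> R by rewrite ln_gt0// ltr1n.
have La0 : 0 < La by rewrite divr_gt0.
(* [C] gathers the constants of all shells: with radii [t j = eta * expR (- (j%:R * La))], shell [j]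
   contributes at most [C eta^b (j+1) / 4^(j+1) <= C eta^b / 2^(j+1)], and [eta0] makes [C eta^b] at
   most [e]. *)
pose C := 2 * La * expR La / k.
have C0 : 0 < C := divr_gt0 (mulr_gt0 (mulr_gt0 (ltr0Sn R 1) La0) (expR_gt0 La)) k0.
pose eta0 := Num.min b ((e / C) `^ (b^-1)).
have eC : 0 < e / C by rewrite divr_gt0.
have eta00 : 0 < eta0 by rewrite lt_min b0 powR_gt0.
have eta0b : eta0 <= b by rewrite ge_min lexx.
exists eta0; first by rewrite eta00 (le_trans eta0b).
move=> nu eta dens /andP[h0 h1].
have hb : eta `^ b <= e / C.
  apply: (@le_trans _ _ (((e / C) `^ (b^-1)) `^ b)).
    apply: ge0_ler_powR; rewrite ?nnegrE ?powR_ge0 ?(ltW b0) ?(ltW h0)//.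
    by apply: le_trans h1 _; rewrite ge_min lexx orbT.
  by rewrite -powRrM mulVf ?gt_eqF// powRr1// ltW.
have etab : eta <= b by exact: le_trans eta0b.
pose t (j : nat) := eta * expR (- (j%:R * La)).
have t0 j : 0 < t j by rewrite mulr_gt0// expR_gt0.
have teta j : t j <= eta.
  by rewrite /t ler_piMr ?(ltW h0)// -expR0 ler_expR oppr_le0 mulr_ge0// ltW.
have tS j : t j.+1 <= t j.
  rewrite /t ler_pM2l// ler_expR lerN2 ler_wpM2r ?ltW//; by rewrite ltr_nat.
pose F j x := (j.+1%:R * La * \1_(shell (t j.+1) (t j)) x)%:E.
have jLa j : 0 <= j%:R * La by apply: mulr_ge0 => //; exact: ltW.
have F0 j x : (0 <= F j x)%E by rewrite lee_fin; apply: mulr_ge0 => //; exact: jLa.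
have mF j : measurable_fun setT (F j).
  apply/measurable_EFinP; apply: measurable_funM => //.
  by apply: measurable_indic; exact: measurable_shell.
have pointwise (x : R) : ((Num.max 0 (ln eta - ln `|x|))%:E <= \sum_(j <oo) F j x)%E.
  have S0 : (0 <= \sum_(j <oo) F j x)%E by apply: nneseries_ge0.
  have [psi0|psi0] := leP (ln eta - ln `|x|) 0; first exact: S0.
  (* By convention [ln 0 = 0], and [eta <= 1], so the integrand vanishes at 0 and a positive value
     excludes this point. *)
  have x0 : 0 < `|x|.
    rewrite normr_gt0; apply/eqP => x0; move: psi0; rewrite x0 normr0 [ln 0]ln0// subr0.
    by rewrite ltNge ln_le0//; lra.
  have tE (j : nat) : (t j <= `|x|) = (ln eta - ln `|x| <= j%:R * La).
    rewrite -ler_ln ?posrE// /t lnM ?posrE ?expR_gt0// expRK.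
    by rewrite lerBlDr lerBlDl.
  have ex : exists n : nat, t n <= `|x|.
    exists (Num.bound ((ln eta - ln `|x|) / La)); rewrite tE -ler_pdivrMr//.
    by apply/ltW/archi_boundP; rewrite divr_ge0 ?ltW.
  case: (ex_minnP ex) => -[|j] hn nmin.
    by move: hn; rewrite tE mul0r leNgt psi0.
  have Sx : shell (t j.+1) (t j) x.
    rewrite /shell/= hn ltNge; apply/negP => /nmin; by rewrite ltnn.
  apply: (@le_trans _ _ (F j x)).
    rewrite /F indicE mem_set// mulr1 lee_fin -tE//.
  apply: le_trans (nneseries_lim_ge (m := 0) j.+1 _); last by move=> *; exact: F0.
  by rewrite big_nat_recr//= leeDr// sume_ge0.
apply: (@le_trans _ _ (\int[nu]_x \sum_(j <oo) F j x)%E).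
  apply: le_integral_raw => x _; last exact: pointwise.
  by rewrite lee_fin le_max lexx.
rewrite integral_nneseries//.
have Ce : C * eta `^ b <= e by rewrite mulrC -ler_pdivlMr.
apply: (@le_trans _ _ (C * eta `^ b)%:E); last by rewrite lee_fin.
apply: le_trans (epsilon_trick0 xpredT _); last by rewrite mulr_ge0 ?powR_ge0// ltW.
apply: lee_nneseries => j _; first by move=> *; exact: integral_ge0.
have mI : measurable_fun setT (\1_(shell (t j.+1) (t j)) : measurableTypeR R -> R).
  by apply: measurable_indic; exact: measurable_shell.
have I0 (x : measurableTypeR R) : 0 <= \1_(shell (t j.+1) (t j)) x :> R by rewrite indicE.
rewrite /F (ge0_integral_EFinZ nu mI I0 (jLa _)).
have -> : (\int[nu]_x (\1_(shell (t j.+1) (t j)) x)%:E = nu (shell (t j.+1) (t j)))%E.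
  by rewrite integral_indic ?setIT//; exact: measurable_shell.
have hm := shell_mass k0 bk b1 (t0 j.+1) (tS j) (le_trans (teta j) (le_trans etab b1))
  (le_trans (teta j) (le_trans etab bk)) dens.
have jL : (0 <= (j.+1%:R * La)%:E)%E by rewrite lee_fin mulr_ge0// ltW.
apply: (le_trans (lee_wpmul2l jL hm)); rewrite -EFinM lee_fin.
have tt : t j = t j.+1 * expR La.
  by rewrite /t -mulrA -expRD; congr (_ * expR _); rewrite -[j.+1%:R]natr1; ring.
have tb : t j.+1 `^ (b - 1) * t j.+1 = t j.+1 `^ b.
  rewrite -{2}[t j.+1]powRr1 ?ltW// -powRD ?subrK//.
  by apply/implyP => _; rewrite gt_eqF.
have t4 : t j.+1 `^ b = eta `^ b * (4 ^+ j.+1)^-1.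
  rewrite /t powRM ?expR_ge0 ?ltW// -expRM; congr (_ * _).
  have -> : - (j.+1%:R * La) * b = - (j.+1%:R * ln 4).
    by rewrite /La; field; rewrite gt_eqF.
  by rewrite expRN expRM_natl lnK ?posrE.
have -> : j.+1%:R * La * (k^-1 * t j.+1 `^ (b - 1) * (2 * t j)) =
    C * eta `^ b * (j.+1%:R * (4 ^+ j.+1)^-1).
  transitivity (j.+1%:R * La * k^-1 * 2 * expR La * (t j.+1 `^ (b - 1) * t j.+1)).
    by rewrite tt; ring.
  by rewrite tb t4 /C; ring.
rewrite ler_pM2l; last by rewrite mulr_gt0// powR_gt0.
have -> : (4 : R) ^+ j.+1 = (2 ^ j.+1)%:R * (2 ^ j.+1)%:R.
  by rewrite !natrX -exprMn; congr (_ ^+ _); ring.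
have p2 : (0 : R) < (2 ^ j.+1)%:R by rewrite ltr0n expn_gt0.
rewrite invfM mulrA ler_piMl ?invr_ge0 ?ltW//.
rewrite ltr_pdivrMr// mul1r ltr_nat; exact: ltn_expl.
Qed.

Lemma density_null0 nu (k : R) : 0 < k -> density_near0 nu `[- k, k]%classic k ->
  nu [set 0 : R] = 0%E.
Proof.
move=> k0 [g [mg g0 gnu gk]].
have s0 : [set (0 : R)] `<=` `[- k, k]%classic.
  by move=> _ -> /=; rewrite in_itv/= oppr_le0 ltW//= ltW.
rewrite (gnu _ (measurable_set1 _) s0).
rewrite integral_set1 //.
Qed.

Lemma measurable_lne_abs : measurable_fun setT (fun x : measurableTypeR R => lne (`|x|%R)%:E).
Proof.
rewrite (_ : (fun _ => _) = (fun x : R => if x == 0 then -oo%E else (ln `|x|)%:E)).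
  apply: measurable_fun_ifT => //.
    by apply: measurable_fun_eqr => //; exact: measurable_id.
  apply/measurable_EFinP; apply: measurableT_comp; first exact: measurable_ln.
  exact: normr_measurable.
apply/funext => x; case: eqP => [->|/eqP x0]; first by rewrite normr0 /= lexx.
by rewrite lne_EFin// normr_gt0.
Qed.

(** Off the null set formed by 0 and the points beyond [K], [ln |x|] is [clampln eta K x] minus the
    nonnegative [phi eta x], whose integral is at most [e] by [log_singularity]. The point 0 must be
    null, since [lne 0] is minus infinity. *)
Lemma log_potential (k K e : R) : 0 < k -> 1 <= K -> 0 < e ->
  exists2 eta0 : R, 0 < eta0 <= 1 &
  forall nu, density_near0 nu `[- k, k]%classic k -> nu [set x | K < `|x|] = 0%E ->
  exists2 V : R, (\int[nu]_x lne (`|x|%R)%:E = V%:E)%E &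
  forall eta, 0 < eta <= eta0 ->
    V <= \int[nu]_x clampln eta K x <= V + e.
Proof.
move=> k0 K1 e0; have [eta0 /andP[eta00 eta01] heta0] := log_singularity k0 e0.
exists eta0; first by rewrite eta00.
move=> nu dens nuK.
pose phi eta (x : R) := Num.max 0 (ln eta - ln `|x|).
have mlog : measurable_fun setT (fun x : measurableTypeR R => ln `|x|).
  by apply: measurableT_comp; [exact: measurable_ln|exact: normr_measurable].
have mphi eta : measurable_fun setT (phi eta : measurableTypeR R -> R).
  by apply: measurable_maxr => //; exact: measurable_funB.
have phi0 eta x : 0 <= phi eta x by rewrite le_max lexx.
have iphi eta : 0 < eta <= eta0 -> nu.-integrable setT (EFin \o phi eta).
  move=> heta; apply/integrableP; split; first exact/measurable_EFinP.
  apply: le_lt_trans (ltry e).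
  have -> : (\int[nu]_x `|(EFin \o phi eta) x| = \int[nu]_x (phi eta x)%:E)%E.
    by apply: eq_integral => x _; rewrite /= ger0_norm.
  exact: heta0.
have main eta : 0 < eta <= eta0 -> (\int[nu]_x lne (`|x|%R)%:E =
    (\int[nu]_x clampln eta K x - \int[nu]_x phi eta x)%:E)%E.
  move=> heta; have /andP[eta1 eta2] := heta.
  have eta3 : eta <= 1 by exact: le_trans eta01.
  have mc := @measurable_clampln _ eta K eta1 eta3 K1.
  have ic : nu.-integrable setT (EFin \o clampln eta K).
    exact: (bounded_integrable nu mc (clampln_bdd eta1 eta3 K1)).
  transitivity (\int[nu]_x (clampln eta K x - phi eta x)%:E)%E.
    apply: ae_eq_integral => //.
    - exact: measurable_lne_abs.
    - by apply/measurable_EFinP; exact: measurable_funB.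
    exists ([set 0 : R] `|` [set x | K < `|x|]); split.
    - by apply: measurableU; [exact: measurable_set1|exact: measurable_abs_gt].
    - apply/eqP; rewrite eq_le measure_ge0 andbT.
      apply: le_trans (measureU2 _ _ _) _; [exact: measurable_set1|exact: measurable_abs_gt|].
      rewrite -[leRHS]adde0; apply: leeD; rewrite le_eqVlt; apply/orP; left; apply/eqP.
        exact: density_null0 k0 dens.
      exact: nuK.
    move=> x hx; have [->|x0] := eqVneq x 0; first by left.
    right; rewrite /mkset ltNge; apply/negP => xK; apply: hx => _.
    rewrite -normr_gt0 in x0.
    rewrite lne_EFin//; congr EFin; rewrite /clampln /phi.
    rewrite (min_idPl _); last by rewrite ge_max xK (le_trans eta3).
    have [xeta|xeta] := leP `|x| eta.
      have h : ln `|x| <= ln eta by rewrite ler_ln ?posrE.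
      by rewrite (max_idPr _) ?subr_ge0// subKr.
    have h : ln eta <= ln `|x| by rewrite ler_ln ?posrE ?ltW.
    by rewrite (max_idPl _) ?subr_le0// subr0.
  have iD : nu.-integrable setT (EFin \o (fun x => clampln eta K x - phi eta x)).
    exact: (integrableB measurableT ic (iphi eta heta)).
  have -> : (\int[nu]_x (clampln eta K x - phi eta x)%:E =
      (\int[nu]_x (clampln eta K x - phi eta x))%:E)%E.
    by rewrite /Rintegral fineK//; exact: integrable_fin_num.
  by congr EFin; apply: RintegralB => //; exact: iphi.
have ee : 0 < eta0 <= eta0 by rewrite eta00 lexx.
exists (\int[nu]_x clampln eta0 K x - \int[nu]_x phi eta0 x); first exact: main.
move=> eta heta; have := main eta heta; rewrite (main eta0 ee) => -[->].
have p0 : 0 <= \int[nu]_x phi eta x by apply: Rintegral_ge0.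
have pe : \int[nu]_x phi eta x <= e.
  rewrite /Rintegral -lee_fin fineK; first exact: heta0.
  by apply: integrable_fin_num => //; exact: iphi.
by apply/andP; split; lra.
Qed.

End logarithmic_potential.

(** * Dependence on the parameter *)

Section left_mass.
Context {R : realType}.
Implicit Types nu : probability (measurableTypeR R) R.

Definition ramp (a x : R) : R := Num.min (Num.max (a - x) 0) 1.

Lemma ramp_ge0 a x : 0 <= ramp a x.
Proof. by rewrite le_min ler01 le_max lexx orbT. Qed.

Lemma ramp_bdd a x : `|ramp a x| <= 1.
Proof. by rewrite ger0_norm ?ramp_ge0// ge_min lexx orbT. Qed.

Lemma ramp_lip a x y : `|ramp a x - ramp a y| <= 1 * `|x - y|.
Proof.
have h1 := ler_norm (x - y); have h2 := ler_norm (y - x); rewrite distrC in h2.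
rewrite mul1r /ramp; case: (leP (a - x) 0) => ?; case: (leP (a - y) 0) => ?;
  rewrite ?(min_idPl ler01); apply/ler_normlP.
- by split; lra.
- by case: (leP (a - y) 1) => ?; split; lra.
- by case: (leP (a - x) 1) => ?; split; lra.
- by case: (leP (a - x) 1) => ?; case: (leP (a - y) 1) => ?; split; lra.
Qed.

(** A substitute for the mass of []-oo, a[] that is continuous in the measure and vanishes together
    with it. Besides [a = 0] it is used with [a = 2 * eps], to see that [goodset_eps] is closed. *)
Definition left_mass nu (a : R) : R := \int[nu]_x ramp a x.

Lemma left_mass_ge nu (a b c : R) : 0 <= b -> b <= a - c -> b <= 1 ->
  b * fine (nu `]-oo, c]%classic) <= left_mass nu a.
Proof.
move=> b0 bac b1; have mr := lip_measurable (ramp_lip a).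
have mI : measurable (`]-oo, c]%classic : set (measurableTypeR R)) by exact: measurable_itv.
have h0 : forall x : measurableTypeR R, setT x -> (0 <= (ramp a x)%:E)%E.
  by move=> x _; rewrite lee_fin ramp_ge0.
have hb : forall x : measurableTypeR R, `]-oo, c]%classic x -> (b%:E <= (ramp a x)%:E)%E.
  move=> x; rewrite /= in_itv/= => xc; rewrite lee_fin le_min b1 andbT le_max.
  by rewrite (le_trans bac)// lerD2l lerN2.
have := integral_ge0_lb nu mI (@subsetT _ _) b0 h0 hb.
rewrite (bounded_RintegralE nu mr (ramp_bdd a)) -[left_mass nu a]/(\int[nu]_x ramp a x).
move=> h; rewrite -lee_fin EFinM fineK ?fin_num_measure//.
Qed.

Lemma left_mass_ge0 nu a : 0 <= left_mass nu a.
Proof. by apply: Rintegral_ge0 => x _; exact: ramp_ge0. Qed.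

Lemma left_mass_eq0 nu a : left_mass nu a = 0 <-> nu `]-oo, a[%classic = 0%E.
Proof.
split=> [h|h].
  pose F n : set (measurableTypeR R) := `]-oo, a - n.+1%:R^-1]%classic.
  have mF n : measurable (F n) by exact: measurable_itv.
  have F0 n : nu (F n) = 0%E.
    have n0 : (0 : R) < n.+1%:R^-1 by rewrite invr_gt0 ltr0n.
    have n1 : n.+1%:R^-1 <= 1 :> R by rewrite invf_le1 ?ler1n ?ltr0n.
    have := @left_mass_ge nu a n.+1%:R^-1 (a - n.+1%:R^-1) (ltW n0) _ n1.
    rewrite subKr lexx h => /(_ isT).
    rewrite pmulr_rle0// => h1; apply/eqP; rewrite eq_le measure_ge0 andbT.
    by rewrite -[leLHS]fineK ?fin_num_measure// lee_fin.
  apply: measure_negligible; first exact: measurable_itv.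
  apply: (@negligibleS _ _ _ nu (\bigcup_n F n)).
    move=> x /=; rewrite in_itv/= => xa; exists (Num.bound (a - x)^-1) => //.
    rewrite /F/= in_itv/= lerBrDl -lerBrDr.
    have ax : 0 < a - x by rewrite subr_gt0.
    rewrite -[leRHS]invrK lef_pV2 ?posrE ?invr_gt0 ?ltr0n//.
    have := @archi_boundP R (a - x)^-1; rewrite invr_ge0 (ltW ax) => /(_ isT) /ltW h'.
    by apply: le_trans h' _; rewrite ler_nat.
  by apply: negligible_bigcup => n; exists (F n); split => //; exact: F0.
rewrite /left_mass /Rintegral.
have -> : (\int[nu]_x (ramp a x)%:E = \int[nu]_x cst 0%E x)%E.
  apply: ae_eq_integral => //.
    by apply/measurable_EFinP; exact: lip_measurable (ramp_lip a).
  exists `]-oo, a[%classic; split => //.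
  move=> x hx /=; rewrite in_itv/= ltNge; apply/negP => xa; apply: hx => _ /=.
  by rewrite /ramp (max_idPr _) ?subr_le0// (min_idPl _).
by rewrite integral0.
Qed.

(* Countably many null rational intervals cover the complement of the
   support. *)
Lemma ledge_ge nu (a : R) : (a%:E <= ledge nu)%E <-> nu `]-oo, a[%classic = 0%E.
Proof.
split=> [h|h]; last first.
  apply: le_ereal_inf_tmp => _ [x sx <-]; rewrite lee_fin leNgt; apply/negP => xa.
  have : (0 < nu `]-oo, a[%classic)%E.
    by apply: sx; [exact: interval_open|rewrite /= in_itv].
  by rewrite h ltxx.
pose G (p q : rat) : set (measurableTypeR R) :=
  if nu `]ratr p, ratr q[%classic == 0%E then `]ratr p, ratr q[%classic else set0.
pose F n := if (unpickle n : option (rat * rat)) is Some z then G z.1 z.2 else set0.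
apply: measure_negligible; first exact: measurable_itv.
apply: (@negligibleS _ _ _ nu (\bigcup_n F n)); last first.
  apply: negligible_bigcup => n; rewrite /F; case: unpickle => [z|]; last exact: negligible_set0.
  rewrite /G; case: eqP => [z0|_]; last exact: negligible_set0.
  by exists `]ratr z.1, ratr z.2[%classic; split.
move=> x /=; rewrite in_itv/= => xa.
have : ~ msupport nu x.
  move=> sx; have : (ledge nu <= x%:E)%E by apply: ereal_inf_lbound; exists x.
  by move=> /(le_trans h); rewrite lee_fin leNgt xa.
move=> /existsNP[U /not_implyP[oU /not_implyP[Ux nU]]].
have [e /= e0 eU] : exists2 e : R, 0 < e & ball x e `<=` U.
  by have /nbhs_ballP[e e0 eU] := open_nbhs_nbhs (conj oU Ux); exists e.
have xe1 : x - e < x by rewrite ltrBlDr ltrDl.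
have xe2 : x < x + e by rewrite ltrDl.
have [p] := rat_in_itvoo xe1; rewrite in_itv/= => /andP[p1 p2].
have [q] := rat_in_itvoo xe2; rewrite in_itv/= => /andP[q1 q2].
suff pq0 : nu `](ratr p : R), ratr q[%classic = 0%E.
  exists (pickle (p, q)); first exact: Logic.I.
  suff Gx : G p q x by rewrite /F pickleK; exact: Gx.
  by rewrite /G pq0 eqxx /= in_itv/= p2.
apply/eqP; rewrite eq_le measure_ge0 andbT leNgt; apply/negP => pos; apply: nU.
apply: lt_le_trans pos _; apply: le_measure; rewrite ?inE.
- exact: measurable_itv.
- exact: open_measurable.
- move=> y /=; rewrite in_itv/= => /andP[y1 y2]; apply: eU; rewrite /ball/=.
  by rewrite ltr_norml; apply/andP; split; lra.
Qed.

End left_mass.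

Section sequential_continuity.
Context {R : realType} {p q : nat}.

(** Dominated convergence speaks of sequences; this carries its conclusion back to neighbourhoods in
    the parameter space. *)
Lemma seq_continuous (g : 'M[R]_(p, q) -> R) x :
  (forall s : nat -> 'M[R]_(p, q), s @ \oo --> x -> (fun n => g (s n)) @ \oo --> g x) ->
  {for x, continuous g}.
Proof.
move=> h; apply: (@cvgrPdist_lt _ _ _ _ (nbhs_filter x) _ _).2 => e e0.
apply: contrapT => hn.
have pick (n : nat) : exists y, ball x n.+1%:R^-1 y /\ ~ (`|g x - g y| < e).
  apply: contrapT => /forallNP hy; apply: hn; apply/nbhs_ballP.
  exists n.+1%:R^-1; rewrite /= ?invr_gt0 ?ltr0n// => y bxy.
  by apply: contrapT => hh; apply: (hy y).
pose s n := sval (cid (pick n)).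
have sP n : ball x n.+1%:R^-1 (s n) /\ ~ (`|g x - g (s n)| < e) := svalP (cid (pick n)).
have sx : s @ \oo --> x.
  apply/cvg_ballP => r r0; near=> n.
  apply: le_ball (sP n).1.
  near: n; exists (Num.bound r^-1) => // n /= rn.
  rewrite -[leRHS]invrK lef_pV2 ?posrE ?invr_gt0 ?ltr0n//.
  have := @archi_boundP R r^-1; rewrite invr_ge0 (ltW r0) => /(_ isT) /ltW h'.
  by apply: le_trans h' _; rewrite ler_nat (leq_trans rn).
have /cvgrPdist_lt/(_ e e0)[n _ hn'] := h s sx.
by have [_] := sP n; apply; exact: (hn' n (leqnn n)).
Unshelve. all: by end_near. Qed.

End sequential_continuity.

Section eballs.
Context {R : realType} {m : nat}.

Definition cball (r : R) : set 'rV[R]_m := [set u | enorm u <= r].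

Lemma enorm_coord (u : 'rV[R]_m) i : `|u ord0 i| <= enorm u.
Proof.
rewrite -sqrtr_sqr /enorm ler_wsqrtr// (bigD1 i)//= lerDl.
by apply: sumr_ge0 => j _; exact: sqr_ge0.
Qed.

Lemma closed_cball r : closed (cball r).
Proof.
have -> : cball r = @enorm R m @^-1` [set x | x <= r] by [].
by apply: closed_comp => [u _|]; [exact: continuous_enorm|exact: closed_le].
Qed.

Lemma compact_cball r : compact (cball r).
Proof.
apply: (subclosed_compact (@closed_cball r)).
  apply: (@rV_compact R m (fun=> `[- r, r]%classic)) => _; exact: segment_compact.
move=> u ur i; rewrite /= in_itv/= -ler_norml.
exact: le_trans (enorm_coord u i) ur.
Qed.

Lemma open_eball r : open (@eball R m r).
Proof.
have -> : @eball R m r = @enorm R m @^-1` [set x | x < r] by [].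
by apply: open_comp => [u _|]; [exact: continuous_enorm|exact: open_lt].
Qed.

Lemma eball_cball r : @eball R m r `<=` cball r.
Proof. by move=> u /ltW. Qed.

Lemma cball_nbhs r (u : 'rV[R]_m) : enorm u < r -> nbhs u (cball r).
Proof.
move=> ur; apply: filterS (@eball_cball r) _.
by apply: open_nbhs_nbhs; split => //; exact: open_eball.
Qed.

End eballs.

Section parameter.
Context {R : realType} {m : nat} {d : nat -> measure_display}
  {Om : forall N, measurableType (d N)} (P : forall N, probability (Om N) R)
  (H : forall N, 'rV[R]_m -> {RV (P N) >-> 'M[R]_N})
  (muoo : 'rV[R]_m -> probability (measurableTypeR R) R).
Hypothesis H_sym : forall N u w, sym_mx (H N u w).
Hypothesis H_cont : forall N, {ae P N, forall w, forall i j,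
  continuous (fun u => H N u w i j)}.

Lemma continuous_mx_entries (T : topologicalType) (p q : nat) (F : T -> 'M[R]_(p, q)) :
  (forall i j, continuous (fun t => F t i j)) -> continuous F.
Proof.
move=> cF t; apply/cvg_ballP => e e0.
suff : \forall s \near t, forall ij : 'I_p * 'I_q, `|F t ij.1 ij.2 - F s ij.1 ij.2| < e.
  by apply: filterS => s hs; apply/mx_ballP => // i j; exact: (hs (i, j)).
apply: (@filter_forall _ _ _ (nbhs t)) => -[i j].
exact: ((@cvgrPdist_lt _ _ _ _ (nbhs_filter t) _ _).1 (cF i j t) e e0).
Qed.

(** Paths of [H] are continuous almost surely and Weyl's inequality makes the statistic continuous
    in the matrix; boundedness of [f] gives the domination. *)
Lemma mean_continuous N (f : R -> R) (b c : R) :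
  (forall x y, `|f x - f y| <= c * `|x - y|) -> (forall x, `|f x| <= b) ->
  (forall x, 0 <= f x) ->
  continuous (fun u => \int[P N]_w (N%:R^-1 * tr_fun f (H N u w))).
Proof.
move=> f_lip f_bdd f0 u0; apply: seq_continuous => s su.
have mf := lip_measurable f_lip.
pose g u w := N%:R^-1 * tr_fun f (H N u w).
have mg u : measurable_fun setT (g u).
  apply: measurable_funM => //.
  exact: (measurable_tr_fun (measurable_funPT (H N u)) (@H_sym N u) mf).
have gb u w : `|g u w| <= b.
  have /andP[h1 h2] := tr_fun_bounded f_bdd f0 (@H_sym N u w).
  by rewrite ger0_norm.
have mfs n : measurable_fun setT (fun w => (g (s n) w)%:E) by exact/measurable_EFinP.
have mf0 : measurable_fun setT (fun w => (g u0 w)%:E) by exact/measurable_EFinP.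
have cvg_ae : {ae P N, forall w, setT w -> (fun n => (g (s n) w)%:E) @ \oo --> (g u0 w)%:E}.
  have := H_cont N; apply: filterS => w cw _.
  apply: cvg_EFin; first by apply: nearW.
  have cH : continuous (fun u => H N u w) by apply: continuous_mx_entries => i j; exact: cw.
  have E u : g u w = N%:R^-1 * \sum_(i < N) f (ev (symz (H N u w)) i).
    by rewrite /g (symz_id (@H_sym N u w)) tr_funE//; exact: H_sym.
  rewrite E; under eq_fun do rewrite E.
  apply: cvgM; first exact: cvg_cst.
  pose S (T : 'M[R]_N) := \sum_(i < N) f (ev (symz T) i).
  suff cS : {for u0, continuous (fun u => S (H N u w))} by exact: (cvg_comp s _ su cS).
  apply: (@continuous_comp _ _ _ (fun u => (H N u w : 'M[R]_N)) S); first exact: cH.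
  exact: (continuous_sum_ev (lip_continuous f_lip)).
have ib : (P N).-integrable setT (cst b%:E) by exact: finite_measure_integrable_cst.
have gbe : {ae P N, forall w n, setT w -> (`|(g (s n) w)%:E| <= cst b%:E w)%E}.
  by apply: aeW => w n _; rewrite lee_fin.
have [_ _ h] := dominated_convergence measurableT mfs mf0 cvg_ae ib gbe.
have E u : (\int[P N]_w (g u w)%:E = (\int[P N]_w g u w)%:E)%E.
  exact: (bounded_RintegralE (P N) (mg u) (gb u)).
rewrite E in h; exact: (fine_cvg h).
Qed.

(** A locally uniform limit of continuous functions: a single large [N] approximates within [e / 3]
    on all of [Q]. *)
Lemma spectral_control_continuous (Q : set 'rV[R]_m) (K : R) (f : R -> R) (b c : R) u0 :
  spectral_control H muoo Q K -> nbhs u0 Q ->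
  (forall x y, `|f x - f y| <= c * `|x - y|) -> (forall x, `|f x| <= b) -> 0 <= c ->
  0 < b + c -> (forall x, 0 <= f x) ->
  {for u0, continuous (fun u => \int[muoo u]_x f x)}.
Proof.
move=> [_ sc] nQ f_lip f_bdd c0 bc f0.
apply: (@cvgrPdist_le _ _ _ _ (nbhs_filter u0) _ _).2 => e e0.
have e30 : 0 < e / 3 by rewrite divr_gt0.
have [N _ hN] := sc f b c f_lip f_bdd c0 bc f0 _ e30.
have {}hN := hN N (leqnn N).
have cE := ((@cvgrPdist_le _ _ _ _ (nbhs_filter u0) _ _).1 (@mean_continuous N f b c f_lip f_bdd f0 u0) _ e30).
have Q0 : Q u0 by exact: nbhs_singleton.
near=> u.
have Qu : Q u by near: u.
have h : `|\int[P N]_w (N%:R^-1 * tr_fun f (H N u0 w)) - \int[P N]_w (N%:R^-1 * tr_fun f (H N u w))| <= e / 3.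
  by near: u.
have /ler_normlP[a1 a2] := h; have /ler_normlP[b1 b2] := hN u Qu.
have /ler_normlP[c1 c2] := hN u0 Q0.
move: a1 a2 b1 b2 c1 c2.
move: (\int[P N]_w (N%:R^-1 * tr_fun f (H N u0 w))) (\int[P N]_w (N%:R^-1 * tr_fun f (H N u w))) => x y.
move: (\int[muoo u]_x f x) (\int[muoo u0]_x f x) => z t.
by move=> *; apply/ler_normlP; split; lra.
Unshelve. all: by end_near. Qed.

Hypothesis ctl : forall r : R, 0 < r -> exists K k : R, [/\ 1 <= K, 0 < k,
  spectral_control H muoo (cball r) K, determinant_control H muoo (cball r) K &
  forall u, cball r u -> density_near0 (muoo u) `[- k, k]%classic k].

Lemma enorm_ge0 (u : 'rV[R]_m) : 0 <= enorm u. Proof. exact: sqrtr_ge0. Qed.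

Lemma continuous_left_mass a : continuous (fun u => left_mass (muoo u) a).
Proof.
move=> u0; have r0 : 0 < enorm u0 + 1 by rewrite ltr_wpDl ?enorm_ge0.
have [K [k [K1 k0 sc _ _]]] := ctl r0.
apply: (spectral_control_continuous sc _ (ramp_lip a) (ramp_bdd a)) => //.
- by apply: cball_nbhs; rewrite ltrDl.
- exact: ramp_ge0.
Qed.

Lemma closed_goodset_eps eps : closed (goodset_eps muoo eps).
Proof.
have -> : goodset_eps muoo eps = (fun u => left_mass (muoo u) (2 * eps)) @^-1` [set 0].
  apply/seteqP; split => u /=.
    by move/ledge_ge/left_mass_eq0.
  by move=> h; apply/ledge_ge/left_mass_eq0.
by apply: closed_comp => [u _|]; [exact: continuous_left_mass|exact: closed_eq].
Qed.

Definition logpot (u : 'rV[R]_m) : R := fine (\int[muoo u]_x lne (`|x|%R)%:E)%E.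

Lemma logpot_approx (r e : R) : 0 < r -> 0 < e -> exists K eta : R,
  [/\ 1 <= K, 0 < eta <= 1, spectral_control H muoo (cball r) K,
    determinant_control H muoo (cball r) K &
    forall u, cball r u -> (\int[muoo u]_x lne (`|x|%R)%:E = (logpot u)%:E)%E /\
      forall h, 0 < h <= eta -> logpot u <= \int[muoo u]_x clampln h K x <= logpot u + e].
Proof.
move=> r0 e0; have [K [k [K1 k0 sc dc dens]]] := ctl r0.
have [eta heta hlog] := log_potential k0 K1 e0.
exists K, eta; split => // u ru.
have [V EV hV] := hlog (muoo u) (dens u ru) (sc.1 u ru).
have -> : logpot u = V by rewrite /logpot EV.
by split.
Qed.

Lemma logpot_EFin u : (\int[muoo u]_x lne (`|x|%R)%:E = (logpot u)%:E)%E.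
Proof.
have r0 : 0 < enorm u + 1 by rewrite ltr_wpDl ?enorm_ge0.
have [K [eta [_ _ _ _ /(_ u)[]]]] := logpot_approx r0 ltr01 => //.
by rewrite /cball/= lerDl.
Qed.

Lemma clampln_continuous r K eta u0 : spectral_control H muoo (cball r) K ->
  enorm u0 < r -> 0 < eta -> eta <= 1 -> 1 <= K ->
  {for u0, continuous (fun u => \int[muoo u]_x clampln eta K x)}.
Proof.
(* The shift by [ln eta] supplies the nonnegativity asked of test functions. *)
move=> sc ur eta0 eta1 K1; pose f x := clampln eta K x - ln eta.
have f0 x : 0 <= f x by rewrite subr_ge0 clampln_ge.
have fb x : `|f x| <= ln K - ln eta by rewrite ger0_norm// lerD2r clampln_le.
have fl x y : `|f x - f y| <= eta^-1 * `|x - y|.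
  by rewrite /f opprB addrA subrK; exact: clampln_lip.
have ie : 0 < eta^-1 by rewrite invr_gt0.
have bc : 0 < ln K - ln eta + eta^-1.
  have h1 := ln_le0 eta1; have h2 := ln_ge0 K1; lra.
have hc := spectral_control_continuous sc (cball_nbhs ur) fl fb (ltW ie) bc f0.
have -> : (fun u => \int[muoo u]_x clampln eta K x) = (fun u => \int[muoo u]_x f x + ln eta).
  apply/funext => u; rewrite /f (Rintegral_prob_shift (muoo u) _ (measurable_clampln eta0 eta1 K1)
    (clampln_bdd eta0 eta1 K1)).
  by rewrite subrK.
apply: (@cvgD _ _ _ _ (nbhs_filter u0)); [exact: hc|exact: cvg_cst].
Qed.

Lemma continuous_logpot : continuous logpot.
Proof.
move=> u0; have r0 : 0 < enorm u0 + 1 by rewrite ltr_wpDl ?enorm_ge0.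
apply: (@cvgrPdist_le _ _ _ _ (nbhs_filter u0) _ _).2 => e e0.
have e30 : 0 < e / 3 by rewrite divr_gt0.
have [K [eta [K1 /andP[eta0 eta1] sc _ hV]]] := logpot_approx r0 e30.
have ur : enorm u0 < enorm u0 + 1 by rewrite ltrDl.
have hc := (@cvgrPdist_le _ _ _ _ (nbhs_filter u0) _ _).1 (clampln_continuous sc ur eta0 eta1 K1) _ e30.
have nQ := cball_nbhs ur.
have ee : 0 < eta <= eta by rewrite eta0 lexx.
near=> u.
have Qu : cball (enorm u0 + 1) u by near: u.
have h : `|\int[muoo u0]_x clampln eta K x - \int[muoo u]_x clampln eta K x| <= e / 3.
  by near: u.
have /ler_normlP[a1 a2] := h.
have /andP[b1 b2] := (hV u Qu).2 eta ee.
have /andP[c1 c2] := (hV u0 (ltW ur)).2 eta ee.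
move: a1 a2 b1 b2 c1 c2; move: (logpot u) (logpot u0) (\int[muoo u]_x _) (\int[muoo u0]_x _) => x y z t.
by move=> *; apply/ler_normlP; split; lra.
Unshelve. all: by end_near. Qed.

End parameter.

(** * Lebesgue measure on row vectors *)

Section affine_null_sets.
Context {R : realType}.

(** By uniqueness of Lebesgue measure, [a] times its push-forward under the affine map is Lebesgue
    measure again, as half-open intervals show. *)
Lemma affine_null1 (A : set (measurableTypeR R)) (a b : R) : 0 < a -> measurable A ->
  lebesgue_measure A = 0%E ->
  lebesgue_measure ((fun x : measurableTypeR R => a * x + b) @^-1` A) = 0%E.
Proof.
move=> a0 mA A0; pose phi (x : measurableTypeR R) : measurableTypeR R := a * x + b.
have mphi : measurable_fun setT phi.
  by apply: measurable_funD => //; exact: measurable_funM.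
have h X : measurable X -> lebesgue_measure X =
    mscale (NngNum (ltW a0)) (pushforward (@lebesgue_measure R) phi) X.
  move: X; apply: lebesgue_measure_unique => _ [[s t]] _ <-.
  transitivity (a%:E * lebesgue_measure (phi @^-1` `]s, t]%classic))%E; last by [].
  have -> : phi @^-1` `]s, t]%classic = `](s - b) / a, (t - b) / a]%classic.
    apply/seteqP; split => x /=; rewrite !in_itv/= /phi.
      by rewrite ltr_pdivrMr// ler_pdivlMr// ltrBlDr lerBrDr mulrC.
    by rewrite ltr_pdivrMr// ler_pdivlMr// ltrBlDr lerBrDr mulrC.
  rewrite !lebesgue_measure_itv/= !lte_fin ltr_pM2r ?invr_gt0// ltrD2r.
  case: ifPn => st; last by rewrite mule0.
  by rewrite -!EFinB -EFinM; congr EFin; field; rewrite gt_eqF.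
have := h mphi A mA; rewrite A0 /mscale/= /pushforward => /esym/eqP.
by rewrite mule_eq0 eqe gt_eqF//= => /eqP.
Qed.

Lemma affine_rV_cons m (a : R) (b : 'rV[R]_m.+1) (x : R) (v : 'rV[R]_m) :
  a *: rV_cons (x : measurableTypeR R, v) + b =
  rV_cons ((a * x + b ord0 ord0 : R) : measurableTypeR R, a *: v + rsubmx (b : 'rV_(1 + m))).
Proof.
apply/rowP => i; rewrite /rV_cons !mxE.
case: (splitP (i : 'I_(1 + m))) => j ij.
  rewrite !mxE; congr (_ + b _ _); apply: val_inj; rewrite /= ij.
  by case: j {ij} => -[].
by rewrite !mxE; congr (_ + b _ _); apply: val_inj.
Qed.

Lemma measurable_affine m (a : R) (b : 'rV[R]_m) :
  measurable_fun setT (fun v : 'rV[R]_m => a *: v + b).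
Proof.
apply: measurable_fun_mx => i j; under eq_fun do rewrite !mxE.
apply: measurable_funD => //; apply: measurable_funM => //.
exact: measurable_entry.
Qed.

(** Working with null sets avoids tracking the power of [a]: almost every section of [A] is null,
    the exceptional set stays null under the affine map of the first coordinate, and the sections
    are handled by induction. *)
Lemma leb_affine_null m (a : R) (b : 'rV[R]_m) (A : set 'rV[R]_m) : 0 < a ->
  measurable A -> leb m A = 0%E -> leb m ((fun v => a *: v + b) @^-1` A) = 0%E.
Proof.
move=> a0; elim: m => [|m IH] in b A *.
  suff -> : (fun v : 'rV[R]_0 => a *: v + b) @^-1` A = A by [].
  by apply/seteqP; split => v; rewrite /preimage/= (thinmx0 (a *: v + b)) (thinmx0 v).
move=> mA.
have mcons (S : set 'rV[R]_m.+1) : measurable S -> measurable (@rV_cons R m @^-1` S).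
  by move=> mS; rewrite -[X in measurable X]setTI; exact: measurable_rV_cons.
have lebE (S : set 'rV[R]_m.+1) : leb m.+1 S =
  (\int[lebesgue_measure]_x leb m (xsection (@rV_cons R m @^-1` S) x))%E by [].
pose S' := (fun v : 'rV[R]_m.+1 => a *: v + b) @^-1` A.
have mS' : measurable S'.
  by rewrite -[X in measurable X]setTI; exact: measurable_affine.
have msec (S : set 'rV[R]_m.+1) : measurable S ->
  measurable_fun setT (fun x => leb m (xsection (@rV_cons R m @^-1` S) x)).
  by move=> mS; apply: measurable_fun_xsection; exact: mcons.
rewrite lebE => A0.
have : (\int[lebesgue_measure]_x `|leb m (xsection (@rV_cons R m @^-1` A) x)| = 0)%E.
  by rewrite -[RHS]A0; apply: eq_integral => x _; rewrite gee0_abs.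
move=> /(ae_eq_integral_abs _ measurableT (msec A mA))[N [mN N0 hN]].
rewrite lebE -/S'.
have -> : (\int[lebesgue_measure]_x leb m (xsection (@rV_cons R m @^-1` S') x) =
  \int[lebesgue_measure]_(x in [set: measurableTypeR R]) cst 0%E x)%E.
  apply: ae_eq_integral => //; first exact: msec.
  exists ((fun x : measurableTypeR R => a * x + b ord0 ord0) @^-1` N); split.
  - rewrite -[X in measurable X]setTI; apply: (_ : measurable_fun setT _) => //.
    by apply: measurable_funD => //; exact: measurable_funM.
  - exact: affine_null1.
  move=> x hx; apply: hN => h; apply: hx => _ /=.
  have -> : xsection (@rV_cons R m @^-1` S') x =
      (fun v => a *: v + rsubmx (b : 'rV_(1 + m))) @^-1`
      xsection (@rV_cons R m @^-1` A) (a * x + b ord0 ord0).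
    by apply/seteqP; split => v; rewrite /xsection/= !inE /S'/= affine_rV_cons.
  apply: IH; last exact: h.
  by apply: measurable_xsection; exact: mcons.
by rewrite integral0.
Qed.

Lemma sqr_enorm_rV_cons m (z : measurableTypeR R * 'rV[R]_m) :
  enorm (rV_cons z) ^+ 2 = z.1 ^+ 2 + enorm z.2 ^+ 2.
Proof.
rewrite /enorm !sqr_sqrtr; last 2 first.
- by apply: sumr_ge0 => i _; exact: sqr_ge0.
- by apply: sumr_ge0 => i _; exact: sqr_ge0.
have -> : \sum_i rV_cons z ord0 i ^+ 2 =
    \sum_(i < 1 + m) (row_mx (const_mx z.1 : 'rV[R]_1) z.2) ord0 i ^+ 2 by [].
rewrite big_split_ord/= big_ord1 row_mxEl mxE; congr (_ + _).
by apply: eq_bigr => i _; rewrite row_mxEr.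
Qed.

Lemma measurable_gauss_rV m : measurable_fun setT (fun u : 'rV[R]_m => expR (- enorm u ^+ 2)).
Proof.
apply: measurable_mx_continuous => u.
apply: (@continuous_comp _ _ _ (fun u : 'rV[R]_m => - enorm u ^+ 2) expR); last exact: continuous_expR.
apply: (@cvgN _ _ _ _ (nbhs_filter u)); rewrite expr2.
by apply: (@cvgM _ _ _ (nbhs_filter u)); exact: continuous_enorm.
Qed.

(** Serves twice: the Gaussian dominates the integrand far away, uniformly in [N], and being bounded
    below on balls it shows that they have finite volume. *)
Lemma leb_gauss m : (\int[@leb R m]_u (expR (- enorm u ^+ 2))%:E < +oo :> \bar R)%E.
Proof.
elim: m => [|m IH].
  apply: (@le_lt_trans _ _ (\int[@leb R 0]_(u in setT) (1%:E : \bar R))%E).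
    apply: le_integral_raw => u _; rewrite lee_fin ?expR_ge0//.
    by rewrite -expR0 ler_expR oppr_le0 sqr_ge0.
  by rewrite integral_cst//= mul1e diracE ltry.
have mE : measurable_fun setT (fun u : 'rV[R]_m.+1 => (expR (- enorm u ^+ 2))%:E).
  by apply/measurable_EFinP; exact: measurable_gauss_rV.
have -> : (\int[@leb R m.+1]_u (expR (- enorm u ^+ 2))%:E =
  \int[(lebesgue_measure \x leb m)%E]_z (expR (- enorm (rV_cons z) ^+ 2))%:E)%E.
  have h := @ge0_integral_pushforward _ _ _ _ R (@rV_cons R m) (@measurable_rV_cons R m)
    (lebesgue_measure \x leb m)%E setT (fun u => (expR (- enorm u ^+ 2))%:E) measurableT mE.
  rewrite preimage_setT in h; apply: h.
  by move=> u _; rewrite lee_fin expR_ge0.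
rewrite fubini_tonelli1//=; last exact: (measurableT_comp mE (@measurable_rV_cons R m)).
rewrite /fubini_F.
have hI : (\int[@leb R m]_u (expR (- enorm u ^+ 2))%:E)%E \is a fin_num.
  by rewrite ge0_fin_numE// integral_ge0// => u _; rewrite lee_fin expR_ge0.
have [c [c0 Ec]] : exists c : R, 0 <= c /\
    (\int[@leb R m]_u (expR (- enorm u ^+ 2))%:E)%E = c%:E.
  exists (fine (\int[@leb R m]_u (expR (- enorm u ^+ 2))%:E)%E); rewrite fineK//; split => //.
  by rewrite fine_ge0// integral_ge0// => u _; rewrite lee_fin expR_ge0.
have inner (x : measurableTypeR R) : (\int[@leb R m]_y (expR (- enorm (rV_cons (x, y)) ^+ 2))%:E =
    (c * gauss_fun x)%:E)%E.
  transitivity (\int[@leb R m]_y (expR (- x ^+ 2) * expR (- enorm y ^+ 2))%:E)%E.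
    by apply: eq_integral => y _; rewrite sqr_enorm_rV_cons/= opprD expRD.
  rewrite ge0_integral_EFinZ ?expR_ge0//; last exact: measurable_gauss_rV.
  by rewrite Ec -EFinM mulrC.
under eq_integral do rewrite inner.
have E := @ge0_integral_EFinZ R _ (measurableTypeR R) lebesgue_measure _ c
  (@measurable_gauss_fun R) (@gauss_fun_ge0 R) c0.
apply: (@le_lt_trans _ _ (c%:E * \int[@lebesgue_measure R]_x (gauss_fun x)%:E)%E).
  by rewrite -E.
apply: lte_mul_pinfty => //.
have /integrableP[_] := @integrableT_gauss R.
apply: le_lt_trans; apply: le_integral_raw => x _; first by rewrite lee_fin gauss_fun_ge0.
by rewrite /= ger0_norm ?gauss_fun_ge0.
Qed.

End affine_null_sets.

(** * Volume of balls and of convex sets near their points *)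

Section positive_mass.
Context {R : realType} {m : nat}.

Lemma closed_measurable_rV (A : set 'rV[R]_m) : closed A -> measurable A.
Proof. by move=> cA; rewrite -[A]setCK; apply: measurableC; apply: measurable_mx_open; exact: closed_openC. Qed.

Lemma mul_EFin_lty (c : R) (x y : \bar R) :
  0 < c -> (c%:E * x <= y)%E -> (y < +oo)%E -> (x < +oo)%E.
Proof.
case: x => [x| |] c0 h hy //; first by rewrite ltry.
by move: (le_lt_trans h hy); rewrite gt0_muley ?lte_fin.
Qed.

Lemma leb_cball_lty (r : R) : (leb m (cball r) < +oo)%E.
Proof.
have mB : measurable (@cball R m r) by apply: closed_measurable_rV; exact: closed_cball.
have := @integral_ge0_lb _ _ _ (leb m) setT (cball r)
  (fun u => (expR (- enorm u ^+ 2))%:E) (expR (- r ^+ 2)) mB (@subsetT _ _) (expR_ge0 _).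
have h0 : forall u : 'rV[R]_m, setT u -> (0 <= (expR (- enorm u ^+ 2))%:E)%E.
  by move=> u _; rewrite lee_fin expR_ge0.
have hb : forall u : 'rV[R]_m, cball r u ->
    ((expR (- r ^+ 2))%:E <= (expR (- enorm u ^+ 2))%:E)%E.
  move=> u ur; rewrite lee_fin ler_expR lerN2.
  have r0 : 0 <= r by apply: le_trans (enorm_ge0 u) ur.
  by rewrite ler_sqr ?nnegrE ?enorm_ge0.
move=> /(_ h0 hb) h; exact: (mul_EFin_lty (expR_gt0 _) h (leb_gauss m)).
Qed.

Lemma convex_set_comb (A : set 'rV[R]_m) (x y : 'rV[R]_m) (t : R) : convex_set A ->
  A x -> A y -> 0 <= t <= 1 -> A (t *: x + (1 - t) *: y).
Proof.
move=> cA Ax Ay t01; have /andP[t0 t1] := t01.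
pose l : {i01 R} := Itv01 t0 t1.
exact: (set_mem (cA x y l (mem_set Ax) (mem_set Ay))).
Qed.

Lemma enormB (v w : 'rV[R]_m) : enorm (v - w) <= enorm v + enorm w.
Proof.
have a0 := enorm_ge0 v; have b0 := enorm_ge0 w.
have sq (z : 'rV[R]_m) : enorm z ^+ 2 = \sum_i z ord0 i ^+ 2.
  by rewrite /enorm sqr_sqrtr// sumr_ge0// => i _; exact: sqr_ge0.
rewrite -ler_sqr ?nnegrE ?enorm_ge0 ?addr_ge0// sq.
have cs := cauchy_schwarz_sum (fun i => v ord0 i) (fun i => w ord0 i).
rewrite -!sq in cs; set S := \sum_i v ord0 i * w ord0 i in cs.
have -> : \sum_i (v - w) ord0 i ^+ 2 = enorm v ^+ 2 + enorm w ^+ 2 - 2 * S.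
  rewrite !sq /S mulr_sumr -big_split -sumrB/=; apply: eq_bigr => i _.
  by rewrite !mxE; ring.
have : - S <= enorm v * enorm w.
  rewrite -exprMn in cs; apply: le_trans (ler_norm _) _; rewrite normrN.
  by rewrite -ler_sqr ?nnegrE ?mulr_ge0// real_normK ?num_real.
by rewrite sqrrD; move: (enorm v ^+ 2) (enorm w ^+ 2) (enorm v * enorm w) => x y z; lra.
Qed.

(* The homothety of centre [u0] and small ratio maps [B] into [A] near [u0]. *)
Lemma convex_mass_near (A B : set 'rV[R]_m) (u0 : 'rV[R]_m) (e : R) :
  convex_set A -> measurable A -> measurable B -> B `<=` A -> (0 < leb m B)%E -> A u0 -> 0 < e ->
  (0 < leb m (A `&` [set u | (enorm (u - u0) <= e)%R]))%E.
Proof.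
move=> cA mA mB BA B0 Au0 e0.
have mcB r : measurable (@cball R m r) by apply: closed_measurable_rV; exact: closed_cball.
(* Passing to a bounded part of [B] lets one ratio [t] bring all its points within [e] of [u0]. *)
have [n hn] : exists n : nat, (0 < leb m (B `&` cball n%:R))%E.
  apply: contrapT => /forallNP h; move: B0; apply/negP; rewrite -leNgt.
  rewrite (_ : leb m B = 0%E)//; apply: measure_negligible => //.
  apply: (@negligibleS _ _ _ (leb m) (\bigcup_n (B `&` cball n%:R))).
    move=> u Bu; exists (Num.bound (enorm u)) => //; split => //.
    by apply/ltW/archi_boundP; exact: enorm_ge0.
  apply: negligible_bigcup => n; exists (B `&` cball n%:R); split => //.
    exact: measurableI.
  by apply/eqP; rewrite eq_le measure_ge0 andbT leNgt; apply/negP/h.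
pose r : R := n%:R + enorm u0 + 1.
have r0 : 0 < r by rewrite ltr_wpDl// addr_ge0// enorm_ge0.
pose t := Num.min 1 (e / r).
have t0 : 0 < t by rewrite lt_min ltr01 divr_gt0.
have t1 : t <= 1 by rewrite ge_min lexx.
have mC : measurable (A `&` [set u | (enorm (u - u0) <= e)%R]).
  apply: measurableI => //.
  have -> : [set u | (enorm (u - u0) <= e)%R] = (fun u => 1 *: u + - u0) @^-1` cball e.
    by apply/seteqP; split => u; rewrite /cball/= scale1r.
  rewrite -[X in measurable X]setTI; exact: measurable_affine.
rewrite lt_neqAle measure_ge0 andbT; apply/eqP => /esym C0.
have := leb_affine_null ((1 - t) *: u0) t0 mC C0.
set S := (X in leb m X = _) => S0; move: hn; apply/negP; rewrite -leNgt -S0.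
have mS : measurable S by rewrite -[X in measurable X]setTI; exact: measurable_affine.
apply: le_measure; rewrite ?inE//; first exact: measurableI.
move=> v [Bv vn]; split.
  by apply: convex_set_comb => //; [exact: BA|rewrite (ltW t0)].
rewrite /mkset (_ : _ - _ = t *: (v - u0)); last by apply/rowP => i; rewrite !mxE; ring.
have tn (w : 'rV[R]_m) : enorm (t *: w) = t * enorm w.
  rewrite /enorm -[t in RHS]ger0_norm ?ltW// -sqrtr_sqr -sqrtrM ?sqr_ge0//.
  by congr Num.sqrt; rewrite mulr_sumr; apply: eq_bigr => i _; rewrite mxE exprMn.
have vr : enorm (v - u0) <= r.
  apply: le_trans (enormB v u0) _; rewrite /r -addrA; apply: lerD => //.
  by rewrite lerDl.
rewrite tn; apply: le_trans (ler_wpM2l (ltW t0) vr) _.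
by rewrite -ler_pdivlMr// ge_min lexx orbT.
Qed.

End positive_mass.

(** * Laplace's method *)

Section laplace_method.
Context {R : realType} {m : nat} {D : set 'rV[R]_m} {d : nat -> measure_display}
  {Om : forall N, measurableType (d N)} (P : forall N, probability (Om N) R)
  (H : forall N, 'rV[R]_m -> {RV (P N) >-> 'M[R]_N})
  (muoo : 'rV[R]_m -> probability (measurableTypeR R) R).
Hypothesis H_sym : forall N u w, sym_mx (H N u w).
Hypothesis H_cont : forall N, {ae P N, forall w, forall i j,
  continuous (fun u => H N u w i j)}.
Hypothesis ctl : forall r : R, 0 < r -> exists K k : R, [/\ 1 <= K, 0 < k,
  spectral_control H muoo (cball r) K, determinant_control H muoo (cball r) K &
  forall u, cball r u -> density_near0 (muoo u) `[- k, k]%classic k].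
Hypothesis H_conc : superexp_concentration H muoo.
Variables (alpha p : R).
Hypothesis alpha_gt0 : 0 < alpha.

Definition psd_det N (u : 'rV[R]_m) (w : Om N) : R :=
  `|\det (H N u w)| * \1_[set w | psd (H N u w)] w.

Definition weighted_det N (u : 'rV[R]_m) : \bar R :=
  ((expR (- ((N%:R + p) * alpha * enorm u ^+ 2)))%:E * 'E_(P N)[psd_det (N := N) u])%E.

Definition rate (u : 'rV[R]_m) : R := logpot muoo u - alpha * enorm u ^+ 2.

Lemma continuous_rate : continuous rate.
Proof.
move=> u; apply: (@cvgB _ _ _ _ (nbhs_filter u)).
  exact: (continuous_logpot H_sym H_cont ctl).
apply: (@cvgM _ _ _ (nbhs_filter u)); first exact: cvg_cst.
by rewrite expr2; apply: (@cvgM _ _ _ (nbhs_filter u)); exact: continuous_enorm.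
Qed.

Lemma psd_det_ge0 N u w : 0 <= psd_det (N := N) u w.
Proof. by rewrite /psd_det mulr_ge0// indicE. Qed.

Lemma weighted_det_ge0 N u : (0 <= weighted_det N u)%E.
Proof.
apply: mule_ge0; first by rewrite lee_fin expR_ge0.
rewrite unlock; apply: integral_ge0 => w _; rewrite lee_fin; exact: psd_det_ge0.
Qed.

Lemma near_conc (r e1 B : R) : 0 < r -> 0 < e1 -> \forall N \near \oo, forall u, eball r u ->
  pr (P N) [set w | (e1%:E < dBL (esd (H N u w)) (muoo u))%E] <= expR (- B * (N%:R * ln N%:R)).
Proof.
move=> r0 e10; have [N1 hN1] := superexp_le (H_conc r0 e10) B.
exists N1 => // N /= NN1 u ru; apply: pr_le_EFin.
  exact: (measurable_dBL_gt (measurable_funPT (H N u)) (@H_sym N u)).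
by apply: le_trans (hN1 N NN1); apply: ereal_sup_ubound; exists u.
Qed.

Definition spectrum_within N (u : 'rV[R]_m) (eps : R) : set (Om N) :=
  [set w | forall x, eigenvalue (H N u w) x ->
     (ledge (muoo u) - eps%:E <= x%:E <= redge (muoo u) + eps%:E)%E].

Lemma measurable_spectrum_within N u eps : measurable (@spectrum_within N u eps).
Proof.
pose I (i : 'I_N) := [set w | (ledge (muoo u) - eps%:E <= (ev (H N u w) i)%:E)%E] `&`
  [set w | ((ev (H N u w) i)%:E <= redge (muoo u) + eps%:E)%E].
have mev (i : 'I_N) : measurable_fun setT (fun w => (ev (H N u w) i)%:E).
  apply/measurable_EFinP; exact: (measurable_ev (measurable_funPT (H N u)) (@H_sym N u) i).
have -> : @spectrum_within N u eps = \bigcap_i I i.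
  apply/seteqP; split => w hw.
    move=> i _; have /hw/andP[h1 h2] : eigenvalue (H N u w) (ev (H N u w) i).
      by apply/(eigenvalue_ev _ (@H_sym N u w)); exists i.
    by split.
  by move=> x /(eigenvalue_ev _ (@H_sym N u w))[i _ ->]; have [h1 h2] := hw i Logic.I; apply/andP.
apply: fin_bigcap_measurable => // i _; apply: measurableI.
  by have := emeasurable_fun_c_infty measurableT (mev i) (ledge (muoo u) - eps%:E)%E; rewrite setTI.
by have := emeasurable_fun_infty_c measurableT (mev i) (redge (muoo u) + eps%:E)%E; rewrite setTI.
Qed.

(** On [goodset_eps] the support starts at [2 * eps] or later, so a spectrum within [eps] of it is
    at least [eps >= eta]. The matrix is then positive, the lower clamp is inactive, and the upper
    clamp can only decrease the product. *)
Lemma psd_det_lower N u w (eps eta K e1 : R) : (0 < N)%N -> 0 < eta -> eta <= 1 -> eta <= eps ->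
  1 <= K -> goodset_eps muoo eps u -> spectrum_within u eps w ->
  ~ (e1%:E < dBL (esd (H N u w)) (muoo u))%E ->
  expR (N%:R * (\int[muoo u]_x clampln eta K x - (ln K - ln eta + eta^-1) * e1)) <=
    psd_det (N := N) u w.
Proof.
move=> N0 eta0 eta1 ee K1 gu sw dB; have Hs := @H_sym N u w.
have NR : (0 : R) < N%:R by rewrite ltr0n.
have evge (i : 'I_N) : eps <= ev (H N u w) i.
  have /sw/andP[h _] : eigenvalue (H N u w) (ev (H N u w) i).
    by apply/(eigenvalue_ev _ Hs); exists i.
  have : (eps%:E <= ledge (muoo u) - eps%:E)%E.
    rewrite leeBrDr// -EFinD; apply: le_trans gu; rewrite lee_fin; lra.
  by move=> /le_trans/(_ h); rewrite lee_fin.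
have evgt (i : 'I_N) : 0 < ev (H N u w) i by apply: lt_le_trans (evge i); exact: lt_le_trans ee.
rewrite /psd_det indicE mem_set ?mulr1; last first.
  by apply/(psd_ev Hs) => i; exact: ltW.
have c0 : 0 < ln K - ln eta + eta^-1.
  have h1 := ln_le0 eta1; have h2 := ln_ge0 K1; have h3 : 0 < eta^-1 by rewrite invr_gt0.
  by lra.
have ie : 0 <= eta^-1 by rewrite invr_ge0 ltW.
have /ler_normlP[h _] := dBL_esd (clampln_lip eta0 eta1 K1) (clampln_bdd eta0 eta1 K1)
  ie c0 Hs dB.
apply: (@le_trans _ _ (expR (tr_fun (clampln eta K) (H N u w)))).
  rewrite ler_expR -ler_pdivlMl//; move: h.
  by move: (_ * tr_fun _ _) (_ * e1) (\int[_]_x _) => x y z; lra.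
rewrite tr_funE// expR_sum det_ev// normr_prod; apply: ler_prod => i _.
rewrite expR_ge0/= gtr0_norm// /clampln gtr0_norm//.
have ei : eta <= ev (H N u w) i by exact: le_trans (evge i).
rewrite (max_idPl ei) lnK ?posrE ?ge_min ?lexx//.
by rewrite lt_min evgt (lt_le_trans ltr01).
Qed.

Hypothesis H_outliers : no_outliers H muoo D.
Hypothesis G_convex : forall eps : R, 0 < eps -> convex_set (goodset_eps muoo eps).
Hypothesis D_convex : convex_set D.
Hypothesis D_closed : closed D.
Hypothesis DG1_pos : (0 < leb m (D `&` goodset_eps muoo 1))%E.

Lemma near_expected_lower (r eps eta K e : R) : 0 < r -> 0 < eps -> 0 < eta -> eta <= 1 -> eta <= eps ->
  1 <= K -> 0 < e -> D `&` goodset_eps muoo eps `&` eball r !=set0 ->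
  \forall N \near \oo, forall u, (D `&` goodset_eps muoo eps `&` eball r) u ->
  ((expR (N%:R * (\int[muoo u]_x clampln eta K x - e)) / 2)%:E <= 'E_(P N)[psd_det (N := N) u])%E.
Proof.
move=> r0 eps0 eta0 eta1 ee K1 e0 ne.
pose c := ln K - ln eta + eta^-1.
have c0 : 0 < c.
  have h1 := ln_le0 eta1; have h2 := ln_ge0 K1; have h3 : 0 < eta^-1 by rewrite invr_gt0.
  by rewrite /c; lra.
pose e1 := e / c; have e10 : 0 < e1 by rewrite divr_gt0.
(* The two exceptional events get probability at most [1/4] each, which leaves the factor [1/2] of
   the statement. *)
have q0 : 0 < 4^-1 :> R by rewrite invr_gt0.
have [N1 hN1] := cvg1_ge (H_outliers r0 eps0 ne) q0.
have h1 := near_conc 1 r0 e10; have h2 := nbhs_infty_gt 0%N; have h3 := nbhs_infty_ge N1.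
have h4 := @near_NlnN_ge R 1; have h5 := nbhs_infty_ger (3 : R).
near=> N.
have g1 : forall u, eball r u ->
  pr (P N) [set w | (e1%:E < dBL (esd (H N u w)) (muoo u))%E] <= expR (- 1 * (N%:R * ln N%:R)).
  by near: N.
have N0 : (0 < N)%N by near: N.
have g3 : (N1 <= N)%N by near: N.
have g4 : 1 * N%:R <= N%:R * ln N%:R :> R by near: N.
have g5 : 3 <= N%:R :> R by near: N.
move=> u hu; have [[Du gu] ru] := hu.
pose B := [set w | (e1%:E < dBL (esd (H N u w)) (muoo u))%E].
have mB : measurable B by exact: (measurable_dBL_gt (measurable_funPT (H N u)) (@H_sym N u)).
have mS := @measurable_spectrum_within N u eps.
have pB : pr (P N) B <= 4^-1.
  apply: le_trans (g1 u ru) _; rewrite mulN1r expRN lef_pV2 ?posrE ?expR_gt0//.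
  apply: le_trans (expR_ge1Dx _); move: g4 g5; rewrite mul1r.
  by move: (N%:R * ln N%:R) => x; lra.
have pS : pr (P N) (~` @spectrum_within N u eps) <= 4^-1.
  rewrite (prC (P N) mS) lerBlDr -lerBlDl -lee_fin; have <- := prE (P N) mS.
  apply: le_trans (hN1 N g3) _; apply: ereal_inf_lbound; exists u => //.
pose G := @spectrum_within N u eps `&` ~` B.
have mG : measurable G by apply: measurableI => //; exact: measurableC.
have pG : 2^-1 <= pr (P N) G.
  have : pr (P N) (~` G) <= 4^-1 + 4^-1.
    rewrite /G setCI setCK; apply: le_trans (prU (P N) (measurableC mS) mB) _.
    exact: lerD.
  rewrite (prC (P N) mG); have -> : 4^-1 + 4^-1 = 2^-1 :> R by field.
  by move: (pr _ _) => x; lra.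
have Ee : c * e1 = e by rewrite /e1 mulrC divfK// gt_eqF.
have hG w : G w -> ((expR (N%:R * (\int[muoo u]_x clampln eta K x - e)))%:E <= (psd_det (N := N) u w)%:E)%E.
  move=> [sw nB]; rewrite lee_fin -Ee.
  exact: psd_det_lower N0 eta0 eta1 ee K1 gu sw nB.
have p0 w : setT w -> (0 <= (psd_det (N := N) u w)%:E)%E.
  by move=> _; rewrite lee_fin psd_det_ge0.
have := integral_ge0_lb (P N) mG (@subsetT _ _) (expR_ge0 _) p0 hG.
rewrite unlock => h; apply: le_trans h.
have pG' : ((2^-1)%:E <= P N G)%E by have -> := prE (P N) mG; rewrite lee_fin.
by rewrite EFinM; apply: lee_wpmul2l; [rewrite lee_fin expR_ge0|exact: pG'].
Unshelve. all: by end_near. Qed.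

Lemma goodset_eps_anti (e1 e2 : R) : e1 <= e2 -> goodset_eps muoo e2 `<=` goodset_eps muoo e1.
Proof. by move=> h u; apply: le_trans; rewrite lee_fin ler_pM2l. Qed.

Lemma nbhs_enorm (u0 : 'rV[R]_m) (A : set 'rV[R]_m) : nbhs u0 A ->
  exists2 e : R, 0 < e & forall u, enorm (u - u0) <= e -> A u.
Proof.
move=> /nbhs_ballP[e /= e0 eA]; exists (e / 2); first by rewrite divr_gt0.
move=> u hu; apply: eA; apply/mx_ballP => // i j; rewrite (ord1 i) distrC.
have := enorm_coord (u - u0) j; rewrite !mxE => h.
apply: le_lt_trans h _; apply: le_lt_trans hu _; rewrite ltr_pdivrMr//.
by rewrite ltr_pMr// ltr1n.
Qed.

Lemma enormD (v w : 'rV[R]_m) : enorm (v + w) <= enorm v + enorm w.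
Proof.
have -> : enorm w = enorm (- w).
  by congr Num.sqrt; apply: eq_bigr => i _; rewrite mxE sqrrN.
by rewrite -[v + w]/(v + w) -{1}[w]opprK; exact: enormB.
Qed.

Lemma lower_bound (u0 : 'rV[R]_m) (eps' e : R) : 0 < eps' -> 0 < e -> D u0 ->
  goodset_eps muoo eps' u0 -> \forall N \near \oo,
  ((expR (N%:R * (rate u0 - e)))%:E <= \int[leb m]_(u in D) weighted_det N u)%E.
Proof.
(* Capping at 1 places [goodset_eps muoo 1] inside [goodset_eps muoo eps], and with it a set of
   positive volume. *)
move=> eps'0 e0 Du0 gu0'; pose eps := Num.min eps' 1.
have eps0 : 0 < eps by rewrite lt_min eps'0 ltr01.
have eps1 : eps <= 1 by rewrite ge_min lexx orbT.
have gu0 : goodset_eps muoo eps u0.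
  by apply: goodset_eps_anti gu0'; rewrite ge_min lexx.
have e40 : 0 < e / 4 by rewrite divr_gt0.
pose r := enorm u0 + 2; have r0 : 0 < r by rewrite ltr_wpDl ?enorm_ge0.
have [K [eta [K1 /andP[eta0 eta1] _ _ hV]]] := logpot_approx ctl r0 e40.
pose h := Num.min eta eps; have h0 : 0 < h by rewrite lt_min eta0 eps0.
have h1 : h <= 1 by rewrite ge_min eta1.
have hV' u : cball r u -> logpot muoo u <= \int[muoo u]_x clampln h K x.
  move=> ru; have hh : 0 < h <= eta by rewrite h0 ge_min lexx.
  by have /andP[] := (hV u ru).2 h hh.
have [rho rho0 hrho] : exists2 rho : R, 0 < rho & forall u, enorm (u - u0) <= rho ->
    rate u0 - e / 4 <= rate u.
  apply: nbhs_enorm.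
  have := (@cvgrPdist_le _ _ _ _ (nbhs_filter u0) _ _).1 (@continuous_rate u0) _ e40.
  by apply: filterS => u /ler_normlP[_]; move: (rate u) (rate u0) => x y; lra.
pose s := Num.min rho 1; have s0 : 0 < s by rewrite lt_min rho0 ltr01.
have s_rho : s <= rho by rewrite ge_min lexx.
have s1 : s <= 1 by rewrite ge_min lexx orbT.
have heps : h <= eps by rewrite ge_min lexx orbT.
pose A := D `&` goodset_eps muoo eps.
have cA : convex_set A.
  move=> x y l /set_mem[Dx gx] /set_mem[Dy gy]; apply/mem_set; split.
    exact: (set_mem (D_convex l (mem_set Dx) (mem_set Dy))).
  exact: (set_mem (G_convex eps0 l (mem_set gx) (mem_set gy))).
have mg a : measurable (goodset_eps muoo a).
  apply: closed_measurable_rV; exact: (closed_goodset_eps H_sym H_cont ctl).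
have mD : measurable D by exact: closed_measurable_rV.
have mA : measurable A by exact: measurableI.
have mA1 : measurable (D `&` goodset_eps muoo 1) by exact: measurableI.
have BA : D `&` goodset_eps muoo 1 `<=` A.
  by move=> u [Du gu]; split => //; exact: goodset_eps_anti gu.
pose B := A `&` [set u | (enorm (u - u0) <= s)%R].
have B0 : (0 < leb m B)%E by exact: (convex_mass_near cA mA mA1 BA DG1_pos (conj Du0 gu0) s0).
have mB : measurable B.
  apply: measurableI => //.
  have -> : [set u | (enorm (u - u0) <= s)%R] = (fun u => 1 *: u + - u0) @^-1` cball s.
    by apply/seteqP; split => u; rewrite /cball/= scale1r.
  rewrite -[X in measurable X]setTI; apply: measurable_affine => //.
  by apply: closed_measurable_rV; exact: closed_cball.
have Br u : B u -> eball r u.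
  move=> [_ us]; rewrite /eball/= -[u](subrK u0).
  apply: le_lt_trans (enormD _ _) _; rewrite /r addrC; rewrite ltrD2l.
  by apply: le_lt_trans us _; apply: le_lt_trans s1 _; rewrite ltr1n.
have [c0 c00 hc0] : exists2 c0 : R, 0 < c0 & (c0%:E <= leb m B)%E.
  move: B0; case: (leb m B) => [x| |] // x0; first by exists x.
  by exists 1; rewrite ?leey.
have ne : D `&` goodset_eps muoo eps `&` eball r !=set0.
  by exists u0; split => //; rewrite /eball/= ltrDl.
have hE := near_expected_lower r0 eps0 h0 h1 heps K1 e40 ne.
(* The costs independent of [N]: the shift [p], the probability [1/2] and the volume near [u0]. They
   are absorbed by [N * (e / 4)]. *)
pose C := `|p| * (alpha * r ^+ 2) + ln 2 - ln c0.
have h3 := nbhs_infty_ger (C / (e / 4)).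
near=> N.
have g1 : forall u, (D `&` goodset_eps muoo eps `&` eball r) u ->
  ((expR (N%:R * (\int[muoo u]_x clampln h K x - e / 4)) / 2)%:E <= 'E_(P N)[psd_det (N := N) u])%E.
  by near: N.
have g3 : C / (e / 4) <= N%:R by near: N.
pose c := expR (N%:R * (rate u0 - e / 2) - `|p| * (alpha * r ^+ 2)) / 2.
have cW u : B u -> (c%:E <= weighted_det N u)%E.
  move=> Bu; have [[Du gu] us] := Bu; have ru := Br u Bu.
  have hg := g1 u (conj (conj Du gu) ru).
  apply: le_trans (lee_wpmul2l _ hg); last by rewrite lee_fin expR_ge0.
  rewrite -EFinM lee_fin /c [leRHS]mulrA; apply: ler_wpM2r; first by rewrite invr_ge0.
  rewrite -expRD ler_expR.
  have hl := hV' u (ltW ru).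
  have hr : rate u0 - e / 4 <= rate u by apply: hrho; apply: le_trans us s_rho.
  have n0 : 0 <= enorm u ^+ 2 by exact: sqr_ge0.
  have nr : enorm u ^+ 2 <= r ^+ 2 by rewrite ler_sqr ?nnegrE ?enorm_ge0 ?ltW.
  have pp : p * (alpha * enorm u ^+ 2) <= `|p| * (alpha * r ^+ 2).
    apply: (@le_trans _ _ (`|p| * (alpha * enorm u ^+ 2))).
      by apply: ler_wpM2r (ler_norm p); apply: mulr_ge0 => //; exact: ltW.
    by apply: ler_wpM2l => //; apply: ler_wpM2l => //; exact: ltW.
  have NRx (x y : R) : x <= y -> N%:R * x <= N%:R * y by move=> xy; rewrite ler_wpM2l.
  have k1 : rate u0 - e / 2 <= \int[muoo u]_x clampln h K x - e / 4 - alpha * enorm u ^+ 2.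
    by move: hl hr; rewrite /rate; move: (alpha * enorm u ^+ 2) (\int[muoo u]_x _) => *; lra.
  have -> : - ((N%:R + p) * alpha * enorm u ^+ 2) + N%:R * (\int[muoo u]_x clampln h K x - e / 4) =
    N%:R * (\int[muoo u]_x clampln h K x - e / 4 - alpha * enorm u ^+ 2) - p * (alpha * enorm u ^+ 2).
    by ring.
  by rewrite lerB// NRx.
have hint := integral_ge0_lb (leb m) mB _ _ (fun u _ => weighted_det_ge0 N u) cW.
apply: (@le_trans _ _ (c%:E * leb m B)%E); last first.
  by apply: hint; [move=> u [[]]|rewrite divr_ge0 ?expR_ge0].
apply: (@le_trans _ _ (c%:E * c0%:E)%E); last first.
  by apply: lee_wpmul2l => //; rewrite lee_fin divr_ge0 ?expR_ge0.
rewrite -EFinM lee_fin /c.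
have -> : c0 = expR (ln c0) by rewrite lnK ?posrE.
have e2 (y : R) : expR y / 2 = expR (y - ln 2) by rewrite expRD expRN lnK ?posrE.
rewrite e2 -expRD ler_expR.
have : C <= N%:R * (e / 4) by rewrite -ler_pdivrMr.
have : 0 <= N%:R * e by rewrite mulr_ge0// ltW.
rewrite /C; move: (`|p| * (alpha * r ^+ 2)) (ln 2) (ln c0) (rate u0) (N%:R) => *; lra.
Unshelve. all: by end_near. Qed.

End laplace_method.

(** * The upper bound *)

Section upper_bound.
Context {R : realType} {m : nat} {D : set 'rV[R]_m} {d : nat -> measure_display}
  {Om : forall N, measurableType (d N)} (P : forall N, probability (Om N) R)
  (H : forall N, 'rV[R]_m -> {RV (P N) >-> 'M[R]_N})
  (muoo : 'rV[R]_m -> probability (measurableTypeR R) R).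
Hypothesis H_sym : forall N u w, sym_mx (H N u w).
Hypothesis H_cont : forall N, {ae P N, forall w, forall i j,
  continuous (fun u => H N u w i j)}.
Hypothesis ctl : forall r : R, 0 < r -> exists K k : R, [/\ 1 <= K, 0 < k,
  spectral_control H muoo (cball r) K, determinant_control H muoo (cball r) K &
  forall u, cball r u -> density_near0 (muoo u) `[- k, k]%classic k].
Hypothesis H_conc : superexp_concentration H muoo.
Variables (alpha p : R).
Hypothesis alpha_gt0 : 0 < alpha.
Hypothesis D_closed : closed D.
Variable C : R.
Hypothesis C0 : 0 < C.
Hypothesis H_decay : forall N u, (0 < N)%N ->
  ('E_(P N)[fun w => `|\det (H N u w)|%R] <= ((C * Num.max (enorm u) 1) ^+ N)%:E)%E.
Variable s : R.
Hypothesis rate_le : forall u, D u -> goodset muoo u -> rate muoo alpha u <= s.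

Lemma expected_psd_det_le N u : ('E_(P N)[psd_det (N := N) H u] <=
  'E_(P N)[fun w => `|\det (H N u w)|%R])%E.
Proof.
rewrite unlock; apply: le_integral_raw => w _; rewrite lee_fin; first exact: psd_det_ge0.
by rewrite /psd_det ler_piMr// indicE; case: (_ \in _).
Qed.

(** Once [N >= 2 |p|], half of the exponent [N alpha |u|^2] remains after the shift by [p]. One
    quarter of it pays for the growth [ln C + ln |u| - s] and another for a Gaussian factor
    integrable independently of [N]. *)
Lemma tail_bound : exists2 r : R, 0 < r & \forall N \near \oo, forall u, ~ cball r u ->
  (weighted_det H alpha p N u <= (expR (N%:R * s) * expR (- enorm u ^+ 2))%:E)%E.
Proof.
pose b := 1 + `|ln C - s|; have b1 : 1 <= b by rewrite lerDl.
pose r := Num.max 1 (4 / alpha * b).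
have r1 : 1 <= r by rewrite le_max lexx.
exists r; first exact: lt_le_trans r1.
have h1 := nbhs_infty_ger (2 * `|p|); have h2 := nbhs_infty_ger (4 / alpha).
have h3 := nbhs_infty_gt 0%N.
near=> N; have g1 : 2 * `|p| <= N%:R by near: N.
have g2 : 4 / alpha <= N%:R by near: N.
have N0 : (0 < N)%N by near: N.
move=> u nu; pose x := enorm u.
have rx : r < x by rewrite ltNge; apply/negP.
have x1 : 1 <= x by apply: le_trans r1 (ltW rx).
have x0 : 0 < x by exact: lt_le_trans x1.
have hE := le_trans (expected_psd_det_le N u) (H_decay u N0).
apply: (le_trans (lee_wpmul2l _ hE)); first by rewrite lee_fin expR_ge0.
rewrite -/x (max_idPl x1) -EFinM lee_fin.
have -> : (C * x) ^+ N = expR (N%:R * (ln C + ln x)).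
  by rewrite -lnM ?posrE// expRM_natl lnK ?posrE ?mulr_gt0.
rewrite -!expRD ler_expR.
have lx : ln x <= x by apply/ltW/ln_sublinear.
have NR : 0 <= N%:R :> R by [].
have ax : b * x <= alpha * x ^+ 2 / 4.
  have : 4 / alpha * b <= x by apply: le_trans (ltW rx); rewrite le_max lexx orbT.
  move=> /(ler_wpM2l (ltW alpha_gt0)); have -> : alpha * (4 / alpha * b) = 4 * b.
    by field; rewrite gt_eqF.
  move=> /(ler_wpM2r (ltW x0)); rewrite expr2; lra.
have k1 : ln C + ln x - s <= alpha * x ^+ 2 / 4.
  apply: le_trans ax; have := ler_norm (ln C - s).
  have : `|ln C - s| <= `|ln C - s| * x by rewrite ler_peMr.
  by rewrite /b; lra.
have k2 : N%:R * (ln C + ln x - s) <= N%:R * (alpha * x ^+ 2 / 4) by rewrite ler_wpM2l.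
have ax0 : 0 <= alpha * x ^+ 2 by rewrite mulr_ge0 ?sqr_ge0// ltW.
have k3 : N%:R / 2 * (alpha * x ^+ 2) <= (N%:R + p) * (alpha * x ^+ 2).
  apply: ler_wpM2r => //; have := ler_norm (- p); rewrite normrN; lra.
have k4 : x ^+ 2 <= N%:R * (alpha * x ^+ 2 / 4).
  move: g2; rewrite ler_pdivrMr// => h.
  have := ler_wpM2r (sqr_ge0 x) h; rewrite -mulrA; lra.
by move: k2 k3 k4; rewrite -/x; move: (ln C) (ln x) (N%:R) => *; lra.
Unshelve. all: by end_near. Qed.

(* On the compact set where [rate] is at least [s + e] the continuous function
   [left_mass] does not vanish, so it is bounded away from 0. *)
Lemma compact_gap (r e : R) : 0 < e -> exists2 tau : R, 0 < tau &
  forall u, D u -> cball r u -> left_mass (muoo u) 0 < tau -> rate muoo alpha u <= s + e.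
Proof.
move=> e0; pose A := (D `&` cball r) `&` [set u | s + e <= rate muoo alpha u].
have crate : continuous (rate muoo alpha) by exact: (continuous_rate H_sym H_cont ctl).
have clm : continuous (fun u => left_mass (muoo u) 0).
  exact: (continuous_left_mass H_sym H_cont ctl).
have cA : compact A.
  apply: (subclosed_compact _ (@compact_cball _ m r)) => [|u [[]]//].
  apply: closedI; first by apply: closedI => //; exact: closed_cball.
  have -> : [set u | s + e <= rate muoo alpha u] = rate muoo alpha @^-1` [set x | s + e <= x] by [].
  by apply: closed_comp => [u _|]; [exact: crate|exact: closed_ge].
have : compact ((fun u => left_mass (muoo u) 0) @` A).
  by apply: continuous_compact cA; apply: continuous_subspaceT; exact: clm.
move=> cI; have oU : open (~` ((fun u => left_mass (muoo u) 0) @` A)).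
  by apply: closed_openC; exact: compact_closed.
have U0 : (~` ((fun u => left_mass (muoo u) 0) @` A)) 0.
  move=> [u [[Du _] hu] /left_mass_eq0 u0].
  have := rate_le Du u0; move: hu; rewrite /=; move: (rate _ _ _) => x; lra.
have /nbhs_ballP[tau /= tau0 htau] := open_nbhs_nbhs (conj oU U0).
exists tau => // u Du ru hu; rewrite leNgt; apply/negP => hs.
have : ball 0 tau (left_mass (muoo u) 0).
  by rewrite /ball/= sub0r normrN ger0_norm ?left_mass_ge0.
by move=> /htau; apply; exists u => //; split => //=; exact: ltW.
Qed.

(* A positive spectral measure stays at distance at least [tau / 2] from a
   measure with left mass [tau]; that event is superexponentially rare. *)
Lemma near_not_psd (r tau L : R) : 0 < r -> 0 < tau -> \forall N \near \oo, forall u,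
  cball r u -> tau <= left_mass (muoo u) 0 ->
  ('E_(P N)[psd_det (N := N) H u] <= (expR (N%:R * L))%:E)%E.
Proof.
move=> r0 tau0; have [K [k [K1 k0 _ [_ [delta [B [delta0 hB]]]] _]]] := ctl r0.
pose a1 := (`|B| + 1) / delta.
have e10 : 0 < tau / 4 by rewrite divr_gt0.
have r10 : 0 < r + 1 by rewrite addr_gt0.
have h1 := near_conc H_sym H_conc (a1 + 1) r10 e10.
have h2 := near_NlnN_ge (`|L| + 1); have h3 := nbhs_infty_gt 0%N.
near=> N; have g1 : forall u, eball (r + 1) u ->
  pr (P N) [set w | ((tau / 4)%:E < dBL (esd (H N u w)) (muoo u))%E] <=
  expR (- (a1 + 1) * (N%:R * ln N%:R)) by near: N.
have g2 : (`|L| + 1) * N%:R <= N%:R * ln N%:R by near: N.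
have g3 : forall u, cball r u -> (\int[P N]_w (`|\det (H N u w)| `^ (1 + delta))%:E <=
       (expR (B * (N%:R * ln N%:R)))%:E)%E by near: N.
have N0 : (0 < N)%N by near: N.
move=> u ru hu; have Hs := @H_sym N u; have mH := measurable_funPT (H N u).
set y := N%:R * ln N%:R in g1 g2 g3.
have y0 : 0 <= y by apply: le_trans g2; rewrite mulr_ge0// addr_ge0.
pose Bad := [set w | ((tau / 4)%:E < dBL (esd (H N u w)) (muoo u))%E].
have mBad : measurable Bad by exact: (measurable_dBL_gt mH Hs).
have pBad : pr (P N) Bad <= expR (- (a1 + 1) * y).
  by apply: g1; apply: le_lt_trans ru _; rewrite ltrDl.
(* A nonnegative spectrum is invisible to [ramp 0], whose sup bound and Lipschitz constant add up to
   2; outside [Bad] the left mass would be at most [2 * (tau / 4)], below [tau]. *)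
have psd_bad w : psd (H N u w) -> Bad w.
  move=> /(psd_ev (Hs w)) hev; apply: contrapT => nB.
  have b0 : (0 : R) < 1 + 1 by [].
  have := dBL_esd (ramp_lip 0) (ramp_bdd 0) ler01 b0 (Hs w) nB.
  rewrite tr_funE// big1 => [|i _]; last first.
    by rewrite /ramp sub0r (max_idPr _) ?oppr_le0// (min_idPl _).
  rewrite mulr0 sub0r normrN ger0_norm; last exact: (left_mass_ge0 (muoo u) 0).
  move=> h; move: (le_trans hu h); lra.
have I0 w : 0 <= \1_Bad w :> R by rewrite indicE.
have pointwise w : psd_det (N := N) H u w <= expR (a1 * y) * \1_Bad w +
    expR (- delta * (a1 * y)) * `|\det (H N u w)| `^ (1 + delta).
  have t2 : 0 <= expR (- delta * (a1 * y)) * `|\det (H N u w)| `^ (1 + delta).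
    by rewrite mulr_ge0 ?expR_ge0 ?powR_ge0.
  have [hp|np] := pselect (psd (H N u w)); last first.
    rewrite /psd_det [X in _ * X <= _]indicE memNset// mulr0.
    exact: addr_ge0 (mulr_ge0 (expR_ge0 _) (I0 w)) t2.
  rewrite /psd_det !indicE !mem_set ?mulr1//; last exact: psd_bad.
  have [h|h] := young_trunc (a1 * y) (normr_ge0 (\det (H N u w))) delta0.
    by apply: le_trans h _; rewrite lerDl.
  by apply: le_trans h _; rewrite lerDr expR_ge0.
have mD : measurable_fun setT (fun w => `|\det (H N u w)| `^ (1 + delta)).
  apply: (@measurableT_comp _ _ _ _ _ _ (fun x : R => x `^ (1 + delta))) => //.
  exact: (measurableT_comp (@normr_measurable R setT) (measurable_det mH Hs)).
have mB : measurable_fun setT (\1_Bad : Om N -> R) by exact: measurable_indic.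
have D0 w : 0 <= `|\det (H N u w)| `^ (1 + delta) by exact: powR_ge0.
rewrite unlock; apply: (@le_trans _ _ (\int[P N]_w (expR (a1 * y) * \1_Bad w +
    expR (- delta * (a1 * y)) * `|\det (H N u w)| `^ (1 + delta))%:E)%E).
  by apply: le_integral_raw => w _; rewrite lee_fin ?psd_det_ge0//; exact: pointwise.
have mZ (c : R) (f : Om N -> R) : measurable_fun setT f -> measurable_fun setT (fun w => c * f w).
  by move=> mf; exact: measurable_funM.
have z1 w : 0 <= expR (a1 * y) * \1_Bad w by rewrite mulr_ge0 ?expR_ge0.
have z2 w : 0 <= expR (- delta * (a1 * y)) * `|\det (H N u w)| `^ (1 + delta).
  by rewrite mulr_ge0 ?expR_ge0.
rewrite (ge0_integral_EFinD (P N) (mZ _ _ mB) (mZ _ _ mD) z1 z2).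
rewrite (ge0_integral_EFinZ (P N) mB I0 (expR_ge0 _)).
rewrite (ge0_integral_EFinZ (P N) mD D0 (expR_ge0 _)).
have -> : (\int[P N]_x (\1_Bad x)%:E = (pr (P N) Bad)%:E)%E.
  by rewrite integral_indic// setIT; exact: prE.
apply: (le_trans (leeD (lexx _) (lee_wpmul2l _ (g3 u ru)))); first by rewrite lee_fin expR_ge0.
rewrite -!EFinM -EFinD lee_fin -expRD.
have t1 : expR (a1 * y) * pr (P N) Bad <= expR (- y).
  apply: le_trans (ler_wpM2l (expR_ge0 _) pBad) _; rewrite -expRD ler_expR.
  by rewrite -mulrDl opprD addrA subrr add0r mulN1r.
have t2 : expR (- delta * (a1 * y) + B * y) <= expR (- y).
  rewrite ler_expR mulrA (_ : - delta * a1 = - (`|B| + 1)); last by rewrite /a1; field; rewrite gt_eqF.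
  have hB1 : - (`|B| + 1) + B <= - 1 by have := ler_norm B; lra.
  by have := ler_wpM2r y0 hB1; rewrite mulN1r mulrDl.
have NR : (1 : R) <= N%:R by rewrite ler1n.
have h : expR (- y) * 2 <= expR (N%:R * L).
  have e2 : 2 <= expR N%:R :> R by apply: le_trans (expR_ge1Dx _); lra.
  apply: (le_trans (ler_wpM2l (expR_ge0 _) e2)); rewrite -expRD ler_expR.
  have : - (`|L| * N%:R) <= N%:R * L.
    rewrite mulrC -mulrN ler_wpM2l//; have := ler_norm (- L); rewrite normrN; lra.
  by move: g2; rewrite mulrDl mul1r; move: (`|L| * N%:R) (N%:R * L) (N%:R) => *; lra.
by apply: le_trans h; move: t1 t2; move: (expR (- y)) => *; lra.
Unshelve. all: by end_near. Qed.

Lemma inside_bound (r e : R) : 0 < r -> 0 < e -> \forall N \near \oo, forall u,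
  D u -> cball r u ->
  (weighted_det H alpha p N u <= (expR (N%:R * (s + e) + `|p| * (alpha * r ^+ 2)))%:E)%E.
Proof.
move=> r0 e0; have e40 : 0 < e / 4 by rewrite divr_gt0.
have [K [eta [K1 /andP[eta0 eta1] _ [dc _] hV]]] := logpot_approx ctl r0 e40.
have [tau tau0 htau] := compact_gap r e40.
have h1 := near_not_psd (s + e) r0 tau0.
have h2 := dc eta (e / 4) eta0 eta1 e40.
have h3 := nbhs_infty_ger `|p|.
near=> N; have g1 : forall u, cball r u -> tau <= left_mass (muoo u) 0 ->
  ('E_(P N)[psd_det (N := N) H u] <= (expR (N%:R * (s + e)))%:E)%E by near: N.
have g2 : forall u, cball r u -> (\int[P N]_w (`|\det (H N u w)|)%:E <=
       (expR (N%:R * (\int[muoo u]_x clampln eta K x + e / 4)))%:E)%E by near: N.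
have g3 : `|p| <= N%:R by near: N.
move=> u Du ru.
have n0 : 0 <= enorm u ^+ 2 by exact: sqr_ge0.
have nr : enorm u ^+ 2 <= r ^+ 2 by rewrite ler_sqr ?nnegrE ?enorm_ge0 ?(ltW r0)//; exact: ru.
have an0 : 0 <= alpha * enorm u ^+ 2 by apply: mulr_ge0 => //; exact: ltW.
have pp : - p * (alpha * enorm u ^+ 2) <= `|p| * (alpha * r ^+ 2).
  apply: (@le_trans _ _ (`|p| * (alpha * enorm u ^+ 2))).
    by apply: ler_wpM2r => //; rewrite -normrN ler_norm.
  by apply: ler_wpM2l => //; apply: ler_wpM2l => //; exact: ltW.
have w0 : (0 <= (expR (- ((N%:R + p) * alpha * enorm u ^+ 2)))%:E)%E by rewrite lee_fin expR_ge0.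
have [small|large] := ltP (left_mass (muoo u) 0) tau; last first.
  apply: (le_trans (lee_wpmul2l w0 (g1 u ru large))).
  rewrite -EFinM lee_fin -expRD ler_expR addrC lerD2l.
  apply: le_trans _ pp; have : 0 <= N%:R * (alpha * enorm u ^+ 2) by rewrite mulr_ge0.
  by move: (enorm u ^+ 2) (N%:R) => *; lra.
have hr := htau u Du ru small.
have hE : ('E_(P N)[psd_det (N := N) H u] <= (expR (N%:R * (\int[muoo u]_x clampln eta K x + e / 4)))%:E)%E.
  apply: le_trans (expected_psd_det_le N u) _; have := g2 u ru; by rewrite unlock.
apply: (le_trans (lee_wpmul2l w0 hE)); rewrite -EFinM lee_fin -expRD ler_expR.
have hh : 0 < eta <= eta by rewrite eta0 lexx.
have /andP[_ hl] := (hV u ru).2 eta hh.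
have k1 : \int[muoo u]_x clampln eta K x + e / 4 - alpha * enorm u ^+ 2 <= s + e.
  by move: hl hr; rewrite /rate; move: (alpha * _) (\int[_]_x _) (logpot _ _) => *; lra.
have -> : - ((N%:R + p) * alpha * enorm u ^+ 2) + N%:R * (\int[muoo u]_x clampln eta K x + e / 4) =
    N%:R * (\int[muoo u]_x clampln eta K x + e / 4 - alpha * enorm u ^+ 2) + - p * (alpha * enorm u ^+ 2).
  by ring.
by apply: lerD => //; apply: ler_wpM2l.
Unshelve. all: by end_near. Qed.

Lemma ge0_lty_EFin (x : \bar R) : (0 <= x)%E -> (x < +oo)%E ->
  exists2 V : R, x = V%:E & 0 <= V.
Proof. by case: x => [x| |] // x0 _; exists x. Qed.

Lemma upper_bound (e : R) : 0 < e -> \forall N \near \oo,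
  (\int[leb m]_(u in D) weighted_det H alpha p N u <= (expR (N%:R * (s + e)))%:E)%E.
Proof.
move=> e0; have e20 : 0 < e / 2 by rewrite divr_gt0.
have [r r0 h1] := tail_bound; have h2 := inside_bound r0 e20.
have mB : measurable (@cball R m r) by apply: closed_measurable_rV; exact: closed_cball.
have mD : measurable D by exact: closed_measurable_rV.
pose c := `|p| * (alpha * r ^+ 2).
have [V EV V0] := ge0_lty_EFin (measure_ge0 (leb m) (cball r)) (@leb_cball_lty R m r).
have gpos : (0 <= \int[@leb R m]_u (expR (- enorm u ^+ 2))%:E)%E.
  by apply: integral_ge0 => u _; rewrite lee_fin expR_ge0.
have [g Eg g0] := ge0_lty_EFin gpos (@leb_gauss R m).
(* The volume of the ball, the shift by [p] and the Gaussian mass do not depend on [N]; half of the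
   slack absorbs them. *)
have h3 := nbhs_infty_ger ((V * expR c + g) / (e / 2)).
near=> N; have g1 : forall u, ~ cball r u ->
  (weighted_det H alpha p N u <= (expR (N%:R * s) * expR (- enorm u ^+ 2))%:E)%E by near: N.
have g2 : forall u, D u -> cball r u ->
  (weighted_det H alpha p N u <= (expR (N%:R * (s + e / 2) + c))%:E)%E by near: N.
have g3 : (V * expR c + g) / (e / 2) <= N%:R by near: N.
pose F u := expR (N%:R * (s + e / 2) + c) * \1_(@cball R m r) u + expR (N%:R * s) * expR (- enorm u ^+ 2).
have I0 u : 0 <= \1_(@cball R m r) u :> R by rewrite indicE.
have E0 (u : 'rV[R]_m) : 0 <= expR (- enorm u ^+ 2) by exact: expR_ge0.
have z1 u : 0 <= expR (N%:R * (s + e / 2) + c) * \1_(@cball R m r) u by rewrite mulr_ge0 ?expR_ge0.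
have z2 (u : 'rV[R]_m) : 0 <= expR (N%:R * s) * expR (- enorm u ^+ 2) by rewrite mulr_ge0 ?expR_ge0.
have F0 u : 0 <= F u by rewrite addr_ge0.
have mI : measurable_fun setT (\1_(@cball R m r) : 'rV[R]_m -> R) by exact: measurable_indic.
have mG := @measurable_gauss_rV R m.
have mZ (a : R) (f : 'rV[R]_m -> R) : measurable_fun setT f -> measurable_fun setT (fun w => a * f w).
  by move=> mf; exact: measurable_funM.
have mF : measurable_fun setT F by apply: measurable_funD; exact: mZ.
apply: (@le_trans _ _ (\int[leb m]_(u in D) (F u)%:E)%E).
  apply: le_integral_raw => u Du; first exact: weighted_det_ge0.
  have [ru|nr] := pselect (cball r u).
    apply: le_trans (g2 u Du ru) _; rewrite lee_fin /F indicE mem_set// mulr1.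
    by rewrite lerDl mulr_ge0 ?expR_ge0.
  apply: le_trans (g1 u nr) _; rewrite lee_fin /F indicE memNset// mulr0 add0r//.
apply: (@le_trans _ _ (\int[leb m]_u (F u)%:E)%E).
  apply: ge0_subset_integral => //.
  - exact/measurable_EFinP.
  - by move=> u _; rewrite lee_fin.
rewrite /F (ge0_integral_EFinD (leb m) (mZ _ _ mI) (mZ _ _ mG) z1 z2).
rewrite (ge0_integral_EFinZ (leb m) mI I0 (expR_ge0 _)).
rewrite (ge0_integral_EFinZ (leb m) mG E0 (expR_ge0 _)) Eg.
rewrite integral_indic// setIT EV -!EFinM -EFinD lee_fin.
rewrite expRD; set T := expR (N%:R * (s + e / 2)).
have T0 : 0 < T by exact: expR_gt0.
have NR : (0 : R) <= N%:R by [].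
have sT : expR (N%:R * s) <= T by rewrite ler_expR ler_wpM2l// lerDl ltW.
have -> : expR (N%:R * (s + e)) = T * expR (N%:R * (e / 2)).
  by rewrite /T -expRD; congr expR; field.
apply: (@le_trans _ _ (T * (V * expR c + g))).
  have : expR (N%:R * s) * g <= T * g by rewrite ler_wpM2r.
  have -> : T * expR c * V = T * (V * expR c) by ring.
  by rewrite mulrDr; move: (expR _ * g) (T * g) (T * _) => *; lra.
rewrite ler_pM2l//; apply: le_trans (expR_ge1Dx _).
have : V * expR c + g <= N%:R * (e / 2) by rewrite -ler_pdivrMr.
by move: (_ + g) (N%:R * _) => *; lra.
Unshelve. all: by end_near. Qed.

End upper_bound.

Section extended_limits.
Context {R : realType}.

(** Testing against real levels on both sides treats finite and infinite limits alike, so finiteness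
    of the supremum never has to be shown. *)
Lemma cvge_sandwich (F : nat -> \bar R) (S : \bar R) :
  (forall a : R, (a%:E < S)%E -> \forall N \near \oo, (a%:E <= F N)%E) ->
  (forall b : R, (S < b%:E)%E -> \forall N \near \oo, (F N <= b%:E)%E) ->
  F @ \oo --> S.
Proof.
case: S => [s| |] lo up.
- move=> A [e /= e0 eA]; have e20 : 0 < e / 2 by rewrite divr_gt0.
  have h1 : \forall N \near \oo, ((s - e / 2)%:E <= F N)%E.
    by apply: lo; rewrite lte_fin ltrBlDr ltrDl.
  have h2 : \forall N \near \oo, (F N <= (s + e / 2)%:E)%E.
    by apply: up; rewrite lte_fin ltrDl.
  suff : \forall N \near \oo, A (F N) by [].
  near=> N; have g1 : ((s - e / 2)%:E <= F N)%E by near: N.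
  have g2 : (F N <= (s + e / 2)%:E)%E by near: N.
  move: g1 g2; case: (F N) => [x| |] //; rewrite !lee_fin => g1 g2.
  by apply: eA; rewrite /ball/=; apply/ltr_normlP; split; lra.
- by apply/cvgeyPge => A; apply: lo; rewrite ltry.
- by apply/cvgeNyPle => A; apply: up; rewrite ltNyr.
Unshelve. all: by end_near. Qed.

Lemma lne_rate_ge (N : nat) (x : R) (I : \bar R) : (0 < N)%N ->
  ((expR (N%:R * x))%:E <= I)%E -> (x%:E <= (N%:R^-1)%:E * lne I)%E.
Proof.
by move=> N0; rewrite expR_le_lne lee_pdivlMl ?ltr0n// EFinM.
Qed.

Lemma lne_rate_le (N : nat) (x : R) (I : \bar R) : (0 < N)%N ->
  (I <= (expR (N%:R * x))%:E)%E -> ((N%:R^-1)%:E * lne I <= x%:E)%E.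
Proof.
by move=> N0; rewrite -lne_le_expR lee_pdivrMl ?ltr0n// EFinM.
Qed.

End extended_limits.

Theorem theorem4p5 (R : realType) (m : nat) (D : set 'rV[R]_m)
  (d : nat -> measure_display) (Om : forall N, measurableType (d N))
  (P : forall N, probability (Om N) R)
  (H : forall N, 'rV[R]_m -> {RV (P N) >-> 'M[R]_N})
  (mu : nat -> 'rV[R]_m -> probability (measurableTypeR R) R)
  (muoo : 'rV[R]_m -> probability (measurableTypeR R) R)
  (* the domain *)
  (D_pos : (0 < leb m D)%E)
  (D_reg : D = closure (interior D))
  (H_sym : forall N u w, sym_mx (H N u w))
  (* assumptions locally uniform in u, with the matching limit measures *)
  (H_assumptions :
     (convexity_preserving H mu /\ limit_measures mu muoo dBL) \/
     (concentrated_input H mu /\ limit_measures mu muoo W1))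
  (* continuity and decay in u *)
  (H_cont : forall N, {ae P N, forall w, forall i j,
     continuous (fun u => H N u w i j)})
  (H_decay : exists2 C : R, 0 < C & forall N u, (0 < N)%N ->
     ('E_(P N)[fun w => `|\det (H N u w)|%R] <=
       ((C * Num.max (enorm u) 1) ^+ N)%:E)%E)
  (H_conc : superexp_concentration H muoo)
  (H_outliers : no_outliers H muoo D)
  (* topology *)
  (G_convex : forall eps : R, 0 < eps -> convex_set (goodset_eps muoo eps))
  (D_convex : convex_set D)
  (D_closed : closed D)
  (DG1_pos : (0 < leb m (D `&` goodset_eps muoo 1))%E)
  (DG_closure :
     closure (D `&` \bigcup_(eps in [set eps : R | 0 < eps])
                      goodset_eps muoo eps) = D `&` goodset muoo)
  (alpha p : R) (alpha_gt0 : 0 < alpha) :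
  (fun N : nat => (N%:R^-1)%:E *
     lne (\int[leb m]_(u in D)
       ((expR (- ((N%:R + p) * alpha * enorm u ^+ 2)))%:E *
        'E_(P N)[(fun w => `|\det (H N u w)| *
                   \1_[set w | psd (H N u w)] w)%R])))%E
  @ \oo -->
  ereal_sup [set (\int[muoo u]_x lne (`|x|%R)%:E -
                    (alpha * enorm u ^+ 2)%:E)%E | u in D `&` goodset muoo].
Proof.
have ctl (r : R) : 0 < r -> exists K k : R, [/\ 1 <= K, 0 < k,
    spectral_control H muoo (cball r) K, determinant_control H muoo (cball r) K &
    forall u, cball r u -> density_near0 (muoo u) `[- k, k]%classic k].
  move=> r0; have cQ := @compact_cball R m r.
  have Q0 : @cball R m r !=set0.
    exists 0; rewrite /cball/= /enorm big1 ?sqrtr0 ?ltW// => i _.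
    by rewrite mxE expr0n.
  case: H_assumptions => -[hH hlim].
    have [K [K1 sc dc]] := convexity_control H_sym hH hlim H_conc cQ Q0.
    have [k k0 hk] := hlim _ cQ.
    by exists K, k; split => // u ru; have [] := hk u ru.
  have [K [K1 sc dc]] := concentrated_control H_sym hH hlim cQ Q0.
  have [k k0 hk] := hlim _ cQ.
  by exists K, k; split => // u ru; have [] := hk u ru.
have [C C0 hdecay] := H_decay.
have rateE u : (\int[muoo u]_x lne (`|x|%R)%:E - (alpha * enorm u ^+ 2)%:E)%E =
    (rate muoo alpha u)%:E.
  by rewrite (logpot_EFin ctl).
apply: cvge_sandwich => [a|b].
  move=> /ereal_sup_gt[_ [u uA <-]]; rewrite rateE lte_fin => au.
  have crate : continuous (rate muoo alpha) by exact: (continuous_rate H_sym H_cont ctl).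
  have nA : nbhs u [set v | a < rate muoo alpha v].
    by apply: (crate u [set x | a < x]); apply: open_nbhs_nbhs; split => //; exact: open_gt.
  have : closure (D `&` \bigcup_(eps in [set eps : R | 0 < eps]) goodset_eps muoo eps) u.
    by rewrite DG_closure.
  move=> /(_ _ nA)[v [[Dv [eps /= eps0 gv]] av]].
  have e0 : 0 < rate muoo alpha v - a by rewrite subr_gt0.
  have h := lower_bound H_sym H_cont ctl H_conc p alpha_gt0 H_outliers G_convex D_convex
    D_closed DG1_pos eps0 e0 Dv gv.
  have h2 := nbhs_infty_gt 0%N.
  near=> N; apply: lne_rate_ge; first by near: N.
  have -> : a = rate muoo alpha v - (rate muoo alpha v - a) by rewrite subKr.
  by near: N.
set S := ereal_sup _ => Sb.
(* [upper_bound] requires a real majorant of the rate; one below [b] exists even if the supremum is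
   minus infinity. *)
have [s Ss sb] : exists2 s : R, (S <= s%:E)%E & s < b.
  case: S Sb => [x| |] // xb; first by exists x; rewrite -?lte_fin.
  by exists (b - 1); rewrite ?leNye// ltrBlDr ltrDl.
have rate_le u : D u -> goodset muoo u -> rate muoo alpha u <= s.
  move=> Du gu; rewrite -lee_fin -rateE; apply: le_trans Ss.
  by apply: ereal_sup_ubound; exists u.
have e0 : 0 < b - s by rewrite subr_gt0.
have h := upper_bound H_sym H_cont ctl H_conc p alpha_gt0 D_closed C0 hdecay rate_le e0.
have h2 := nbhs_infty_gt 0%N.
near=> N; apply: lne_rate_le; first by near: N.
have -> : b = s + (b - s) by rewrite subrKC.
by near: N.
Unshelve. all: by end_near. Qed.
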